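(* Let $\varphi:\Lambda\to\Gamma$ be a regular covering map of finite simplicial graphs such that $\Gamma$ (and hence $\Lambda$) has no isolated vertices. Then the group $\mathrm{LAut}(\varphi)$ of liftable automorphisms of $A_\Gamma$ is generated by liftable graph symmetries, inversions, liftable transvections and liftable partial conjugations.
   Context: Graphs are finite simplicial graphs; subgraphs are induced. $A_\Gamma=\langle v\in V\Gamma\mid [u,v]=1 \text{ for every edge }\{u,v\}\rangle$ is the right-angled Artin group. $\mathrm{lk}(v)$ is the subgraph induced by neighbours of $v$, $\mathrm{st}(v)$ the subgraph induced by $\mathrm{lk}(v)\cup\{v\}$. A covering map of graphs $\varphi:\Lambda\to\Gamma$ is a surjective simplicial map that maps the neighbours of each vertex $u$ bijectively onto the neighbours of $\varphi(u)$; it is regular if the group $\mathrm{Deck}(\varphi)$ of graph automorphisms $\mu$ of $\Lambda$ with $\varphi\mu=\varphi$ acts transitively on each fiber. Let $\phi:A_\Lambda\to A_\Gamma$ be the induced homomorphism $u\mapsto\varphi(u)$. $f\in\mathrm{Aut}(A_\Gamma)$ is liftable if there is $F\in\mathrm{Aut}(A_\Lambda)$ with $f\circ\phi=\phi\circ F$; $\mathrm{LAut}(\varphi)$ is the group of liftable automorphisms. Elementary automorphisms of $A_\Gamma$: a graph symmetry (graph automorphism of $\Gamma$ extended to $A_\Gamma$ by permuting generators); an inversion (sending each vertex $v$ to $v$ or $v^{-1}$); a transvection (for vertices $b\ne a$ with $\mathrm{lk}(b)\subseteq\mathrm{st}(a)$, the automorphism sending $b$ to $ba$ and fixing all other vertices);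 a partial conjugation $P^v_C$ (for a vertex $v$ and a union $C$ of connected components of $\Gamma\setminus\mathrm{st}(v)$, sending each vertex $w$ of $C$ to $vwv^{-1}$ and fixing all other vertices). *)

(* Defs.v *)
From mathcomp Require Import all_boot.
From Stdlib Require Import Relation_Operators.

Set Implicit Arguments.
Unset Strict Implicit.
Unset Printing Implicit Defensive.

Definition simple_graph (V : finType) (E : rel V) : Prop :=
  symmetric E /\ irreflexive E.

Definition no_isolated (V : finType) (E : rel V) : Prop :=
  forall v : V, exists w : V, E v w.

(** * Right-angled Artin groups, as words modulo the defining relations.
    A letter (v, b) stands for v if b = false and v^-1 if b = true. *)
Definition word (V : Type) := seq (V * bool).

Definition linv (V : Type) (x : V * bool) : V * bool := (x.1, ~~ x.2).
Definition winv (V : Type) (w : word V) : word V := rev (map (@linv V) w).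
Definition gen_word (V : Type) (v : V) : word V := [:: (v, false)].

Inductive raag_step (V : Type) (E : V -> V -> bool) : word V -> word V -> Prop :=
| step_free (w1 w2 : word V) (x : V * bool) :
    raag_step E (w1 ++ x :: linv x :: w2) (w1 ++ w2)
| step_comm (w1 w2 : word V) (a c : V) (b d : bool) :
    E a c ->
    raag_step E (w1 ++ (a, b) :: (c, d) :: w2) (w1 ++ (c, d) :: (a, b) :: w2).

Definition raag_eq (V : Type) (E : V -> V -> bool) : word V -> word V -> Prop :=
  clos_refl_sym_trans _ (raag_step E).

(** * Homomorphisms between RAAGs, given by the images of generators. *)
Definition subst (V U : Type) (f : V -> word U) (w : word V) : word U :=
  flatten (map (fun x => if x.2 then winv (f x.1) else f x.1) w).

Definition comp_end (V : Type) (g f : V -> word V) : V -> word V :=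
  fun v => subst g (f v).

Definition is_hom (V U : Type) (E : V -> V -> bool) (F : U -> U -> bool)
  (f : V -> word U) : Prop :=
  forall u v, E u v -> raag_eq F (f u ++ f v) (f v ++ f u).

Definition is_aut (V : Type) (E : V -> V -> bool) (f : V -> word V) : Prop :=
  is_hom E E f /\
  exists g : V -> word V, is_hom E E g /\
    (forall v, raag_eq E (subst g (f v)) (gen_word v)) /\
    (forall v, raag_eq E (subst f (g v)) (gen_word v)).

Definition end_eq (V : Type) (E : V -> V -> bool) (f g : V -> word V) : Prop :=
  forall v, raag_eq E (f v) (g v).

Inductive gen_aut (V : Type) (E : V -> V -> bool) (S : (V -> word V) -> Prop)
  : (V -> word V) -> Prop :=
| gen_base f : S f -> gen_aut E S f
| gen_one : gen_aut E S (@gen_word V)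
| gen_mul f g : gen_aut E S f -> gen_aut E S g -> gen_aut E S (comp_end g f)
| gen_inv f g : gen_aut E S f -> is_hom E E g ->
    end_eq E (comp_end g f) (@gen_word V) ->
    end_eq E (comp_end f g) (@gen_word V) -> gen_aut E S g
| gen_eq f g : gen_aut E S f -> end_eq E f g -> gen_aut E S g.

Definition map_word (W V : Type) (phi : W -> V) (w : word W) : word V :=
  map (fun x => (phi x.1, x.2)) w.

Definition is_covering (W V : finType) (EL : rel W) (EG : rel V)
  (phi : W -> V) : Prop :=
  (forall v : V, exists u : W, phi u = v) /\
  (forall u u' : W, EL u u' -> EG (phi u) (phi u')) /\
  (forall u : W,
     (forall u1 u2, EL u u1 -> EL u u2 -> phi u1 = phi u2 -> u1 = u2) /\
     (forall v, EG (phi u) v -> exists u', EL u u' /\ phi u' = v)).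

Definition graph_aut (W : finType) (EL : rel W) (mu : W -> W) : Prop :=
  bijective mu /\ forall u u', EL (mu u) (mu u') = EL u u'.

Definition is_deck (W V : finType) (EL : rel W) (phi : W -> V) (mu : W -> W) :=
  graph_aut EL mu /\ forall u, phi (mu u) = phi u.

Definition regular_covering (W V : finType) (EL : rel W) (EG : rel V)
  (phi : W -> V) : Prop :=
  is_covering EL EG phi /\
  forall u u' : W, phi u = phi u' -> exists mu, is_deck EL phi mu /\ mu u = u'.

Definition liftable (W V : finType) (EL : rel W) (EG : rel V) (phi : W -> V)
  (f : V -> word V) : Prop :=
  is_aut EG f /\
  exists F : W -> word W, is_aut EL F /\
    forall u : W, raag_eq EG (f (phi u)) (map_word phi (F u)).

Definition graph_symmetry (V : finType) (E : rel V) (f : V -> word V) : Prop :=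
  exists sigma : V -> V, graph_aut E sigma /\ forall v, f v = gen_word (sigma v).

Definition inversion (V : finType) (f : V -> word V) : Prop :=
  exists b : V -> bool, forall v, f v = [:: (v, b v)].

Definition transvection (V : finType) (E : rel V) (f : V -> word V) : Prop :=
  exists a b : V, a != b /\ (forall w, E b w -> w = a \/ E a w) /\
    forall v, f v = if v == b then [:: (b, false); (a, false)] else gen_word v.

(** partial conjugation P^v_C, C a union of connected components of
    Gamma \ st(v) *)
Definition partial_conj (V : finType) (E : rel V) (f : V -> word V) : Prop :=
  exists (v : V) (C : {set V}),
    (forall x, x \in C -> x != v /\ ~~ E v x) /\
    (forall x y, x \in C -> y != v -> ~~ E v y -> E x y -> y \in C) /\
    forall w, f w = if w \in C then [:: (v, false); (w, false); (v, true)]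
                    else gen_word w.

Definition LAut_gens (W V : finType) (EL : rel W) (EG : rel V) (phi : W -> V)
  (f : V -> word V) : Prop :=
  (graph_symmetry EG f /\ liftable EL EG phi f) \/
  inversion f \/
  (transvection EG f /\ liftable EL EG phi f) \/
  (partial_conj EG f /\ liftable EL EG phi f).

(* Main.v *)
(** Idea.  Work with exponent sums first.  A lift [F] of [f] acts on the
    abelianization of [A_L] by an invertible integer matrix, whose determinant
    is odd, so some permutation selects odd entries.  Minors of this matrix
    vanish on non-adjacent vertices (Heisenberg quotients), which forces the
    permutation to be a graph symmetry respecting the domination preorder
    [lk u <= st w]; dividing by a symmetry of [L] over one of [G], and then
    by transvections between adjacent vertices, which run the Euclidean algorithm
    on rows of the matrix, makes [F u] involve (in exponent sum) only vertices
    [w] with [lk u <= lk w].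

    Now use geometry.  The image of [v] translates a hyperplane with label
    equivalent to [v], and the images of the neighbours of [v] fix it; hence
    [f v] is conjugate into the group generated by the vertices dominating [v],
    compatibly with the lifts.  Cut each [f v] at its middle hyperplane of
    this kind.  If the resulting halfspaces are pairwise disjoint whenever the
    vertices are not adjacent, ping-pong shows that [f] permutes the
    generators up to inversion.  Otherwise two halfspaces are nested, and a liftable
    transvection or partial conjugation shortens the images of the vertices. *)

Require Import Defs.
From HB Require Import structures.
From mathcomp Require Import all_boot all_order all_algebra perm.
From mathcomp Require Import zify ring.
From Stdlib Require Import Relation_Operators Classical.

Set Implicit Arguments.
Unset Strict Implicit.
Unset Printing Implicit Defensive.
Import Order.TTheory GRing.Theory Num.Theory.

(** The obstacle is that every move must lift, so domination in [G] is the wrong order. It is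
    replaced by [pdom], domination between points of the fibres. Deck transformations carry a
    dominated pair to every point of the fibre. A vertex lies in the star of at most one point of
    each fibre; as every vertex has a neighbour, the dominating point in a fibre is unique, and
    exponent sums of a lift agree entry by entry with those below ([chi_lift]). Transvections
    between adjacent vertices are removed first because the vertices with [lk v <= lk w] are
    adjacent to all of [lk v]: together with [lk v] they generate a direct product, and images are
    located by cosets of it. Parity makes middle letters exist, since an odd number of letters has
    no tie. Both descents order vertices by increasing degree, because domination cannot lower the
    degree and is symmetric when the degree stays the same. The lift of a partial conjugation is
    assembled, by inclusion and exclusion, from partial conjugations of [A_L] at the various points
    over [v]. *)

Record graph := Graph {
  vert :> finType;
  adj : rel vert;
  adj_sym : symmetric adj;
  adj_irr : irreflexive adj }.
Arguments adj {g}.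

Lemma linvK (V : Type) : involutive (@linv V).
Proof. by case=> v b; rewrite /linv /= negbK. Qed.

(** * The piling model of a right-angled Artin group *)

Section Piling.
Context {G : graph}.
Implicit Types (x y : G * bool) (w : word G) (a c : G).

Lemma adj_neq a c : adj a c -> a != c.
Proof. by apply: contraTneq => ->; rewrite adj_irr. Qed.

(* A reduced word is recorded by one stack per vertex [a]: reading the word
   from its end, a letter on [a] puts its sign on stack [a] and an empty mark
   on the stack of each vertex not commuting with [a].  Commuting letters act
   on disjoint sets of stacks, so the piling only depends on the element. *)
Definition pile := {ffun G -> seq (option bool)}.
Implicit Types p q : pile.

Definition pile0 : pile := [ffun=> [::]].

Definition stack x p : pile :=
  [ffun c => if c == x.1 then Some x.2 :: p c
             else if adj x.1 c then p c else None :: p c].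

Definition pop a p : pile :=
  [ffun c => if (c == a) || ~~ adj a c then behead (p c) else p c].

Definition heads x p := ohead (p x.1) == Some (Some x.2).

Definition act x p : pile :=
  if heads (linv x) p then pop x.1 p else stack x p.

Definition pil w : pile := foldr act pile0 w.

(** Arbitrary families of stacks need not come from words. [good] cuts out the piles of reduced
    words, on which letters act by bijections. *)
Inductive good : pile -> Prop :=
| good0 : good pile0
| good_push x p : good p -> ~~ heads (linv x) p -> good (stack x p).

Lemma pop_push x p : pop x.1 (stack x p) = p.
Proof.
apply/ffunP=> c; rewrite !ffunE; case: eqVneq => //= _.
by case: (adj _ _).
Qed.

Lemma pop_push_linv x p : pop x.1 (stack (linv x) p) = p.
Proof. exact: (pop_push (linv x)). Qed.

Lemma push_comm x y p : adj x.1 y.1 -> stack x (stack y p) = stack y (stack x p).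
Proof.
move=> Exy; apply/ffunP=> c; rewrite !ffunE.
case: (eqVneq c x.1) => [->|nx].
  by rewrite (negPf (adj_neq Exy)) adj_sym Exy.
case: (eqVneq c y.1) => [->|ny]; first by rewrite Exy.
by case: (adj x.1 c); case: (adj y.1 c).
Qed.

Lemma heads_push x y p :
  heads y (stack x p) =
  if y.1 == x.1 then y.2 == x.2 else if adj x.1 y.1 then heads y p else false.
Proof.
rewrite /heads !ffunE; case: ifP => _ /=.
  by rewrite eq_sym; apply/eqP/eqP => [[]|->].
by case: ifP.
Qed.

Lemma heads_push_id x p : heads x (stack x p).
Proof. by rewrite heads_push !eqxx. Qed.

Lemma heads_push_adj x y p : adj x.1 y.1 -> heads y (stack x p) = heads y p.
Proof. by move=> E; rewrite heads_push eq_sym (negPf (adj_neq E)) E. Qed.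

(** A letter visible on its own stack can be shuffled to the front: the letters pushed after it left
    no mark on that stack, hence commute with it. *)
Lemma good_heads p x : good p -> heads x p ->
  exists q, [/\ good q, ~~ heads (linv x) q & p = stack x q].
Proof.
move=> gp; elim: gp x => [|y q gq IH ny] x.
  by rewrite /heads ffunE.
rewrite heads_push; case: (eqVneq x.1 y.1) => [e1 /eqP e2|_].
  have -> : x = y by case: (x) (y) e1 e2 => [? ?] [? ?] /= -> ->.
  by exists q.
case: ifP => // Eyx tx; have [r [gr nr er]] := IH _ tx.
exists (stack y r); split; last by rewrite er push_comm.
  by apply: good_push => //; move: ny; rewrite er heads_push_adj //= adj_sym.
by rewrite heads_push_adj.
Qed.

Lemma act_push x p : ~~ heads (linv x) p -> act x p = stack x p.
Proof. by rewrite /act => /negPf->. Qed.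

Lemma act_pop x p : act (linv x) (stack x p) = p.
Proof. by rewrite /act linvK heads_push_id /= pop_push. Qed.

Lemma act_popV x p : act x (stack (linv x) p) = p.
Proof. by rewrite -{1}[x]linvK act_pop. Qed.

Lemma act_good x p : good p -> good (act x p).
Proof.
move=> gp; rewrite /act; case: ifPn => h; last exact: good_push.
by have [q [gq _ ->]] := good_heads gp h; rewrite pop_push_linv.
Qed.

Lemma good_foldr p w : good p -> good (foldr act p w).
Proof. by move=> gp; elim: w => //= x w; apply: act_good. Qed.

Lemma good_pil w : good (pil w).
Proof. by apply: good_foldr; constructor. Qed.

Lemma actK x p : good p -> act (linv x) (act x p) = p.
Proof.
move=> gp; have [h|h] := boolP (heads (linv x) p).
  have [q [gq nq ->]] := good_heads gp h.
  by rewrite -{2}[x]linvK act_pop act_push // linvK.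
by rewrite (act_push h) act_pop.
Qed.

Lemma act_comm x y p : good p -> adj x.1 y.1 ->
  act x (act y p) = act y (act x p).
Proof.
move=> gp Exy; have Eyx : adj y.1 x.1 by rewrite adj_sym.
(* If [y] cancels on [p], then [p] is the result of [linv y] acting without cancellation on a
   smaller pile, and that case is used instead. *)
wlog: x y p gp Exy Eyx / ~~ heads (linv y) p.
  move=> W; have [h|h] := boolP (heads (linv y) p); last exact: W.
  have [q [gq nq ->]] := good_heads gp h.
  rewrite -(act_push nq) (W x (linv y) q) //.
  by rewrite -{1 3}[y]linvK !actK //; apply: act_good.
have [h|h] := boolP (heads (linv x) p) => ny.
  have [q [gq nq ep]] := good_heads gp h; rewrite ep.
  have ny' : ~~ heads (linv y) q by move: ny; rewrite ep heads_push_adj.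
  rewrite act_popV (act_push ny') -ep (act_push ny) ep.
  by rewrite push_comm // act_popV.
rewrite (act_push ny) (act_push h) act_push ?heads_push_adj //.
by rewrite push_comm // act_push ?heads_push_adj.
Qed.

Lemma raag_eq_foldr p w w' : good p -> raag_eq adj w w' ->
  foldr act p w = foldr act p w'.
Proof.
move=> gp; elim=> [u v []|//|u v _ -> //|u v t _ -> _ -> //].
  move=> w1 w2 x; rewrite !foldr_cat /=; congr (foldr act _ w1).
  by rewrite -{1}[x]linvK actK //; apply: good_foldr.
move=> w1 w2 a c b d E; rewrite !foldr_cat /=; congr (foldr act _ w1).
by rewrite act_comm //; apply: good_foldr.
Qed.

Lemma raag_eq_refl w : raag_eq adj w w. Proof. exact: rst_refl. Qed.

Lemma raag_eq_trans w1 w2 w3 :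
  raag_eq adj w1 w2 -> raag_eq adj w2 w3 -> raag_eq adj w1 w3.
Proof. exact: rst_trans. Qed.

Lemma raag_eq_sym w1 w2 : raag_eq adj w1 w2 -> raag_eq adj w2 w1.
Proof. exact: rst_sym. Qed.

Lemma raag_eq_ctx u v w w' :
  raag_eq adj w w' -> raag_eq adj (u ++ w ++ v) (u ++ w' ++ v).
Proof.
elim=> [w1 w2 []|//|w1 w2 _|w1 w2 w3 _ h1 _ h2].
- move=> s1 s2 x; apply: rst_step; rewrite -!catA !cat_cons.
  by rewrite (catA u) (catA u); constructor.
- move=> s1 s2 a c b d E; apply: rst_step; rewrite -!catA !cat_cons.
  by rewrite (catA u) (catA u); constructor.
- by move=> ?; apply: raag_eq_refl.
- exact: raag_eq_sym.
- exact: raag_eq_trans h1 h2.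
Qed.

Lemma raag_eq_cons x w w' : raag_eq adj w w' -> raag_eq adj (x :: w) (x :: w').
Proof. by move=> h; have := raag_eq_ctx [:: x] [::] h; rewrite !cats0. Qed.

(** Pushes only, with no cancellation test: a word is recovered from such a pile up to commutations
    alone. *)
Definition spells w p := p = foldr stack pile0 w.

Lemma spells_heads x w p : spells w p -> heads x p ->
  exists2 w', spells (x :: w') p & raag_eq adj w (x :: w').
Proof.
elim: w x p => [|y w IH] x p -> /=; first by rewrite /heads ffunE.
rewrite heads_push; case: (eqVneq x.1 y.1) => [e1 /eqP e2|_].
  have -> : x = y by case: (x) (y) e1 e2 => [? ?] [? ?] /= -> ->.
  by exists w => //; apply: raag_eq_refl.
case: ifP => // Eyx tx; have [w' sp e] := IH x _ (erefl _) tx.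
exists (y :: w'); first by rewrite /spells /= push_comm 1?adj_sym // -[stack x _]sp.
apply: (raag_eq_trans (raag_eq_cons _ e)); apply: rst_step.
by case: (x) (y) Eyx => [a b] [c d] /= E; apply: (@step_comm _ _ [::]).
Qed.

Lemma spells_eq w w' p : spells w p -> spells w' p -> raag_eq adj w w'.
Proof.
elim: w w' p => [|x w IH] w' p sp sp'.
  case: w' sp' sp => [|x w'] -> => [_|e]; first exact: raag_eq_refl.
  by have := heads_push_id x (foldr stack pile0 w'); rewrite [stack _ _]e /heads ffunE.
have hx : heads x p by rewrite sp heads_push_id.
have [w1 sp1 e1] := spells_heads sp' hx.
apply: raag_eq_trans (raag_eq_sym e1); apply: raag_eq_cons.
apply: (IH _ (pop x.1 p)); first by rewrite sp pop_push.
by rewrite sp1 pop_push.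
Qed.

Lemma spells_ex w : exists2 w', spells w' (pil w) & raag_eq adj w w'.
Proof.
elim: w => [|x w [w' sp e]]; first by exists [::] => //; apply: raag_eq_refl.
rewrite /= /act; case: ifPn => h; last first.
  by exists (x :: w'); [rewrite sp | apply: raag_eq_cons].
have [w1 sp1 e1] := spells_heads sp h.
exists w1; first by rewrite sp1 pop_push_linv.
apply: raag_eq_trans (raag_eq_cons x (raag_eq_trans e e1)) _.
by apply: rst_step; apply: (@step_free _ _ [::]).
Qed.

(** Piles solve the word problem: every word is equivalent to one that spells its pile, and words
    spelling the same pile are equivalent. *)
Lemma raag_eqP w w' : raag_eq adj w w' <-> pil w = pil w'.
Proof.
split=> [|e]; first by apply: raag_eq_foldr; constructor.
have [[u su eu] [v sv ev]] := (spells_ex w, spells_ex w').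
rewrite e in su; apply: (raag_eq_trans eu).
exact: raag_eq_trans (spells_eq su sv) (raag_eq_sym ev).
Qed.

Lemma pil_cat u u' v v' :
  pil u = pil u' -> pil v = pil v' -> pil (u ++ v) = pil (u' ++ v').
Proof.
move=> /raag_eqP eu ev; rewrite /pil !foldr_cat -!/(pil _) ev.
exact: raag_eq_foldr (good_pil _) eu.
Qed.

Lemma winv_cons x w : winv (x :: w) = winv w ++ [:: linv x].
Proof. by rewrite /winv /= rev_cons cats1. Qed.

Lemma pil_winv w : pil (winv w ++ w) = pile0.
Proof.
elim: w => //= x w IH; rewrite winv_cons -catA /=.
rewrite -IH /pil !foldr_cat /= actK //; exact: good_pil.
Qed.

Lemma winvK w : winv (winv w) = w.
Proof. by elim: w => // x w IH; rewrite winv_cons /winv map_cat rev_cat -/(winv _) /= -/(winv _) IH linvK. Qed.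

Lemma pil_winvr w : pil (w ++ winv w) = pile0.
Proof. by rewrite -{1}[w]winvK pil_winv. Qed.

(** One word is chosen per pile, so that group elements form a subtype of words and equality in the
    group is Leibniz equality. *)
Definition nf w : word G := choose (fun w' => pil w' == pil w) w.

Lemma pil_nf w : pil (nf w) = pil w.
Proof. by apply/eqP; apply: (@chooseP _ (fun w' => pil w' == pil w)). Qed.

Lemma nf_eq w w' : pil w = pil w' -> nf w = nf w'.
Proof.
move=> e; rewrite /nf -e; apply: choose_id => //.
by rewrite e.
Qed.

Lemma nf_nf w : nf (nf w) == nf w.
Proof. by apply/eqP/nf_eq/pil_nf. Qed.

End Piling.
Arguments pile : clear implicits.

(** * The group of words in normal form *)

Record raag (G : graph) := Raag { rword : word G; _ : nf rword == rword }.
Bind Scope group_scope with raag.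
HB.instance Definition _ (G : graph) := [isSub for @rword G].
HB.instance Definition _ (G : graph) := [Choice of raag G by <:].

Section RaagGroup.
Context {G : graph}.
Implicit Types (g h : raag G) (w : word G).

Definition wd w : raag G := Raag (nf_nf w).
Definition pl g : pile G := pil (rword g).

Lemma pl_wd w : pl (wd w) = pil w. Proof. exact: pil_nf. Qed.

Lemma pl_inj : injective pl.
Proof.
by move=> g h e; apply/val_inj; rewrite /= -(eqP (valP g)) -(eqP (valP h)); apply: nf_eq.
Qed.

Lemma rwordK g : wd (rword g) = g.
Proof. by apply: pl_inj; rewrite pl_wd. Qed.

Lemma wdP w w' : wd w = wd w' <-> raag_eq adj w w'.
Proof.
split=> [e|/raag_eqP e]; last by apply: pl_inj; rewrite !pl_wd.
by apply/raag_eqP; rewrite -!pl_wd e.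
Qed.

Definition raag_mul g h := wd (rword g ++ rword h).
Definition raag_inv g := wd (winv (rword g)).

Lemma wd_cat_mul u v : wd (u ++ v) = raag_mul (wd u) (wd v).
Proof. by apply: pl_inj; rewrite !pl_wd; apply: pil_cat; rewrite pil_nf. Qed.

Lemma raag_mulA : associative raag_mul.
Proof.
move=> g h k; rewrite -[g]rwordK -[h]rwordK -[k]rwordK.
by rewrite -!wd_cat_mul catA.
Qed.

Lemma raag_mul1 : left_id (wd [::]) raag_mul.
Proof. by move=> g; rewrite -[g]rwordK -wd_cat_mul. Qed.

Lemma raag_mulr1 : right_id (wd [::]) raag_mul.
Proof. by move=> g; rewrite -[g]rwordK -wd_cat_mul cats0. Qed.

Lemma raag_mulV : left_inverse (wd [::]) raag_inv raag_mul.
Proof.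
move=> g; rewrite -{2}[g]rwordK -wd_cat_mul; apply: pl_inj.
by rewrite !pl_wd pil_winv.
Qed.

Lemma raag_mulrV : right_inverse (wd [::]) raag_inv raag_mul.
Proof.
move=> g; rewrite -{1}[g]rwordK -wd_cat_mul; apply: pl_inj.
by rewrite !pl_wd pil_winvr.
Qed.

End RaagGroup.

HB.instance Definition _ (G : graph) :=
  isGroup.Build (raag G) raag_mulA raag_mul1 raag_mulr1 raag_mulV raag_mulrV.

Local Open Scope group_scope.
Section WdMorph.
Context {G : graph}.
Implicit Types (g h : raag G) (w : word G) (x y : G * bool) (a : G).

Lemma wd_cat u v : wd (u ++ v) = wd u * wd v :> raag G.
Proof. exact: wd_cat_mul. Qed.

Lemma wd0 : wd [::] = 1 :> raag G. Proof. by []. Qed.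

Lemma wd_inv w : wd (winv w) = (wd w)^-1 :> raag G.
Proof.
apply/esym/mulg1_eq; rewrite -wd_cat; apply: pl_inj.
by rewrite !pl_wd pil_winvr.
Qed.

Definition lt x : raag G := wd [:: x].
Definition gn a : raag G := lt (a, false).

Lemma wd_cons x w : wd (x :: w) = lt x * wd w.
Proof. by rewrite -wd_cat. Qed.

Lemma lt_inv x : lt (linv x) = (lt x)^-1.
Proof. by rewrite -wd_inv. Qed.

Lemma lt_comm x y : adj x.1 y.1 -> commute (lt x) (lt y).
Proof.
move=> E; rewrite /commute -!wd_cat; apply/wdP/rst_step.
by case: (x) (y) E => [a b] [c d] /= E; apply: (@step_comm _ _ [::]).
Qed.

Lemma pl_ltM x g : pl (lt x * g) = act x (pl g).
Proof. by rewrite -[g]rwordK -wd_cons !pl_wd. Qed.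

Lemma pl_good g : good (pl g). Proof. exact: good_pil. Qed.

Lemma pl1 : pl (1 : raag G) = pile0. Proof. by rewrite -wd0 pl_wd. Qed.

End WdMorph.

(* The group laws restated for [raag G]: rewriting with the generic ones leaves
   structure projections in the terms, which arithmetic tactics do not see
   through. *)
Section GroupLaws.
Context {G : graph}.
Implicit Types g h k : raag G.

Lemma mulgA g h k : g * (h * k) = g * h * k. Proof. exact: mulgA. Qed.
Lemma mul1g g : 1 * g = g. Proof. exact: mul1g. Qed.
Lemma mulg1 g : g * 1 = g. Proof. exact: mulg1. Qed.
Lemma mulVg g : g^-1 * g = 1. Proof. exact: mulVg. Qed.
Lemma mulgV g : g * g^-1 = 1. Proof. exact: mulgV. Qed.
Lemma mulKg g h : g^-1 * (g * h) = h. Proof. exact: mulKg. Qed.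
Lemma mulVKg g h : g * (g^-1 * h) = h. Proof. exact: mulVKg. Qed.
Lemma mulgK g h : h * g * g^-1 = h. Proof. exact: mulgK. Qed.
Lemma mulgVK g h : h * g^-1 * g = h. Proof. exact: mulgVK. Qed.
Lemma invgK g : g^-1^-1 = g. Proof. exact: invgK. Qed.
Lemma invgM g h : (g * h)^-1 = h^-1 * g^-1. Proof. exact: invgM. Qed.
Lemma invg1 : 1^-1 = 1 :> raag G. Proof. exact: invg1. Qed.

End GroupLaws.

(** * Reduced products, supports and parabolic subgroups *)

Section Reduced.
Context {G : graph}.
Implicit Types (g h k p q d : raag G) (w : word G) (x y s t : G * bool) (a c : G).
Implicit Types P Q : pred G.

Definition hd x g := heads x (pl g).
Definition cnt a g := count isSome (pl g a).

(* The product [g * h] is reduced. *)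
Definition rd g h := forall a, cnt a (g * h) = (cnt a g + cnt a h)%N.

Definition inp P g := forall a, 0 < cnt a g -> P a.

Lemma ltVK x g : lt (linv x) * (lt x * g) = g.
Proof. by rewrite lt_inv mulKg. Qed.

Lemma ltKV x g : lt x * (lt (linv x) * g) = g.
Proof. by rewrite lt_inv mulVKg. Qed.

Lemma hd_linv x g : hd x (lt x * g) = ~~ hd (linv x) g.
Proof.
rewrite /hd pl_ltM; have [h|h] := boolP (heads _ (pl g)); last first.
  by rewrite act_push // heads_push_id.
have [q [gq nq ->]] := good_heads (pl_good g) h.
by rewrite act_popV; apply/negbTE; rewrite linvK in nq.
Qed.

Lemma hdE x g : hd x g -> exists2 h, g = lt x * h & ~~ hd (linv x) h.
Proof.
move=> hx; exists (lt (linv x) * g); first by rewrite ltKV.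
by rewrite -hd_linv ltKV.
Qed.

Lemma pl_ltM_rd x g : ~~ hd (linv x) g -> pl (lt x * g) = stack x (pl g).
Proof. by move=> n; rewrite pl_ltM act_push. Qed.

Lemma cnt1 a : cnt a 1 = 0%N.
Proof. by rewrite /cnt pl1 ffunE. Qed.

Lemma hd1 x : hd x 1 = false.
Proof. by rewrite /hd pl1 /heads ffunE. Qed.

Lemma cnt_ltM a x g : ~~ hd (linv x) g -> cnt a (lt x * g) = ((a == x.1) + cnt a g)%N.
Proof.
move=> n; rewrite /cnt pl_ltM_rd // ffunE; case: ifP => // _.
by case: ifP.
Qed.

Lemma raag_ind (R : raag G -> Prop) : R 1 ->
  (forall x g, ~~ hd (linv x) g -> R g -> R (lt x * g)) -> forall g, R g.
Proof.
move=> R1 RS g; have := pl_good g; move: {-1}(pl g) (erefl (pl g)) => p e gp.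
elim: gp g e => [|x q gq IH nq] g e; first by rewrite (_ : g = 1) //; apply: pl_inj; rewrite pl1.
have hx : hd x g by rewrite /hd e heads_push_id.
have [h eg nh] := hdE hx; rewrite eg; apply: RS => //; apply: IH.
by move: e; rewrite eg pl_ltM_rd // => /(congr1 (pop x.1)); rewrite !pop_push.
Qed.

Lemma cnt_lt a x : cnt a (lt x) = (a == x.1).
Proof. by rewrite -[lt x]mulg1 cnt_ltM ?hd1 // cnt1 addn0. Qed.

Lemma cnt_ltM_le a x g : cnt a (lt x * g) <= (a == x.1) + cnt a g.
Proof.
have [h|n] := boolP (hd (linv x) g); last by rewrite cnt_ltM.
have [k -> nk] := hdE h; rewrite ltKV cnt_ltM //=; lia.
Qed.

Lemma cntM_le a g h : cnt a (g * h) <= cnt a g + cnt a h.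
Proof.
elim/raag_ind: g => [|x g n IH]; first by rewrite mul1g cnt1.
rewrite (cnt_ltM _ n) -mulgA; apply: leq_trans (cnt_ltM_le _ _ _) _; lia.
Qed.

Lemma cntV a g : cnt a g^-1 = cnt a g.
Proof.
suff le h : cnt a h^-1 <= cnt a h.
  by apply/eqP; rewrite eqn_leq le -{1}[g]invgK le.
elim/raag_ind: h => [|x h n IH]; first by rewrite invg1.
rewrite invgM -lt_inv cnt_ltM //; apply: leq_trans (cntM_le _ _ _) _.
rewrite cnt_lt /=; lia.
Qed.

Lemma hd_cnt x g : hd x g -> 0 < cnt x.1 g.
Proof. by move=> /hdE[h -> n]; rewrite cnt_ltM // eqxx. Qed.

Lemma raag_case g : g = 1 \/ exists x, hd x g.
Proof.
elim/raag_ind: g => [|x g n _]; [by left|right; exists x].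
by rewrite hd_linv.
Qed.

Lemma cnt_eq0 g : (forall a, cnt a g = 0%N) -> g = 1.
Proof. by move=> h; case: (raag_case g) => // -[x /hd_cnt]; rewrite h. Qed.

Lemma rd_lt x g : rd (lt x) g <-> ~~ hd (linv x) g.
Proof.
split=> [h|n a]; last by rewrite cnt_ltM // cnt_lt.
apply/negP => hx; have := h x.1; have [k e n] := hdE hx.
by rewrite e ltKV cnt_ltM //= cnt_lt eqxx; lia.
Qed.

Lemma rd1g g : rd 1 g. Proof. by move=> a; rewrite mul1g cnt1. Qed.
Lemma rd_hd x g : hd x g -> rd (lt x) (lt (linv x) * g).
Proof. by move=> h; apply/rd_lt; rewrite -hd_linv ltKV. Qed.

Lemma rdV g h : rd g h -> rd h^-1 g^-1.
Proof. by move=> r a; rewrite -invgM !cntV r addnC. Qed.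

Lemma rd_assocl g h k : rd g h -> rd (g * h) k -> rd h k /\ rd g (h * k).
Proof.
move=> r1 r2; have L a : cnt a (g * (h * k)) = (cnt a g + cnt a h + cnt a k)%N.
  by rewrite mulgA r2 r1.
by split=> a; have := L a; have := cntM_le a g (h * k); have := cntM_le a h k; lia.
Qed.

Lemma rd_assocr g h k : rd h k -> rd g (h * k) -> rd g h /\ rd (g * h) k.
Proof.
move=> r1 r2; have L a : cnt a (g * h * k) = (cnt a g + cnt a h + cnt a k)%N.
  by rewrite -mulgA r2 r1 addnA.
by split=> a; have := L a; have := cntM_le a (g * h) k; have := cntM_le a g h; lia.
Qed.

Lemma hd_rd x g h : rd g h -> hd x g -> hd x (g * h).
Proof.
move=> r hx; have [k e n] := hdE hx; rewrite e in r *.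
have [_] := rd_assocl (proj2 (rd_lt x k) n) r.
by rewrite -mulgA rd_lt hd_linv.
Qed.

Lemma hd_adj x y g : adj x.1 y.1 -> hd y (lt x * g) = hd y g.
Proof.
move=> E; rewrite /hd pl_ltM /act; case: ifP => h; last exact: heads_push_adj.
have [q [gq nq ->]] := good_heads (pl_good g) h.
by rewrite pop_push_linv heads_push_adj.
Qed.

Lemma hd_diamond x y g : hd x g -> hd y g -> x = y \/ adj x.1 y.1.
Proof.
move=> /hdE[h -> n]; rewrite /hd pl_ltM_rd // heads_push.
case: ifP => [/eqP e1 /eqP e2|_]; last by case: ifP; [right|].
by left; case: (x) (y) e1 e2 => [? ?] [? ?] /= -> ->.
Qed.

Lemma inp1 P : inp P 1. Proof. by move=> a; rewrite cnt1. Qed.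

Lemma inpM P g h : inp P g -> inp P h -> inp P (g * h).
Proof.
move=> hg hh a ha; have := cntM_le a g h.
have [z|/hg//] := posnP (cnt a g).
by have [z'|/hh//] := posnP (cnt a h); lia.
Qed.

Lemma inpV P g : inp P g -> inp P g^-1.
Proof. by move=> h a; rewrite cntV; apply: h. Qed.

Lemma inp_lt P x : inp P (lt x) <-> P x.1.
Proof.
split=> [h|h a]; first by apply: h; rewrite cnt_lt eqxx.
by rewrite cnt_lt; case: eqP => [->|].
Qed.

Lemma inp_sub P Q g : (forall a, P a -> Q a) -> inp P g -> inp Q g.
Proof. by move=> s h a /h/s. Qed.

Lemma inpM_rd P g h : rd g h -> inp P (g * h) -> inp P g /\ inp P h.
Proof. by move=> r i; split=> a ha; apply: i; rewrite r; lia. Qed.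

Lemma inp_ind P (R : raag G -> Prop) : R 1 ->
  (forall x g, P x.1 -> inp P g -> ~~ hd (linv x) g -> R g -> R (lt x * g)) ->
  forall g, inp P g -> R g.
Proof.
move=> R1 RS; elim/raag_ind => // x g n IH i.
have [ix ig] := inpM_rd (proj2 (rd_lt x g) n) i.
by apply: RS => //; [apply/(inp_lt P) | apply: IH].
Qed.

Lemma commute_gen P g h : (forall x, P x.1 -> commute (lt x) h) -> inp P g -> commute g h.
Proof.
move=> c; elim/inp_ind => [|x k px _ _ IH]; first exact/commute_sym/commute1.
by apply/commute_sym/commuteM; apply/commute_sym => //; apply: c.
Qed.

Lemma inp_comm P Q g h : (forall a c, P a -> Q c -> adj a c) ->
  inp P g -> inp Q h -> commute g h.
Proof.
move=> E ig ih; apply: commute_gen ig => x px; apply/commute_sym.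
by apply: commute_gen ih => y py; apply: lt_comm; rewrite adj_sym; apply: E.
Qed.

Lemma adj_comm x g : inp (adj x.1) g -> commute (lt x) g.
Proof.
apply: (@inp_comm (pred1 x.1)) => [a c /eqP->//|].
by apply/inp_lt => /=.
Qed.

Lemma hd_inp_adj y g h : inp (adj y.1) g -> hd y (g * h) = hd y h.
Proof.
elim/inp_ind => [|x k E _ _ IH]; first by rewrite mul1g.
by rewrite -mulgA hd_adj // adj_sym.
Qed.

Lemma hdM x p q : rd p q -> hd x (p * q) ->
  hd x p \/ inp (adj x.1) p /\ hd x q.
Proof.
elim/raag_ind: p => [_|y p n IH r]; first by rewrite mul1g; right; split=> //; apply: inp1.
have [r1 r2] := rd_assocl (proj2 (rd_lt y p) n) r; move/rd_lt: (r2) => n2.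
rewrite -mulgA => hx; have hy : hd y (lt y * (p * q)) by rewrite hd_linv.
case: (hd_diamond hx hy) => [->|E]; first by left; rewrite hd_linv.
rewrite hd_adj 1?adj_sym // in hx; case: (IH r1 hx) => [|[ip hq]].
  by left; rewrite hd_adj 1?adj_sym.
by right; split=> //; apply: inpM => //; apply/inp_lt.
Qed.

Lemma rd_dec g h : rd g h \/ ~ rd g h.
Proof.
have [/forallP r|n] := boolP [forall a, cnt a (g * h) == (cnt a g + cnt a h)%N].
  by left=> a; apply/eqP.
by right=> r; case/forallP: n => a; rewrite r.
Qed.

(** In the inductive step the letter cancelled by [y] has come to the front through all of [g], so
    it commutes with [g], and [y] can be moved to the junction. *)
Lemma rdN g h : ~ rd g h -> exists2 t, hd t g^-1 & hd t h.
Proof.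
elim/raag_ind: g => [|y g n IH] r; first by case: r; apply: rd1g.
have rg : rd (lt y) g by apply/rd_lt.
case: (rd_dec g h) => [r1|/IH[t h1 h2]]; last first.
  by exists t => //; rewrite invgM; apply: hd_rd => //; apply: rdV.
have [hy|ny] := boolP (hd (linv y) (g * h)); last first.
  by case: r; have [] := rd_assocr r1 (proj2 (rd_lt y _) ny).
case: (hdM r1 hy) => [|[ig hh]]; first by rewrite (negPf n).
exists (linv y) => //; rewrite (@adj_comm y g ig) invgM -lt_inv hd_linv linvK.
by apply/negP=> /hd_cnt; rewrite cntV => /ig; rewrite /= adj_irr.
Qed.

Lemma hd_lt x y : hd x (lt y) = (x == y).
Proof.
apply/idP/eqP => [h|->]; last by rewrite -[lt y]mulg1 hd_linv hd1.
have hy : hd y (lt y) by rewrite -[lt y]mulg1 hd_linv hd1.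
case: (hd_diamond h hy) => // E; have := hd_cnt h; rewrite cnt_lt.
by rewrite (negPf (adj_neq E)).
Qed.

(** Right multiplication by a letter on another vertex crosses no hyperplane labelled [s.1], so it
    neither enters nor leaves the halfspace of first letter [s]. *)
Lemma hdMr s q h : inp (predC1 s.1) h -> hd s (q * h) = hd s q.
Proof.
have H (u : raag G) (p : G * bool) : rd u (lt p) -> p.1 != s.1 -> hd s (u * lt p) = hd s u.
  move=> r np; apply/idP/idP => [h0|]; last exact: hd_rd.
  by case: (hdM r h0) => // -[_]; rewrite hd_lt => /eqP e; rewrite e eqxx in np.
move=> ih; elim/inp_ind: h / ih q => [|x h nx _ _ IH] q; first by rewrite mulg1.
rewrite mulgA IH; case: (rd_dec q (lt x)) => [r|/rdN[t h1]]; first exact: H.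
rewrite hd_lt => /eqP e; rewrite {t}e in h1; have [r e n] := hdE h1.
have e' : q = r^-1 * lt (linv x) by rewrite lt_inv -invgM -e invgK.
rewrite e' -mulgA lt_inv mulVg mulg1 -lt_inv H //.
by rewrite lt_inv; apply: rdV; apply/rd_lt.
Qed.

Definition lmin P g := forall x, P x.1 -> ~~ hd x g.
Definition rmin P g := lmin P g^-1.

Lemma lmin_rd P h g : lmin P g -> inp P h -> rd h g.
Proof.
move=> mg; elim/inp_ind => [|x k px _ n IH]; first exact: rd1g.
have [] := @rd_assocr (lt x) k g => //; apply/rd_lt/negP => hx.
by case: (hdM IH hx) => [|[_]]; apply/negP => //; apply: mg.
Qed.

Lemma rmin_rd P h g : rmin P g -> inp P h -> rd g h.
Proof. by move=> mg /inpV ih; rewrite -[g]invgK -[h]invgK; apply/rdV/lmin_rd/ih. Qed.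

Definition len g := (\sum_a cnt a g)%N.

Lemma len_hd x g : hd x g -> len (lt (linv x) * g) < len g.
Proof.
move=> hx; rewrite /len (bigD1 x.1) //= [ltnRHS](bigD1 x.1) //=.
have r := rd_hd hx; have E a : cnt a g = ((a == x.1) + cnt a (lt (linv x) * g))%N.
  by rewrite -cnt_lt -r ltKV.
rewrite E eqxx add1n addSn ltnS leq_add2l; apply: leq_sum => a _; rewrite [leqRHS]E; lia.
Qed.

Lemma len_hdV x g : hd x g^-1 -> len (g * lt x) < len g.
Proof.
move/len_hd; rewrite lt_inv -invgM /len.
by under eq_bigr do rewrite cntV; under [ltnRHS]eq_bigr do rewrite cntV.
Qed.

Lemma lmin_dec P g : exists h g1, [/\ g = h * g1, inp P h & lmin P g1].
Proof.
have [n] := ubnP (len g); elim: n g => // n IH g lg.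
case: (pickP (fun x => P x.1 && hd x g)) => [x /andP[px hx]|nx]; last first.
  exists 1, g; split; [by rewrite mul1g | exact: inp1 |].
  by move=> x px; apply/negP => hx; have := nx x; rewrite px hx.
have [h [g1 [e ih mg]]] := IH (lt (linv x) * g) (leq_trans (len_hd hx) lg).
exists (lt x * h), g1; split => //; first by rewrite -mulgA -e ltKV.
by apply: inpM => //; apply/inp_lt.
Qed.

Lemma rmin_dec P g : exists g1 h, [/\ g = g1 * h, inp P h & rmin P g1].
Proof.
have [h [g1 [e ih mg]]] := lmin_dec P g^-1; exists g1^-1, h^-1; split.
- by rewrite -invgM -e invgK.
- exact: inpV.
- by rewrite /rmin invgK.
Qed.

Lemma double_coset_dec P Q g : exists h d k,
  [/\ g = h * d * k, inp P h, inp Q k, lmin P d & rmin Q d].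
Proof.
have [n] := ubnP (len g); elim: n g => // n IH g lg.
case: (pickP (fun x => P x.1 && hd x g)) => [x /andP[px hx]|nx].
  have [a [d [b [e ia ib ld rd]]]] := IH (lt (linv x) * g) (leq_trans (len_hd hx) lg).
  exists (lt x * a), d, b; split => //; first by rewrite -!mulgA [a * _]mulgA -e ltKV.
  by apply: inpM => //; apply/inp_lt.
case: (pickP (fun x => Q x.1 && hd x g^-1)) => [x /andP[px hx]|nx'].
  have [a [d [b [e ia ib ld rd]]]] := IH (g * lt x) (leq_trans (len_hdV hx) lg).
  exists a, d, (b * lt (linv x)); split => //; first by rewrite mulgA -e lt_inv mulgK.
  by apply: inpM => //; apply/(@inp_lt Q).
exists 1, g, 1; split; [by rewrite mul1g mulg1 | exact: inp1 | exact: inp1 | |].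
  by move=> x px; apply/negP => hx; have := nx x; rewrite px hx.
by move=> x px; apply/negP => hx; have := nx' x; rewrite px hx.
Qed.

(** A first letter of [k] is a first letter of [d * l]; minimality keeps it from beginning [d], so
    it commutes with [d] and begins [l], and can be cancelled on both sides. This turns conjugacy
    relations between parabolic subgroups into conditions on supports. *)
Lemma double_coset_comm P Q d k l : lmin P d -> rmin Q d -> inp P k -> inp Q l ->
  k * d = d * l -> k = l /\ forall a, 0 < cnt a k -> inp (adj a) d.
Proof.
move=> ld rmd ik; elim/inp_ind: k / ik l => [|x k px ik n IH] l il e.
  split; last by move=> a; rewrite cnt1.
  by apply: (@mulgI _ d); rewrite -e mulg1 mul1g.
have rk : rd k d by apply: lmin_rd ld ik.
have hx : hd x (d * l).
  rewrite -e -mulgA hd_linv; apply/negP => hx.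
  by case: (hdM rk hx) => [|[_]]; apply/negP => //; apply: ld.
case: (hdM (rmin_rd rmd il) hx) => [|[id hl]]; first by rewrite (negPf (ld _ px)).
have [l' el n'] := hdE hl; rewrite el in il e *.
have [_ il'] := inpM_rd (proj2 (rd_lt x l') n') il.
have [|-> E] := IH l' il'.
  apply: (@mulgI _ (lt x)); rewrite mulgA e !mulgA; congr (_ * _).
  exact/esym/adj_comm.
split=> // a; rewrite cnt_ltM //; case: (eqVneq a x.1) => [->//|_] ha.
exact: E.
Qed.

End Reduced.

(** * Halfspaces, their gates and their nesting *)

Section Halfspaces.
Context {G : graph}.
Implicit Types (g h x y z p q : raag G) (s t r : G * bool).

(* The halfspace [x * {g | s is a first letter of g}].  Under [gated x s] it
   omits [1] and [x * lt s] is its element closest to [1]. *)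
Definition half x s g := hd s (x^-1 * g).
Definition gated x s := forall t, hd t x^-1 -> ~~ adj t.1 s.1 /\ t != s.
Definition pre p g := rd p (p^-1 * g).

Lemma halfM q x s g : half (q * x) s g = half x s (q^-1 * g).
Proof. by rewrite /half invgM mulgA. Qed.

Lemma half_adjr x h s g : inp (adj s.1) h -> half (x * h) s g = half x s g.
Proof. by move=> ih; rewrite /half invgM -mulgA hd_inp_adj //; apply: inpV. Qed.

(** Letters adjacent to [s.1] at the end of [u] do not affect the halfspace; dropping all of them
    moves [u] to the gate. *)
Lemma half_gated u s : ~~ half u s 1 ->
  exists x h, [/\ u = x * h, inp (adj s.1) h & gated x s].
Proof.
move=> n; have [x [h [e ih mx]]] := rmin_dec (adj s.1) u.
exists x, h; split => // t ht; split.
  by apply/negP=> E; move: (mx t); rewrite adj_sym E ht => /(_ isT).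
apply: contraNneq n => et; rewrite e half_adjr // /half mulg1 -et //.
Qed.

Lemma gated_half1 x s : gated x s -> ~~ half x s 1.
Proof. by move=> hx; apply/negP; rewrite /half mulg1 => /hx[_]; rewrite eqxx. Qed.

Lemma half_rd x s g : gated x s -> half x s g -> rd x (x^-1 * g).
Proof.
move=> hx hg; case: (rd_dec x (x^-1 * g)) => // /rdN[t h1 h2].
have [n1 n2] := hx _ h1; case: (hd_diamond h2 hg) => [e|E].
  by rewrite e eqxx in n2.
by rewrite E in n1.
Qed.

Lemma preE p g : pre p g <-> exists2 z, g = p * z & rd p z.
Proof.
split=> [h|[z -> h]]; last by rewrite /pre mulKg.
by exists (p^-1 * g); rewrite ?mulVKg.
Qed.

Lemma pre_cnt p g a : pre p g -> cnt a p <= cnt a g.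
Proof. by move/preE=> [z -> ->]; lia. Qed.

Lemma half_pre x s g : gated x s -> half x s g -> pre (x * lt s) g.
Proof.
move=> hx hg; have r := half_rd hx hg; have [z e n] := hdE hg.
apply/preE; exists z; first by rewrite -mulgA -e mulVKg.
by rewrite e in r; have [] := rd_assocr (proj2 (rd_lt s z) n) r.
Qed.

Lemma gated_rd x s : gated x s -> rd x (lt s).
Proof.
move=> hx; have := @half_rd x s (x * lt s) hx; rewrite mulKg; apply.
by rewrite /half mulKg hd_lt.
Qed.

Lemma pre_half x s g : gated x s -> pre (x * lt s) g -> half x s g.
Proof.
move=> hx /preE[z -> r]; rewrite /half -mulgA mulKg hd_linv.
by apply/rd_lt; have [] := rd_assocl (gated_rd hx) r.
Qed.

Lemma gated_suffix x y s : rd x y -> gated (x * y) s -> gated y s.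
Proof. by move=> r h t ht; apply: h; rewrite invgM; apply: hd_rd ht; apply: rdV. Qed.

Lemma pre_mull q p y : rd q y -> pre p y -> pre (q * p) (q * y).
Proof.
move=> ry /preE[z e rz]; rewrite e in ry *.
by apply/preE; exists z; rewrite ?mulgA //; have [] := rd_assocr rz ry.
Qed.

Lemma gated_adj1 x s : gated x s -> inp (adj s.1) x -> x = 1.
Proof.
move=> hx ix; case: (raag_case x^-1) => [e|[t ht]]; first by rewrite -[x]invgK e invg1.
have [+ _] := hx _ ht; have := hd_cnt ht; rewrite cntV => /ix.
by rewrite adj_sym => ->.
Qed.

(** Hyperplanes with non-adjacent labels do not cross, so halfspaces that omit [1] and share a point
    are nested; nesting appears as a gate being a prefix. The induction strips the first letter [r]
    of [x], which either begins [y] as well or commutes past it. *)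
Lemma half_nest x y s t g : gated x s -> gated y t -> ~~ adj s.1 t.1 ->
  half x s g -> half y t g ->
  [\/ x = y /\ s = t, pre (x * lt s) y | pre (y * lt t) x].
Proof.
move=> gx gy nst; move: x y g gx gy; apply: (@raag_ind G) => [|r x n IH] y g gx gy hx hy.
  have r0 := half_rd gy hy; have es : hd s (y * (y^-1 * g)).
    by rewrite mulVKg; move: hx; rewrite /half invg1 mul1g.
  case: (hdM r0 es) => [h|[iy h]].
    by constructor 2; rewrite mul1g; apply/preE; have [z ? ?] := hdE h; exists z => //; apply/rd_lt.
  case: (hd_diamond h hy) => [e|E]; last by rewrite E in nst.
  by constructor 1; rewrite (gated_adj1 gy) // -e.
have rx : rd (lt r) x by apply/rd_lt.
have gx' := gated_suffix rx gx.
have hx' : half x s (lt (linv r) * g) by rewrite lt_inv -halfM.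
have hr : hd r g.
  have := half_rd gx hx; set q := _ * g => rq.
  have -> : g = lt r * x * q by rewrite /q mulVKg.
  by apply: hd_rd => //; rewrite hd_linv.
have ry := half_rd gy hy; have hry : hd r (y * (y^-1 * g)) by rewrite mulVKg.
(* Otherwise [r] could be moved to the end of [lt r * x] and would commute with [s], against
   gatedness. *)
have bad : inp (adj r.1) x -> adj r.1 s.1 -> False.
  move=> ix Ers; have [] := gx (linv r); last by rewrite /= Ers.
  rewrite (adj_comm ix) invgM -lt_inv hd_linv linvK.
  by apply/negP=> /hd_cnt; rewrite cntV => /ix; rewrite /= adj_irr.
case: (hdM ry hry) => [h|[iy h]].
  have [y1 ey n1] := hdE h; have ry1 : rd (lt r) y1 by apply/rd_lt.
  rewrite ey in gy hy *.
  case: (IH y1 (lt (linv r) * g)) => //.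
  - exact: gated_suffix ry1 gy.
  - by rewrite lt_inv -halfM.
  - by case=> -> ->; constructor 1.
  - by move=> p; constructor 2; rewrite -mulgA; apply: pre_mull.
  - by move=> p; constructor 3; rewrite -mulgA; apply: pre_mull.
case: (hd_diamond h hy) => [e|E].
  constructor 3; rewrite (gated_adj1 gy) -?e // mul1g.
  by apply/preE; exists x.
case: (IH y (lt (linv r) * g)) => //.
- have c : commute y^-1 (lt (linv r)).
    by apply/commute_sym/commuteV/adj_comm.
  by rewrite /half mulgA c -mulgA hd_adj.
- by case=> ex es; case: bad; rewrite ?ex ?es.
- move/preE=> [z ey rz]; rewrite ey in iy.
  have [i1 _] := inpM_rd rz iy.
  have [i2 i3] := inpM_rd (gated_rd gx') i1.
  by case: bad => //; apply/(inp_lt (adj r.1)).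
- move/preE=> [z ex rz]; constructor 3; apply/preE.
  have c : commute (lt r) (y * lt t) by apply: commuteM (adj_comm iy) (lt_comm E).
  have e1 : y * lt t * (lt r * z) = lt r * x by rewrite ex mulgA -c -mulgA.
  exists (lt r * z) => // a; have := cntM_le a (y * lt t) (lt r * z).
  rewrite e1 rx ex rz => h1; have := cntM_le a (lt r) z; lia.
Qed.

End Halfspaces.

(** * Exponent sums *)

Section Chi.
Context {G : graph}.
Implicit Types (g h k z : raag G) (w : word G) (x y s : G * bool) (a b c : G).

Lemma step_invariant (T : Type) (f : word G -> T) w :
  (forall u v, raag_step adj u v -> f u = f v) -> f (rword (wd w)) = f w.
Proof.
move=> H; have E u v : raag_eq adj u v -> f u = f v.
  by elim=> [{}u {}v /H//|//|{}u {}v _ -> //|{}u {}v t _ -> _ -> //].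
by apply/E/wdP; rewrite rwordK.
Qed.

Definition sg a x : int := (if x.1 == a then (-1) ^+ x.2 else 0)%R.

Fixpoint chiw a w : int := if w is x :: w' then (sg a x + chiw a w')%R else 0%R.

Definition chi a g : int := chiw a (rword g).

Lemma sg_linv a x : sg a (linv x) = (- sg a x)%R.
Proof. by case: x => v []; rewrite /sg /=; case: eqP => _ //=; rewrite ?oppr0 ?opprK. Qed.

Lemma chiw_cat a u v : chiw a (u ++ v) = (chiw a u + chiw a v)%R.
Proof. by elim: u => [|x u /= ->] /=; rewrite ?add0r ?addrA. Qed.

Lemma chi_wd a w : chi a (wd w) = chiw a w.
Proof.
apply: (@step_invariant int (chiw a)) => _ _ [] *; rewrite !chiw_cat /= ?sg_linv; ring.
Qed.

Lemma chiM a g h : chi a (g * h) = (chi a g + chi a h)%R.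
Proof. by rewrite -[g]rwordK -[h]rwordK -wd_cat !chi_wd chiw_cat. Qed.

Lemma chi1 a : chi a 1 = 0%R. Proof. by rewrite -wd0 chi_wd. Qed.

Lemma chi_lt a x : chi a (lt x) = sg a x.
Proof. by rewrite chi_wd /= addr0. Qed.

Lemma chiV a g : chi a g^-1 = (- chi a g)%R.
Proof.
by apply/eqP; rewrite -addr_eq0 -chiM mulVg chi1.
Qed.

Lemma chi_conj a g h : chi a (g^-1 * h * g) = chi a h.
Proof. by rewrite !chiM chiV; ring. Qed.

Lemma chiX a g n : chi a (g ^+ n) = (chi a g *+ n)%R.
Proof.
by elim: n => [|n IH]; rewrite ?expg0 ?chi1 ?mulr0n // expgS chiM IH mulrS.
Qed.

Lemma chi_cnt a g : `|chi a g|%N <= cnt a g.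
Proof.
elim/(@raag_ind G): g => [|x g n IH]; first by rewrite chi1.
rewrite cnt_ltM // chiM chi_lt /sg eq_sym; case: eqP => _; last by rewrite add0r.
by case: x.2 => /=; rewrite ?expr0 ?expr1; lia.
Qed.

Lemma chi_odd a g : odd `|chi a g|%N = odd (cnt a g).
Proof.
elim/(@raag_ind G): g => [|x g n IH]; first by rewrite chi1 cnt1.
rewrite cnt_ltM // chiM chi_lt /sg eq_sym oddD -IH; case: eqP => _; last by rewrite add0r.
by case: x.2 => /=; rewrite ?expr0 ?expr1; lia.
Qed.

Lemma chi_cnt_neq0 a g : chi a g != 0%R -> 0 < cnt a g.
Proof. by move=> h; have := chi_cnt a g; lia. Qed.

Lemma chi_inp (P : pred G) a g : inp P g -> ~~ P a -> chi a g = 0%R.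
Proof. by move=> i; apply: contraNeq => /chi_cnt_neq0/i. Qed.

Fixpoint heisw a b w : int :=
  if w is x :: w' then (sg a x * chiw b w' + heisw a b w')%R else 0%R.

Lemma heisw_cat a b u v :
  heisw a b (u ++ v) = (heisw a b u + heisw a b v + chiw a u * chiw b v)%R.
Proof.
elim: u => [|x u IH] /=; first by rewrite mul0r addr0 add0r.
rewrite IH chiw_cat; ring.
Qed.

(* [heisw a b] is the corner entry of the homomorphism to the integral
   Heisenberg group sending [a] and [b] to its two generators. *)
Lemma commute_minor a b g h : a != b -> ~~ adj a b -> commute g h ->
  (chi a g * chi b h = chi a h * chi b g)%R.
Proof.
move=> nab nE; pose q k := heisw a b (rword k).
have qw w : q (wd w) = heisw a b w.
  apply: (@step_invariant int (heisw a b)) => u v [w1 w2 x|w1 w2 c d e f E].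
    rewrite !heisw_cat /= !sg_linv /sg.
    case: (eqVneq x.1 a) => [->|_]; last ring.
    by rewrite (negPf nab); ring.
  rewrite !heisw_cat /= /sg /=; case: (eqVneq c a) => [ca|_]; last first.
    by case: (eqVneq c b) => [cb|_]; case: (eqVneq d a) => [da|_]; try ring;
      move: E nE; rewrite cb da adj_sym => ->.
  case: (eqVneq d b) => [db|_]; last by rewrite ca (negPf nab); ring.
  by move: E nE; rewrite ca db => ->.
have qM k l : q (k * l) = (q k + q l + chi a k * chi b l)%R.
  by rewrite -[k]rwordK -[l]rwordK -wd_cat !qw heisw_cat !chi_wd.
move=> c; have : q (g * h) = q (h * g) by rewrite c.
rewrite !qM => e.
by apply: (@addrI _ (q g + q h)%R); rewrite e; ring.
Qed.

Lemma chi_pred1 a g : inp (pred1 a) g -> `|chi a g|%N = cnt a g.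
Proof.
suff S : inp (pred1 a) g -> g = 1 \/ exists b : bool,
    hd (a, b) g /\ chi a g = ((-1) ^+ b * (cnt a g)%:Z)%R.
  case/S=> [->|[b [_ ->]]]; first by rewrite chi1 cnt1.
  by case: b => /=; rewrite ?expr0 ?expr1; lia.
elim/(@inp_ind G) => [|x h /eqP ex _ n IH]; first by left.
right; exists x.2; have ex' : (a, x.2) = x by rewrite -ex; case: (x).
rewrite ex' hd_linv n; split=> //; rewrite chiM cnt_ltM // chi_lt /sg ex eqxx.
case: IH => [->|[b [hb ->]]].
  by rewrite chi1 cnt1 addr0 mulr1.
have -> : b = x.2; last by rewrite PoszD mulrDr /= mulr1.
apply/eqP; apply: contraNT n => nb; rewrite /linv ex.
by suff <- : b = ~~ x.2 by []; case: (b) (x.2) nb => [] [].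
Qed.

Definition star a : pred G := fun c => (c == a) || adj a c.

Lemma star_lmin a g : inp (star a) g -> lmin (pred1 a) g -> inp (adj a) g.
Proof.
elim/(@inp_ind G) => [|x h sx _ n IH m]; first by move=> _; apply: inp1.
have nx : x.1 != a.
  by apply/negP=> e; have := m x e; rewrite hd_linv n.
move: sx; rewrite /star (negPf nx) /= => E; apply: inpM; first by apply/inp_lt.
apply: IH => y /eqP ey; have := m y; rewrite ey /= eqxx => /(_ isT).
by rewrite hd_adj // ey adj_sym.
Qed.

(** The group of the star is the product of the cyclic group of [a] and the group of the link, and
    the exponent sum of [a] reads off the first factor. *)
Lemma star_chi0 a g : inp (star a) g -> chi a g = 0%R -> inp (adj a) g.
Proof.
move=> ig; have [h [d [e ih ld]]] := lmin_dec (pred1 a) g.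
have r : rd h d by apply: lmin_rd ld ih.
rewrite e in ig *; have [_ id] := inpM_rd r ig.
have {}id := star_lmin id ld.
rewrite chiM (chi_inp id) ?adj_irr // addr0 => c0.
suff -> : h = 1 by rewrite mul1g.
apply: cnt_eq0 => c; case: (eqVneq c a) => [->|nc].
  by rewrite -chi_pred1 // c0.
by apply/eqP; rewrite -leqn0 leqNgt; apply: contra nc => /ih.
Qed.

(** In the double coset decomposition over the cyclic group of [x.1] the outer factors commute with
    [x]; hence so does the minimal factor, and [double_coset_comm] puts it in the link. *)
Lemma commute_lt_star x g : commute (lt x) g -> inp (star x.1) g.
Proof.
move=> c; have [h [d [k [e ih ik ld rmd]]]] := double_coset_dec (pred1 x.1) (pred1 x.1) g.
have C u : inp (pred1 x.1) u -> commute (lt x) u.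
  move=> iu; apply/commute_sym; apply: commute_gen iu => y /eqP ey.
  have [->|->] : y = x \/ y = linv x.
    by case: (x) (y) ey => [v []] [v' []] /= ->; auto.
  - exact: commute_refl.
  - by rewrite lt_inv; apply/commute_sym/commuteV/commute_refl.
have e1 : lt x * d = d * lt x.
  apply: (@mulgI _ h); rewrite !mulgA -(C h ih).
  apply: (@mulIg _ k); rewrite -!mulgA (mulgA h) (mulgA h) -e c e.
  by rewrite -!mulgA (C k ik).
have ix : inp (pred1 x.1) (lt x) by apply/inp_lt => /=.
have [_ /(_ x.1)] := double_coset_comm ld rmd ix ix e1.
rewrite cnt_lt eqxx => /(_ isT) id; rewrite e.
have sub u : inp (pred1 x.1) u -> inp (star x.1) u.
  by apply: inp_sub => a /eqP ->; rewrite /star eqxx.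
apply: inpM; [apply: inpM|]; try exact: sub.
by apply: inp_sub id => a E; rewrite /star E orbT.
Qed.

Lemma cnt_mulr a g h : inp (predC1 a) h -> cnt a (g * h) = cnt a g.
Proof.
move=> ih; have z k : inp (predC1 a) k -> cnt a k = 0%N.
  by move=> ik; have [//|/ik] := posnP (cnt a k); rewrite /= eqxx.
apply/eqP; rewrite eqn_leq; apply/andP; split.
  by apply: leq_trans (cntM_le _ _ _) _; rewrite (z h) // addn0.
rewrite -{1}[g](mulgK h); apply: leq_trans (cntM_le _ _ _) _.
by rewrite (z h^-1) ?addn0 //; apply: inpV.
Qed.

(** A discrete intermediate value principle: letters of a reduced word pass one by one from the
    right part to the left part until [R] first fails. *)
Lemma cut_red (R : raag G -> raag G -> bool) g : R 1 g -> ~~ R g 1 ->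
  exists u s v, [/\ g = u * (lt s * v), rd u (lt s * v), rd (lt s) v,
                    R u (lt s * v) & ~~ R (u * lt s) v].
Proof.
suff S v u : rd u v -> R u v -> ~~ R (u * v) 1 -> exists u' s v',
  [/\ u * v = u' * (lt s * v'), rd u' (lt s * v'), rd (lt s) v',
      R u' (lt s * v') & ~~ R (u' * lt s) v'].
  move=> h1 h2; have [|u [s [v H]]] := S g 1 (rd1g g) h1.
    by rewrite mul1g.
  by exists u, s, v; rewrite -[g]mul1g.
elim/(@raag_ind G): v u => [|x v n IH] u; first by rewrite mulg1 => _ ->.
move=> r h1 h2; have rx : rd (lt x) v by apply/rd_lt.
have [h|h] := boolP (R (u * lt x) v); last by exists u, x, v.
have [_ r'] := rd_assocr rx r.
by rewrite mulgA in h2 *; apply: IH.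
Qed.

Lemma half_sub (x y : raag G) s g : gated x s -> gated y s -> pre (x * lt s) y ->
  half y s g -> half x s g.
Proof.
move=> gx gy /preE[z e r] /(half_pre gy)/preE[w ew rw]; apply: (pre_half gx).
rewrite ew; apply/preE; exists (z * lt s * w); first by rewrite e !mulgA.
have [_ r1] := rd_assocl (gated_rd gy) rw.
have [r2 r3] := rd_assocl (gated_rd gy) rw.
rewrite e in r3; have [r4 r5] := rd_assocl r r3.
by rewrite -mulgA.
Qed.

(* Each strict inclusion costs one more letter [s.1] to enter the halfspace. *)
Lemma half_chain (U : nat -> raag G) s g :
  (forall n, ~~ half (U n) s 1) ->
  (forall n h, half (U n.+1) s h -> half (U n) s h) ->
  (forall n, exists2 h, half (U n) s h & ~~ half (U n.+1) s h) ->
  forall n, half (U n) s g -> n <= cnt s.1 g.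
Proof.
move=> U1 Usub Ustrict n.
suff S m (x h : raag G) : U m = x * h -> inp (adj s.1) h -> gated x s -> m <= cnt s.1 x.
  have [x [h [e ih gx]]] := half_gated (U1 n).
  rewrite e half_adjr // => /(half_pre gx)/(pre_cnt s.1).
  by rewrite (gated_rd gx); have := S _ _ _ e ih gx; lia.
elim: m x h => // m IH x h e ih gx.
have [y [k [ey ik gy]]] := half_gated (U1 m).
have Hx t : half (U m.+1) s t = half x s t by rewrite e half_adjr.
have Hy t : half (U m) s t = half y s t by rewrite ey half_adjr.
have [t ht nt] := Ustrict m; rewrite Hy in ht; rewrite Hx in nt.
have hx : half x s (x * lt s) by rewrite /half mulKg hd_lt.
have hy : half y s (x * lt s) by rewrite -Hy; apply: Usub; rewrite Hx.
have nE : ~~ adj s.1 s.1 by rewrite adj_irr.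
case: (half_nest gy gx nE hy hx) => [[yx _]|/(pre_cnt s.1)|p].
- by rewrite yx (negPf nt) in ht.
- by rewrite (gated_rd gy) cnt_lt eqxx; have := IH _ _ ey ik gy; lia.
- by rewrite (half_sub gx gy p ht) in nt.
Qed.

(** The halfspace translated by [q^-1] omits [1] and contains [lt s], so its gate is a prefix of a
    single letter; what is left of [q^-1] lies in the link. *)
Lemma half_stab q s : (forall g, hd s (q * g) = hd s g) -> inp (adj s.1) q.
Proof.
move=> H; have n1 : ~~ half q^-1 s 1 by rewrite /half invgK H hd1.
have [x [h [e ih gx]]] := half_gated n1.
have : half q^-1 s (lt s) by rewrite /half invgK H hd_lt.
rewrite e half_adjr // => /(half_pre gx) p.
suff x1 : x = 1 by rewrite -[q]invgK e x1 mul1g; apply: inpV.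
by apply: cnt_eq0 => c; have := pre_cnt c p; rewrite (gated_rd gx); lia.
Qed.

End Chi.

(** * Elements translating a hyperplane *)

Section Axis.
Context {G : graph}.
Implicit Types (g h q y z t u : raag G) (s : G * bool).

Lemma half_expr u s z : (forall g, half u s g -> half u s (z * g)) ->
  forall n g, half u s g -> half u s (z ^+ n * g).
Proof.
move=> H; elim=> [|n IH] g hg; first by rewrite expg0 mul1g.
by rewrite expgS -mulgA; apply/H/IH.
Qed.

Lemma half_iter u s z n g : ~~ half u s 1 ->
  (forall h, half u s h -> half u s (z * h)) ->
  (exists2 h, half u s h & ~~ half u s (z^-1 * h)) ->
  half u s (z ^- n * g) -> n <= cnt s.1 g.
Proof.
move=> n1 Hz [h0 h1 h2]; rewrite -halfM.
apply: (@half_chain _ (fun m => z ^+ m * u) s g) => {n} [n|n h|n].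
- rewrite halfM mulg1; apply: contra n1 => h.
  by rewrite -(mulgV (z ^+ n)); apply: half_expr.
- rewrite !halfM => hK; have := Hz _ hK.
  by rewrite expgSr invgM mulgA mulVKg.
- exists (z ^+ n * h0); rewrite halfM ?mulKg //.
  by rewrite expgSr invgM -mulgA mulKg.
Qed.

Section Translation.
Variables (u v z : raag G) (s : G * bool).
Hypotheses (ez : z = u * (lt s * v)) (ru : rd u (lt s)) (rv : rd (lt s) v).
Hypothesis (cuv : cnt s.1 u = cnt s.1 v).
(** [K] is the far side of the letter [s] of [z], and [K'] the far side of the letter [linv s] of
    [z^-1]; thus [z] maps the complement of [K'] onto [K]. *)
Let K g := half u s g.
Let K' g := half v^-1 (linv s) g.

Let KN1 : ~~ K 1.
Proof.
rewrite /K /half mulg1; have := rdV ru; rewrite -lt_inv.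
by move/rd_lt; rewrite linvK.
Qed.

Let KN1' : ~~ K' 1.
Proof. by rewrite /K' /half mulg1 invgK; apply/rd_lt. Qed.

Let Kz g : K (z * g) = ~~ K' g.
Proof. by rewrite /K /K' /half ez -!mulgA mulKg hd_linv invgK. Qed.

(** Equally many letters on [s.1] in [u] and [v] put both gates at the same depth, which excludes
    proper nesting; equality would identify [s] with its inverse. *)
Let KK' g : K g -> ~~ K' g.
Proof.
have [x [h [ex ih gx]]] := half_gated KN1.
have [y [k [ey ik gy]]] := half_gated KN1'.
have nE : ~~ adj s.1 (linv s).1 by rewrite adj_irr.
rewrite /K /K' ex ey !half_adjr // => h1; apply/negP => h2.
have cx : cnt s.1 x = cnt s.1 u.
  by rewrite ex cnt_mulr //; apply: inp_sub ih => a; apply: contraTneq => ->; rewrite adj_irr.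
have cy : cnt s.1 y = cnt s.1 v.
  rewrite -[RHS]cntV ey cnt_mulr //; apply: inp_sub ik => a.
  by apply: contraTneq => ->; rewrite adj_irr.
case: (half_nest gx gy nE h1 h2) => [[_ /(congr1 snd)/=]|/(pre_cnt s.1)|/(pre_cnt s.1)].
- by case: (s.2).
- by rewrite (gated_rd gx) cnt_lt eqxx cx cy cuv; lia.
- by rewrite (gated_rd gy) cnt_lt eqxx cx cy cuv; lia.
Qed.

Let Kmono g : K g -> K (z * g).
Proof. by rewrite Kz; apply: KK'. Qed.

Let Kz1 : K z. Proof. by rewrite -[z]mulg1 Kz. Qed.

Let KN (n : nat) g : K (z ^- n * g) -> n <= cnt s.1 g.
Proof.
apply: half_iter KN1 Kmono _; exists z => //.
by rewrite mulVg.
Qed.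

Let KP g : exists n, K (z ^+ n * g).
Proof.
exists (cnt s.1 g).+2; rewrite expgS -mulgA Kz; apply/negP => h.
have mono' k : K' k -> K' (z^-1 * k).
  by move=> k'; rewrite -[K' _]negbK -Kz mulVKg; apply: contraL k' => /KK'.
have := @half_iter v^-1 (linv s) z^-1 (cnt s.1 g).+1 g KN1' mono'.
rewrite expVgn !invgK => F; suff : (cnt s.1 g).+1 <= cnt s.1 g by rewrite ltnn.
apply: F h.
exists z^-1; first by rewrite -[half _ _ _]negbK -[half _ _ _]/(K' _) -Kz mulgV.
by rewrite mulgV.
Qed.

Let KPm n m g : n <= m -> K (z ^+ n * g) -> K (z ^+ m * g).
Proof.
by move=> /subnKC <- h; rewrite addnC expgnDr -mulgA; apply: half_expr.
Qed.

Let Ksub q := forall g, K g -> K (q * g).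

(** [K] and its translate by [q] both contain a high power of [z] and both omit a very negative
    power [p]. Seen from [p] they omit the base point, so [half_nest] applies. *)
Let Kcomp q : commute q z -> Ksub q \/ Ksub q^-1.
Proof.
move=> c; have cq n : q^-1 * z ^+ n = z ^+ n * q^-1.
  exact/commuteX/commute_sym/commuteV/commute_sym.
have [n hn] := KP q^-1; pose p1 := z ^+ n.+1.
have k1 : K p1 by rewrite /p1 -[_ ^+ _]mulg1; apply: (@KPm 1) => //; rewrite expg1 mulg1.
have k2 : K (q^-1 * p1) by rewrite cq; apply: KPm hn.
pose m := (cnt s.1 q^-1).+1; pose p := z ^- m.
have k3 : ~~ K p.
  by apply: contra KN1 => h; rewrite -(mulgV (z ^+ m)); apply: half_expr.
have k4 : ~~ K (q^-1 * p).
  apply/negP; have -> : q^-1 * p = z ^- m * q^-1.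
    by apply: commuteV; apply: cq.
  by move/KN; rewrite ltnn.
have n1 : ~~ half (p^-1 * u) s 1 by rewrite halfM invgK mulg1.
have n2 : ~~ half (p^-1 * (q * u)) s 1 by rewrite halfM invgK mulg1 halfM.
have [x [h [ex ih gx]]] := half_gated n1.
have [y [k [ey ik gy]]] := half_gated n2.
have Hx g : half x s g = K (p * g) by rewrite -(half_adjr x g ih) -ex halfM invgK.
have Hy g : half y s g = K (q^-1 * (p * g)).
  by rewrite -(half_adjr y g ik) -ey halfM invgK halfM.
have nE : ~~ adj s.1 s.1 by rewrite adj_irr.
have h1 : half x s (p^-1 * p1) by rewrite Hx mulVKg.
have h2 : half y s (p^-1 * p1) by rewrite Hy mulVKg.
case: (half_nest gx gy nE h1 h2) => [[xy _]|pr|pr].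
- left=> g; have := Hx (p^-1 * (q * g)); rewrite xy Hy mulVKg mulKg => -> //.
- left=> g hg; have := half_sub gx gy pr (g := p^-1 * (q * g)).
  by rewrite Hx Hy mulVKg mulKg; apply.
- right=> g hg; have := half_sub gy gx pr (g := p^-1 * g).
  by rewrite Hx Hy mulVKg; apply.
Qed.

(** If [y] moved [K] strictly into itself, its powers would carry [K] arbitrarily deep. Measured
    against the powers of [z], however, the depth stays below the constant [C], because [y]
    contributes nothing to exponent sums while [chi s.1 z] is odd and hence nonzero. *)
Let Ksub_sym y : odd (cnt s.1 z) -> commute y z -> chi s.1 y = 0%R ->
  Ksub y -> Ksub y^-1.
Proof.
move=> oz c chy Py; apply: NNPP => nP.
have [g0 h0 h1] : exists2 g, K g & ~~ K (y^-1 * g).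
  apply: NNPP => n; apply: nP => g hg.
  by case: (boolP (K (y^-1 * g))) => // h; case: n; exists g.
have Py_ j : Ksub (y ^+ j) by move=> g; apply: half_expr.
have C1 j g : K (y ^- j * g) -> j <= cnt s.1 g.
  by apply: half_iter KN1 Py _; exists g0.
have cX j n : commute (y ^+ j) (z ^+ n) by apply: commuteX2.
pose C := (cnt s.1 (z * z) + cnt s.1 u)%N.
have chz : 0 < `|chi s.1 z|%N by have := chi_odd s.1 z; rewrite oz; case: `|_|%N.
(* The translate of [K] by [t] lies in [K] and contains the translate by [z]. Its gate is therefore
   a prefix of [z * z], which bounds the exponent sum of [t], equal to [- n] times that of [z]. *)
have B j n : Ksub (z ^- n * y ^+ j) -> ~ Ksub (z ^- n.+1 * y ^+ j) -> n <= C.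
  set t := _ * _ => Pt; rewrite expgSr invgM -mulgA -/t => nPt.
  have ct : commute t z.
    apply/commute_sym/commuteM; last exact/commute_sym/commute_sym/commuteX/commute_sym.
    exact/commuteV/commuteX/commute_refl.
  have Pt' : Ksub (t^-1 * z).
    have c' : commute (z^-1 * t) z.
      by apply/commute_sym/commuteM; [apply/commuteV/commute_refl|apply/commute_sym].
    by have [//|] := Kcomp c'; rewrite invgM invgK.
  have n1 : ~~ half (t * u) s 1.
    by rewrite halfM mulg1; apply: contra KN1 => h; rewrite -(mulgV t); apply: Pt.
  have [x [h [ex ih gx]]] := half_gated n1.
  have hx : half x s (z * z).
    by rewrite -(half_adjr x _ ih) -ex halfM mulgA; apply: Pt'.
  have := pre_cnt s.1 (half_pre gx hx); rewrite (gated_rd gx) => lx.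
  have := chi_cnt s.1 x; have := chi_cnt s.1 u.
  have : chi s.1 (t * u) = chi s.1 x by rewrite ex chiM (chi_inp ih) ?addr0 ?adj_irr.
  rewrite !chiM chiV !chiX chy mul0rn addr0 /C => e h3 h4.
  have : `|(chi s.1 z *+ n)%R|%N = (n * `|chi s.1 z|)%N by rewrite -mulr_natl abszM; lia.
  by move: lx e h3 h4 chz; clear; nia.
have P0 j : ~ Ksub (z ^- C.+1 * y ^+ j).
  move=> h; have all n : C.+1 <= n -> Ksub (z ^- n * y ^+ j).
    elim: n => // n IH; rewrite leq_eqVlt => /orP[/eqP<- //|le].
    apply: NNPP => nn; have := B j n (IH le) nn; lia.
  pose g := y ^+ j * z; have := all (C.+1 + cnt s.1 g)%N (leq_addr _ _) _ Kz1.
  by rewrite -mulgA => /KN; rewrite -/g; clearbody g; clear; lia.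
have P1 j : Ksub (y ^- j * z ^+ C.+1).
  have c' : commute (z ^- C.+1 * y ^+ j) z.
    apply/commute_sym/commuteM; last exact/commuteX/commute_sym.
    exact/commuteV/commuteX/commute_refl.
  by have [/P0//|] := Kcomp c'; rewrite invgM invgK.
pose g := z ^+ C.+1 * z.
by have := P1 (cnt s.1 g).+1 _ Kz1; rewrite -mulgA => /C1; rewrite ltnn.
Qed.

Lemma translation_fix y : odd (cnt s.1 z) -> commute y z -> chi s.1 y = 0%R ->
  inp (adj s.1) (u^-1 * y * u).
Proof.
move=> oz c chy; have cV : commute y^-1 z by apply/commute_sym/commuteV/commute_sym.
have chV : chi s.1 y^-1 = 0%R by rewrite chiV chy oppr0.
have [P1 P2] : Ksub y /\ Ksub y^-1.
  case: (Kcomp c) => P; split=> //; first exact: Ksub_sym.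
  by rewrite -[y]invgK; apply: Ksub_sym.
have E g : K (y * g) = K g.
  by apply/idP/idP => [/P2|]; [rewrite mulKg|apply: P1].
apply: half_stab => g; have := E (u * g).
by rewrite /K /half mulKg -!mulgA.
Qed.

End Translation.

(** The middle one among the letters of [z] on [a] gives a hyperplane translated by [z]; the
    conjugator is the part of [z] before that letter. *)
Lemma axis_fix z a : odd (cnt a z) -> exists x, forall y,
  commute y z -> chi a y = 0%R -> inp (adj a) (x^-1 * y * x).
Proof.
move=> oz; have [||u [s [v [e r1 r2]]]] :=
  @cut_red G (fun u v => cnt a u < cnt a v) z.
- by rewrite cnt1; case: (cnt a z) oz.
- by rewrite cnt1.
have [r3 _] := rd_assocr r2 r1; rewrite r2 r3 cnt_lt -leqNgt => h1 h2.
have es : a = s.1 by apply/eqP; move: h1 h2; case: eqP => // _; lia.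
rewrite es in oz h1 h2 *; rewrite eqxx in h1 h2.
have cuv : cnt s.1 u = cnt s.1 v.
  have := oz; rewrite e r1 r2 cnt_lt eqxx !oddD; lia.
by exists u => y; apply: (translation_fix e r3 r2 cuv).
Qed.

End Axis.

(** * Homomorphisms *)

Section Hom.
Context {G H : graph}.
Implicit Types (f : G -> raag H) (g h : raag G) (w : word G) (x y : G * bool).

Definition hom f := forall u v, adj u v -> commute (f u) (f v).

Definition evl f x : raag H := if x.2 then (f x.1)^-1 else f x.1.
Definition evw f w : raag H := foldr (fun x r => evl f x * r) 1 w.
Definition ev f g := evw f (rword g).

Lemma evw_cat f u v : evw f (u ++ v) = evw f u * evw f v.
Proof. by elim: u => [|x u /= ->]; rewrite ?mul1g ?mulgA. Qed.

Lemma evl_linv f x : evl f (linv x) = (evl f x)^-1.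
Proof. by case: x => v []; rewrite /evl /= ?invgK. Qed.

Variable f : G -> raag H.
Hypothesis hf : hom f.

Lemma evl_comm x y : adj x.1 y.1 -> commute (evl f x) (evl f y).
Proof.
move=> /hf c; have c' : commute (f x.1) (evl f y).
  by rewrite /evl; case: y.2 => //; apply: commuteV.
by rewrite {1}/evl; case: x.2 => //; apply/commute_sym/commuteV/commute_sym.
Qed.

Lemma ev_wd w : ev f (wd w) = evw f w.
Proof.
apply: (@step_invariant _ _ (evw f)) => _ _ [w1 w2 x|w1 w2 a c b d E].
  by rewrite !evw_cat /= evl_linv mulVKg.
rewrite !evw_cat /=; congr (_ * _); rewrite !mulgA; congr (_ * _).
exact: evl_comm.
Qed.

Lemma evM g h : ev f (g * h) = ev f g * ev f h.
Proof. by rewrite -[g]rwordK -[h]rwordK -wd_cat !ev_wd evw_cat. Qed.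

Lemma ev1 : ev f 1 = 1. Proof. by rewrite -wd0 ev_wd. Qed.

Lemma ev_lt x : ev f (lt x) = evl f x.
Proof. by rewrite ev_wd /= mulg1. Qed.

Lemma ev_gn a : ev f (gn a) = f a. Proof. exact: ev_lt. Qed.

Lemma evV g : ev f g^-1 = (ev f g)^-1.
Proof. by apply/esym/mulg1_eq; rewrite -evM mulgV ev1. Qed.

Lemma ev_commute g h : commute g h -> commute (ev f g) (ev f h).
Proof. by move=> c; rewrite /commute -!evM c. Qed.

Lemma ev_uniq (F : raag G -> raag H) g : (forall g h, F (g * h) = F g * F h) ->
  (forall a, F (gn a) = f a) -> F g = ev f g.
Proof.
move=> FM Fg; have F1 : F 1 = 1 by apply: (@mulgI _ (F 1)); rewrite -FM !mulg1.
have FV h : F h^-1 = (F h)^-1 by apply/esym/mulg1_eq; rewrite -FM mulgV F1.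
elim/(@raag_ind G): g => [|x g _ IH]; first by rewrite F1 ev1.
rewrite FM evM IH ev_lt; congr (_ * _); rewrite /evl -Fg -FV /gn -lt_inv /linv /=.
by case: x => v [].
Qed.

Lemma ev_inp (P : pred G) (Q : pred H) g :
  (forall a, P a -> inp Q (f a)) -> inp P g -> inp Q (ev f g).
Proof.
move=> PQ; elim/(@inp_ind G) => [|x k px _ _ IH]; first by rewrite ev1; apply: inp1.
rewrite evM ev_lt; apply: inpM => //; rewrite /evl.
by case: x.2; [apply: inpV|]; apply: PQ.
Qed.

Lemma chi_ev b g : chi b (ev f g) = (\sum_c chi c g * chi b (f c))%R.
Proof.
elim/(@raag_ind G): g => [|x g _ IH].
  by rewrite ev1 chi1 big1 // => c _; rewrite chi1 mul0r.
rewrite evM ev_lt chiM IH; under [RHS]eq_bigr do rewrite chiM mulrDl chi_lt.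
rewrite big_split /=; congr (_ + _)%R; rewrite (bigD1 x.1) //= big1 ?addr0.
  by rewrite /sg eqxx /evl; case: x.2 => /=; rewrite ?chiV ?expr1 ?expr0; ring.
by move=> c /negPf nc; rewrite /sg eq_sym nc mul0r.
Qed.

End Hom.

Lemma hom_gn (G : graph) : hom (@gn G).
Proof. by move=> u v E; apply: lt_comm. Qed.

Lemma ev_gn_id (G : graph) (g : raag G) : ev (@gn G) g = g.
Proof. by apply/esym; apply: (@ev_uniq G G (@gn G) (@hom_gn G) id). Qed.

Lemma eq_ev (G H : graph) (f f' : G -> raag H) g : f =1 f' -> ev f g = ev f' g.
Proof.
move=> e; rewrite /ev; elim: (rword g) => //= x w ->.
by rewrite /evl e.
Qed.

Lemma ev_comp (G H K : graph) (h : G -> raag H) (f : H -> raag K) g :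
  hom h -> hom f -> ev f (ev h g) = ev (fun v => ev f (h v)) g.
Proof.
move=> hh hf; apply: (@ev_uniq _ _ _ _ (fun g => ev f (ev h g))).
- by move=> u v E; apply: ev_commute => //; apply: hh.
- by move=> k l; rewrite !evM.
- by move=> a; rewrite ev_gn.
Qed.

Lemma hom_comp (G H K : graph) (h : G -> raag H) (f : H -> raag K) :
  hom h -> hom f -> hom (fun v => ev f (h v)).
Proof. by move=> hh hf u v /hh; apply: ev_commute. Qed.

Definition inv_pair (G : graph) (f f' : G -> raag G) :=
  [/\ hom f, hom f', forall v, ev f' (f v) = gn v & forall v, ev f (f' v) = gn v].

Lemma inv_pair_sym (G : graph) (f f' : G -> raag G) : inv_pair f f' -> inv_pair f' f.
Proof. by case. Qed.

Lemma inv_pairK (G : graph) (f f' : G -> raag G) g : inv_pair f f' -> ev f' (ev f g) = g.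
Proof. by case=> hf hf' e _; rewrite ev_comp // (eq_ev _ e) ev_gn_id. Qed.

Lemma inv_pair_comp (G : graph) (f f' h h' : G -> raag G) : inv_pair f f' -> inv_pair h h' ->
  inv_pair (fun v => ev f (h v)) (fun v => ev h' (f' v)).
Proof.
move=> pf ph; have [hf hf' e1 e2] := pf; have [hh hh' e3 e4] := ph.
have pf' := inv_pair_sym pf; have ph' := inv_pair_sym ph.
split; try exact: hom_comp; move=> v.
- by rewrite -ev_comp // (inv_pairK _ pf) e3.
- by rewrite -ev_comp // (inv_pairK _ ph') e2.
Qed.

(** * Automorphisms respecting link domination *)

Definition lkdom (G : graph) (v b : G) : bool := [forall w, adj v w ==> adj b w].

Arguments lkdom {G}.

Lemma lkdomP (G : graph) (v b : G) : reflect (forall w, adj v w -> adj b w) (lkdom v b).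
Proof. by apply: (iffP forallP) => h w; [apply/implyP|apply/implyP/h]. Qed.

Lemma commute_conj (G : graph) (x g h : raag G) :
  commute g (x^-1 * h * x) -> commute (x * g * x^-1) h.
Proof.
move=> c; have -> : h = x * (x^-1 * h * x) * x^-1.
  by rewrite -!mulgA mulVKg mulgV mulg1.
move: (x^-1 * h * x) c => k c; rewrite /commute -!mulgA !mulKg !mulgA.
by rewrite -(mulgA x g) c mulgA.
Qed.

Section Structure.
Context {G : graph}.
Implicit Types (v w b c : G).

(** For [c] in the support, zero exponent sum pushes [h] from the star of [c] into its link, which
    does not contain [c]. *)
Lemma star_self (h : raag G) : (forall c, 0 < cnt c h -> inp (star c) h) ->
  (forall c, chi c h = 0%R) -> h = 1.
Proof.
move=> hs h0; apply: cnt_eq0 => c; have [//|hc] := posnP (cnt c h).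
by have := star_chi0 (hs c hc) (h0 c) hc; rewrite adj_irr.
Qed.

Variables (f f' : G -> raag G) (sigma : G -> G).
Hypotheses (pf : inv_pair f f').
Hypothesis fdom : forall v b, chi b (f v) != 0%R -> lkdom v b.
Hypotheses (bsigma : bijective sigma) (lksigma : forall w, adj (sigma w) =1 adj w).
Hypothesis oddsigma : forall w, odd (cnt (sigma w) (f w)).

(* [x] lies on the axis of [f v] in the tree dual to the [sigma v]-hyperplanes.
   The images of the neighbours of [v] fix this axis, and the factor of [f v]
   in [lk v] is central in the image of [st v] with vanishing exponent sums. *)
Lemma dominated_structure v : exists x,
  (forall w, adj v w -> inp (adj v) (x^-1 * f w * x)) /\
  inp (lkdom v) (x^-1 * f v * x).
Proof.
have [hf hf' e1 e2] := pf.
have [x hx] := axis_fix (oddsigma v).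
have Y w : adj v w -> inp (adj v) (x^-1 * f w * x).
  move=> E; have := hx (f w); rewrite (_ : chi (sigma v) (f w) = 0%R).
    move=> H; apply: (@inp_sub _ (adj (sigma v))) => [c|]; first by rewrite lksigma.
    by apply: H => //; apply: hf; rewrite adj_sym.
  apply/eqP; apply: contraT => /fdom/lkdomP/(_ (sigma v)).
  by rewrite adj_irr; apply; rewrite adj_sym lksigma.
exists x; split=> //; set k := _ * x.
(* The aim is that the letters of [d] dominate [v] and that the link part [a * b] is trivial. *)
have [a [d [b [ek ia ib ld rmd]]]] := double_coset_dec (adj v) (adj v) k.
have yk w : adj v w -> commute (x^-1 * f w * x) k.
  move=> E; rewrite /commute /k -!mulgA !mulVKg; congr (_ * _).
  by rewrite !mulgA; congr (_ * _); apply/esym/hf.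
have D w : adj v w -> a^-1 * (x^-1 * f w * x) * a = b * (x^-1 * f w * x) * b^-1 /\
    forall c, 0 < cnt c (a^-1 * (x^-1 * f w * x) * a) -> inp (adj c) d.
  move=> E; apply: (double_coset_comm ld rmd).
  - by apply: inpM => //; apply: inpM; [apply: inpV|apply: Y].
  - by apply: inpM; [apply: inpM => //; apply: Y|apply: inpV].
  - apply: (@mulgI _ a); apply: (@mulIg _ b); have := yk w E; rewrite /commute ek.
    by rewrite -!mulgA mulVKg !mulgA => ->; rewrite mulgVK.
(* [sigma] permutes the link of [v], so each [c] there occurs in the conjugated image of some
   neighbour, and by [D] it commutes with [d]. *)
have dcov c : adj v c -> inp (adj c) d.
  have [s' s1 s2] := bsigma; move=> E; have Ew : adj v (s' c).
    by rewrite adj_sym -lksigma s2 adj_sym.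
  have [_] := D _ Ew; apply; apply: chi_cnt_neq0; rewrite !chi_conj.
  by have := oddsigma (s' c); rewrite s2 -chi_odd; case: chi => [[]|].
have id : inp (lkdom v) d.
  by move=> c hc; apply/lkdomP => w E; rewrite adj_sym; apply: dcov hc.
have cd l : inp (adj v) l -> commute l d.
  by move=> il; apply: inp_comm il id => c c' E /lkdomP/(_ c E); rewrite adj_sym.
pose l := a * b; have il : inp (adj v) l by apply: inpM.
have ekl : k = l * d by rewrite ek /l -!mulgA (cd b ib).
suff l1 : l = 1 by rewrite ekl l1 mul1g.
have ly w : adj v w -> commute l (x^-1 * f w * x).
  move=> E; have [e _] := D w E; move: (_ * x) e => y e; rewrite /commute /l.
  by rewrite -[RHS](mulVKg a) !(mulgA _ a b) (mulgA _ _ b) (mulgA _ y a) e mulgVK mulgA.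
have lk_ : commute l k by rewrite ekl; apply: commuteM => //; apply: cd.
(* Pulled back by [f'], the link part centralizes every generator in the star of [v] and has zero
   exponent sums, so [star_self] kills it. *)
pose L := x * l * x^-1.
have LC z : commute l (x^-1 * z * x) -> commute L z by apply: commute_conj.
pose h := ev f' L.
have hC w : star v w -> inp (star w) h.
  move=> sw; apply: (@commute_lt_star _ (w, false)); rewrite -[lt _]/(gn w) -e1.
  apply: ev_commute => //; apply/commute_sym/LC; move: sw.
  by rewrite /star => /orP[/eqP->//|]; apply: ly.
have chl c : chi c l = 0%R.
  case: (boolP (adj v c)) => E; last exact: chi_inp il E.
  have : chi c k = (chi c l + chi c d)%R by rewrite ekl chiM.
  have nd : ~~ lkdom v c by apply/negP => /lkdomP/(_ c E); rewrite adj_irr.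
  rewrite (chi_inp id nd) addr0 /k chi_conj => <-.
  by apply/eqP; apply: contraNT nd; apply: fdom.
have h1 : h = 1.
  apply: star_self => [c hc|c].
    have sv : star v v by rewrite /star eqxx.
    exact: hC (hC v sv c hc).
  rewrite chi_ev // big1 // => c' _; rewrite /L 2!chiM chiV chl addr0 addrN.
  by rewrite mul0r.
have : L = 1 by rewrite -[L](inv_pairK _ (inv_pair_sym pf)) -/h h1 ev1.
by move=> L1; apply: (@mulgI _ x); apply: (@mulIg _ x^-1); rewrite -/L L1 mulg1 mulgV.
Qed.

End Structure.

(** * Linear algebra of the abelianization *)

Section LinearAlgebra.
Local Open Scope ring_scope.

(** The hypothesis says that the block with columns [A] and rows [B] has trivial kernel, so its rank
    is [#|A|]; a square block of this kind is invertible. *)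
Lemma injective_restriction (V : finType) (A B : {set V}) (m : V -> V -> rat) :
  (forall s : V -> rat, (forall c, c \notin A -> s c = 0) ->
     (forall b, b \in B -> \sum_c s c * m b c = 0) -> forall c, s c = 0) ->
  (#|A| <= #|B|)%N /\ (#|A| = #|B| -> forall t : V -> rat,
     exists2 s, (forall c, c \notin A -> s c = 0) &
       forall b, b \in B -> \sum_c s c * m b c = t b).
Proof.
move=> inj; pose R := \matrix_(i < #|A|, j < #|B|) m (enum_val j) (enum_val i).
pose ext (r : 'rV[rat]_(#|A|)) c := \sum_i r 0 i * (c == enum_val i)%:R.
have ext_out r c : c \notin A -> ext r c = 0.
  move=> nc; rewrite /ext big1 // => i _; case: eqP => [e|_]; last by rewrite mulr0.
  by rewrite e enum_valP in nc.
have ext_in r i : ext r (enum_val i) = r 0 i.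
  rewrite /ext (bigD1 i) //= eqxx mulr1 big1 ?addr0 // => j nj.
  by rewrite (inj_eq enum_val_inj) eq_sym (negPf nj) mulr0.
have ext_sum r b : \sum_c ext r c * m b c = \sum_i r 0 i * m b (enum_val i).
  rewrite (bigID (mem A)) /= [X in _ + X]big1 ?addr0; last first.
    by move=> c nc; rewrite ext_out // mul0r.
  rewrite big_enum_val; apply: eq_bigr => i _.
  by rewrite ext_in.
have extR r j : (r *m R) 0 j = \sum_c ext r c * m (enum_val j) c.
  by rewrite ext_sum mxE; apply: eq_bigr => i _; rewrite !mxE.
have freeR : row_free R.
  apply: inj_row_free => r rR; apply/rowP => i; rewrite mxE -ext_in; apply: inj.
    exact: ext_out.
  move=> b bB; have := extR r (enum_rank_in bB b).
  by rewrite enum_rankK_in // rR mxE => <-.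
split; first by rewrite -(eqP freeR) rank_leq_col.
move=> e t; have fullR : row_full R by rewrite /row_full (eqP freeR) e.
pose tv := \row_(j < #|B|) t (enum_val j).
have [D eD] := submxP (submx_full tv fullR).
exists (ext D); first exact: ext_out.
move=> b bB; have := extR D (enum_rank_in bB b).
by rewrite enum_rankK_in // -eD mxE enum_rankK_in.
Qed.

Lemma odd_permutation (V : finType) (M N : V -> V -> int) :
  (forall a b, \sum_c M a c * N c b = (a == b)%:R) ->
  exists2 sigma : V -> V, bijective sigma & forall v, odd `|M (sigma v) v|%N.
Proof.
move=> MN; pose mx (P : V -> V -> int) : 'M[int]_(#|V|) :=
  \matrix_(i, j) P (enum_val i) (enum_val j).
have e1 : mx M *m mx N = 1%:M.
  apply/matrixP => i j; rewrite !mxE -(inj_eq enum_val_inj) -MN.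
  rewrite [RHS](reindex (@enum_val _ (mem V))) /=; last first.
    by apply: onW_bij; apply: enum_val_bij.
  by apply: eq_bigr => k _; rewrite !mxE.
have : ~~ (2 %| \det (mx M))%Z.
  apply/negP => d2; have := dvdz_mulr (\det (mx N)) d2.
  by rewrite -det_mulmx e1 det1.
rewrite /determinant.
have [s hs|no] := pickP (fun s : {perm 'I_(#|V|)} => [forall i, odd `|mx M i (s i)|%N]); last first.
  case/negP; apply: rpred_sum => s _; apply: dvdz_mull.
  have /negbT/forallPn[i] := no s; rewrite -dvdn2 => ev.
  by rewrite (bigD1 i) //= dvdz_mulr.
move=> _; exists (fun v => enum_val ((s^-1)%g (enum_rank v))).
  exists (fun v => enum_val (s (enum_rank v))) => v.
    by rewrite enum_valK permKV enum_rankK.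
  by rewrite enum_valK permK enum_rankK.
by move=> v; have := forallP hs ((s^-1)%g (enum_rank v)); rewrite !mxE permKV enum_rankK.
Qed.

Lemma bij_leq_eq (V : finType) (d : V -> nat) (s : V -> V) : bijective s ->
  (forall v, d v <= d (s v))%N -> forall v, d (s v) = d v.
Proof.
move=> bs h v; apply/eqP; rewrite eqn_leq h andbT leqNgt; apply/negP => lv.
have : (\sum_u d u = \sum_u d (s u))%N by apply: reindex; apply: onW_bij.
rewrite (bigD1 v) //= [RHS](bigD1 v) //=.
have : (\sum_(i | i != v) d i <= \sum_(i | i != v) d (s i))%N by apply: leq_sum.
lia.
Qed.

End LinearAlgebra.

(** * Star and link domination as preorders, and degrees *)

Section Dominance.
Context {G : graph}.
Implicit Types (a b c h v w x y : G).

Definition stdom a h : bool := [forall w, adj a w ==> star h w].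

Lemma stdomP a h : reflect (forall w, adj a w -> star h w) (stdom a h).
Proof. by apply: (iffP forallP) => H w; [apply/implyP|apply/implyP/H]. Qed.

Lemma stdom_refl a : stdom a a.
Proof. by apply/stdomP => w E; rewrite /star E orbT. Qed.

Lemma star_sym a b : star a b = star b a.
Proof. by rewrite /star eq_sym adj_sym. Qed.

Lemma stdom_trans b a c : stdom a b -> stdom b c -> stdom a c.
Proof.
move=> /stdomP ab /stdomP bc; apply/stdomP => p ap.
case/orP: (ab p ap) => [/eqP pb|]; last exact: bc.
rewrite {p}pb in ap *; have ba : adj b a by rewrite adj_sym.
case/orP: (bc a ba) => [/eqP <-|ca]; first by rewrite /star ap orbT.
have ac : adj a c by rewrite adj_sym.
by rewrite star_sym; apply: ab.
Qed.

Lemma lkdom_stdom a b : lkdom a b -> stdom a b.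
Proof. by move=> /lkdomP h; apply/stdomP => w /h E; rewrite /star E orbT. Qed.

Lemma stdom_lkdom a b : ~~ adj a b -> stdom a b -> lkdom a b.
Proof.
move=> nE /stdomP h; apply/lkdomP => w E; case/orP: (h w E) => // /eqP e.
by rewrite -e E in nE.
Qed.

Lemma stdom_star a b c : adj a b -> stdom a b -> star a c -> star b c.
Proof.
move=> E /stdomP h; case/orP => [/eqP->|]; last exact: h.
by rewrite star_sym /star E orbT.
Qed.

Definition deg a := #|[set c | adj a c]|.

Lemma card_star a : #|[set c | star a c]| = (deg a).+1.
Proof.
rewrite /deg (_ : [set c | star a c] = a |: [set c | adj a c]).
  by rewrite cardsU1 inE adj_irr.
by apply/setP => c; rewrite !inE.
Qed.

Lemma lkdom_deg a b : lkdom a b -> deg a <= deg b.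
Proof. by move=> /lkdomP h; apply/subset_leq_card/subsetP => c; rewrite !inE => /h. Qed.

Lemma lkdom_deg_eq a b : lkdom a b -> deg b <= deg a -> adj b =1 adj a.
Proof.
move=> /lkdomP h d c; have : [set c | adj a c] = [set c | adj b c].
  by apply/eqP; rewrite eqEcard d andbT; apply/subsetP => e; rewrite !inE => /h.
by move/setP/(_ c); rewrite !inE.
Qed.

Lemma stdom_deg_sym a b : stdom a b -> deg b <= deg a -> stdom b a.
Proof.
move=> h d; have [E|nE] := boolP (adj a b); last first.
  by apply/stdomP => w; rewrite (lkdom_deg_eq (stdom_lkdom nE h) d) /star => ->; rewrite orbT.
have : [set c | star a c] = [set c | star b c].
  apply/eqP; rewrite eqEcard !card_star ltnS d andbT; apply/subsetP => c.
  by rewrite !inE; apply: stdom_star.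
move/setP => e; apply/stdomP => w bw; have := e w; rewrite !inE => ->.
by rewrite /star bw orbT.
Qed.

(** The finite set of edges is mapped injectively into itself, hence onto itself. *)
Lemma adj_inj_eq (s : G -> G) : injective s -> (forall v w, adj v w -> adj (s v) (s w)) ->
  forall v w, adj (s v) (s w) = adj v w.
Proof.
move=> injs sadj v w; apply/idP/idP; last exact: sadj.
pose S := [set e : G * G | adj e.1 e.2]; pose F (e : G * G) := (s e.1, s e.2).
have injF : injective F by case=> [a b] [c d] [/injs-> /injs->].
have FS : F @: S \subset S.
  by apply/subsetP => _ /imsetP[e + ->]; rewrite !inE; apply: sadj.
have eFS : F @: S = S by apply/eqP; rewrite eqEcard FS (card_imset _ injF) leqnn.
move=> E; have : (s v, s w) \in F @: S by rewrite eFS inE.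
by case/imsetP=> [[a b]]; rewrite inE => /= E' [/injs-> /injs->].
Qed.

End Dominance.

(** * The odd permutation is a graph symmetry compatible with domination *)

Section Symmetry.
Local Open Scope ring_scope.
Context {G : graph}.
Variables (f f' : G -> raag G) (sigma : G -> G).
Hypotheses (pf : inv_pair f f') (bsigma : bijective sigma).
Hypothesis sigma0 : forall v, chi (sigma v) (f v) != 0.
Implicit Types (a b c h v w x y : G).

Let M b v : rat := (chi b (f v))%:~R.
Let N b v : rat := (chi b (f' v))%:~R.

Lemma chi_gn b v : chi b (gn v) = (b == v)%:R.
Proof. by rewrite chi_lt /sg eq_sym /=; case: eqP. Qed.

Lemma chi_inv_pair b v (k k' : G -> raag G) : inv_pair k k' ->
  \sum_c chi b (k c) * chi c (k' v) = (b == v)%:R.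
Proof.
case=> hk _ _ e; rewrite -chi_gn -e chi_ev //.
by apply: eq_bigr => c _; rewrite mulrC.
Qed.

Let NM b v : \sum_c N b c * M c v = (b == v)%:R.
Proof.
rewrite -[RHS](rmorph_nat (intr : {rmorphism int -> rat})).
rewrite -(chi_inv_pair b v (inv_pair_sym pf)) rmorph_sum.
by apply: eq_bigr => c _; rewrite -intrM.
Qed.

Let M0 b v : (M b v != 0) = (chi b (f v) != 0).
Proof. by rewrite intr_eq0. Qed.

Let Mker (s : G -> rat) : (forall b, \sum_c s c * M b c = 0) -> forall c, s c = 0.
Proof.
move=> h c; transitivity (\sum_b N c b * (\sum_d s d * M b d)).
  transitivity (\sum_d s d * \sum_b N c b * M b d).
    under eq_bigr do rewrite NM.
    rewrite (bigD1 c) //= eqxx mulr1 big1 ?addr0 // => d /negPf nd.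
    by rewrite eq_sym nd mulr0.
  under eq_bigr do rewrite mulr_sumr.
  rewrite exchange_big /=; apply: eq_bigr => b _; rewrite mulr_sumr.
  by apply: eq_bigr => d _; ring.
by rewrite big1 // => b _; rewrite h mulr0.
Qed.

Let minor v w a b : star v w -> a != b -> ~~ adj a b -> M a w * M b v = M a v * M b w.
Proof.
move=> sw nab nE; rewrite -!intrM (@commute_minor _ a b) //.
have [hf _ _ _] := pf; case/orP: sw => [/eqP->|E]; first exact: commute_refl.
by apply: hf; rewrite adj_sym.
Qed.

(** Linear extension of [minor] from one column in the star of [v] to combinations of such
    columns. *)
Let minors v (s : G -> rat) a b : (forall c, ~~ star v c -> s c = 0) ->
  a != b -> ~~ adj a b ->
  (\sum_c s c * M a c) * M b v = M a v * (\sum_c s c * M b c).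
Proof.
move=> s0 nab nE; rewrite mulr_suml mulr_sumr; apply: eq_bigr => c _.
have [sc|/s0->] := boolP (star v c); last by rewrite !mul0r mulr0.
by rewrite -mulrA (minor sc) // mulrCA.
Qed.

(** A combination of columns of [st v] that vanishes on the rows of [st a] vanishes on every other
    row too: the minor of that row with row [a] has the nonzero factor [M a v]. *)
Let restr_inj v a : M a v != 0 -> forall s : G -> rat,
  (forall c, c \notin [set c | star v c] -> s c = 0) ->
  (forall b, b \in [set c | star a c] -> \sum_c s c * M b c = 0) -> forall c, s c = 0.
Proof.
move=> Mav s s0 h; apply: Mker => q.
have [sq|] := boolP (star a q); first by apply: h; rewrite inE.
rewrite /star negb_or => /andP[nq nE].
have s0' c : ~~ star v c -> s c = 0 by move=> n; apply: s0; rewrite inE.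
have := minors s0' _ nE; rewrite eq_sym nq h ?inE /star ?eqxx // mul0r => /(_ isT)/esym/eqP.
by rewrite mulf_eq0 (negPf Mav) => /eqP.
Qed.

Let deg_le v a : chi a (f v) != 0 -> (deg v <= deg a)%N.
Proof.
rewrite -M0 => /restr_inj/injective_restriction[+ _].
by rewrite !card_star ltnS.
Qed.

Let deg_sigma v : deg (sigma v) = deg v.
Proof. by apply: (@bij_leq_eq _ _ sigma) => // w; apply/deg_le/sigma0. Qed.

(** Equal degrees make the block of [restr_inj] square, hence onto. If [b] in the link of [a] were
    outside the star of [h], a combination of columns equal to the unit vector at [b] on [st a]
    would force [M h v = 0], by the minors of [h] with [b] and with [a]. *)
Lemma sigma_stdom v h : chi h (f v) != 0 -> stdom (sigma v) h.
Proof.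
rewrite -M0 => Mh; set a := sigma v; have Ma : M a v != 0 by rewrite M0; apply: sigma0.
have [_] := injective_restriction (restr_inj Ma).
rewrite !card_star deg_sigma => /(_ erefl) surj.
apply/stdomP => b Eab; apply/negPn/negP => nhb.
have [s s0 hs] := surj (fun c => (c == b)%:R).
have s0' c : ~~ star v c -> s c = 0 by move=> n; apply: s0; rewrite inE.
have yb : \sum_c s c * M b c = 1 by rewrite hs ?eqxx // inE /star Eab orbT.
have ya : \sum_c s c * M a c = 0.
  by rewrite hs ?(negPf (adj_neq Eab)) // inE /star eqxx.
move: (nhb); rewrite /star negb_or => /andP[nbh nE].
have := minors s0' _ nE; rewrite eq_sym nbh yb mulr1 => /(_ isT) e1.
have [sah|] := boolP (star a h).
  move: e1; rewrite hs ?inE // eq_sym (negPf nbh) mul0r => e1.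
  by rewrite -e1 eqxx in Mh.
rewrite /star negb_or => /andP[nha nE'].
have := minors s0' _ nE'; rewrite eq_sym nha ya mul0r => /(_ isT)/esym/eqP.
rewrite mulf_eq0 (negPf Ma) /= => /eqP yh.
by move: e1; rewrite yh mul0r => e1; rewrite -e1 eqxx in Mh.
Qed.

(* A set [Q] of vertices closed under domination spans a subspace that [f]
   maps onto from the span of the preimage of [Q] under [sigma]. *)
Let upclosed_inv (Q : pred G) (t : G -> rat) :
  (forall a h, Q a -> stdom a h -> Q h) -> (forall h, ~~ Q h -> t h = 0) ->
  forall v, \sum_h N v h * t h != 0 -> Q (sigma v).
Proof.
move=> Qup t0; pose A := [set v | Q (sigma v)]; pose B := [set h | Q h].
have out s h : (forall c, c \notin A -> s c = 0) -> ~~ Q h -> \sum_c s c * M h c = 0.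
  move=> s0 nh; rewrite big1 // => c _; have [cA|/s0->] := boolP (c \in A); last by rewrite mul0r.
  have [->|nz] := eqVneq (M h c) 0; first by rewrite mulr0.
  rewrite M0 in nz; case/negP: nh; apply: Qup (sigma_stdom nz).
  by rewrite inE in cA.
have inj s : (forall c, c \notin A -> s c = 0) ->
    (forall b, b \in B -> \sum_c s c * M b c = 0) -> forall c, s c = 0.
  move=> s0 h; apply: Mker => b; have [Qb|nQ] := boolP (Q b); last exact: out.
  by apply: h; rewrite inE.
have [_] := injective_restriction inj.
have [s' s1 s2] := bsigma.
have cAB : #|A| = #|B|.
  have <- : sigma @: A = B.
    apply/setP => h; rewrite inE; apply/imsetP/idP => [[v]|Qh].
      by rewrite inE => Qv ->.
    by exists (s' h); rewrite ?inE s2.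
  by rewrite card_imset //; apply: can_inj s1.
move=> /(_ cAB t)[s s0 hs] v; have Ms b : t b = \sum_c s c * M b c.
  have [Qb|nQ] := boolP (Q b); first by rewrite hs // inE.
  by rewrite t0 // out.
have -> : \sum_h N v h * t h = s v.
  under eq_bigr do rewrite Ms mulr_sumr.
  rewrite exchange_big /= (bigD1 v) //= [X in _ + X]big1 ?addr0.
    under eq_bigr do rewrite mulrCA.
    by rewrite -mulr_sumr NM eqxx mulr1.
  move=> c /negPf nc; under eq_bigr do rewrite mulrCA.
  by rewrite -mulr_sumr NM eq_sym nc mulr0.
by apply: contraNT => nQ; rewrite s0 // inE.
Qed.

Lemma inv_stdom v h : (forall w, stdom w (sigma w)) -> chi h (f' v) != 0 -> stdom v h.
Proof.
move=> ws nz; have := @upclosed_inv (stdom v) (fun c => (c == v)%:R) _ _ h.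
have e : \sum_c N h c * (c == v)%:R = N h v.
  rewrite (bigD1 v) //= eqxx mulr1 big1 ?addr0 // => c /negPf->.
  by rewrite mulr0.
rewrite e intr_eq0 nz => H; have Q : stdom v (sigma h).
  apply: H => // [a c va ac|c]; first exact: stdom_trans ac.
  by case: eqP => // -> /negP[]; apply: stdom_refl.
apply: stdom_trans Q _; apply: stdom_deg_sym => //.
by rewrite deg_sigma.
Qed.

Let sigma_adj_imp v w : adj v w -> adj (sigma v) (sigma w).
Proof.
move=> E; set x := sigma v; set y := sigma w; apply/negPn/negP => nE.
have nwv : w != v by rewrite eq_sym; apply: adj_neq.
have nxy : x != y by rewrite (bij_eq bsigma) eq_sym.
have sw : star v w by rewrite /star E orbT.
have [Mx My] : M x v != 0 /\ M y w != 0 by rewrite !M0; split; apply: sigma0.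
have := minor sw nxy nE => e1.
have nz : M x w * M y v != 0 by rewrite e1 mulf_neq0.
move: (nz); rewrite mulf_eq0 negb_or !M0 => /andP[/sigma_stdom yx /sigma_stdom xy].
(* Vanishing minors make [d] zero on all rows not adjacent to [x], so it lives strictly above [x].
   Its preimage has coordinate [1] at [w], which would put [y] strictly above [x]. *)
pose t := M x w / M x v; pose d b := M b w - t * M b v.
have d0 b : ~~ adj x b -> d b = 0.
  rewrite /d /t; have [->|nbx] := eqVneq b x; first by rewrite divfK // subrr.
  move=> nb; have := minor sw _ nb; rewrite eq_sym nbx => /(_ isT) e.
  apply/eqP; rewrite subr_eq0 mulrAC e; apply/eqP; field.
  exact: Mx.
pose Q b := stdom x b && ~~ stdom b x.
have Qd b : ~~ Q b -> d b = 0.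
  apply: contraNeq => nd; have Exb : adj x b by apply: contraT => /d0 e; rewrite e eqxx in nd.
  apply/andP; split.
    have [z1|] := eqVneq (M b w) 0; last by rewrite M0 => /sigma_stdom; apply: stdom_trans.
    have [z2|] := eqVneq (M b v) 0; last by rewrite M0 => /sigma_stdom.
    by rewrite /d z1 z2 mulr0 subrr eqxx in nd.
  apply/negP => /stdomP bx; case/orP: (stdomP _ _ xy b Exb) => [/eqP e|Eyb].
    by rewrite -e Exb in nE.
  rewrite adj_sym in Eyb; case/orP: (bx y Eyb) => [/eqP e|Exy].
    by rewrite e eqxx in nxy.
  by rewrite Exy in nE.
have Qup a h : Q a -> stdom a h -> Q h.
  move=> /andP[xa nax] ah; apply/andP; split; first exact: stdom_trans ah.
  by apply: contra nax; apply: stdom_trans.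
have := @upclosed_inv Q d Qup Qd w; have -> : \sum_h N w h * d h = 1.
  rewrite /d; under eq_bigr do rewrite mulrBr mulrCA.
  by rewrite sumrB NM eqxx -mulr_sumr NM (negPf nwv) mulr0 subr0.
by rewrite oner_eq0 => /(_ isT)/andP[_]; rewrite -/y yx.
Qed.

Lemma sigma_adj v w : adj (sigma v) (sigma w) = adj v w.
Proof. by apply: adj_inj_eq; [apply: bij_inj|apply: sigma_adj_imp]. Qed.

End Symmetry.

(** * Elementary automorphisms *)

Section Elementary.
Context {G : graph}.
Implicit Types (a b c u v w : G).

Lemma gn_comm u v : adj u v -> commute (gn u) (gn v).
Proof. by move=> E; apply: lt_comm. Qed.

Lemma star_comm u v : star u v -> commute (gn u) (gn v).
Proof. by case/orP=> [/eqP->|/gn_comm//]; apply: commute_refl. Qed.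

Lemma commute_gnlt u v s : commute (gn u) (gn v) -> commute (gn u) (lt (v, s)).
Proof.
by case: s => // c; rewrite -[lt (v, true)]/(lt (linv (v, false))) lt_inv; apply: commuteV.
Qed.

Section MultiTransvection.
Variables (S : pred G) (c : G -> G).
Hypotheses (Sadj : forall u w, S u -> adj u w -> ~~ S w)
  (Sc : forall u, S u -> ~~ S (c u)) (cdom : forall u, S u -> stdom u (c u)).

(** A lift of one transvection acts on a whole fibre [S] at once, with a multiplier [c u] that
    depends on the point. *)
Definition mtv (s : bool) u : raag G := if S u then gn u * lt (c u, s) else gn u.

Lemma hom_mtv s : hom (mtv s).
Proof.
have H u w : S u -> adj u w -> commute (gn u * lt (c u, s)) (gn w).
  move=> Su E; apply/commute_sym/commuteM; first by apply: gn_comm; rewrite adj_sym.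
  by apply/commute_gnlt/commute_sym/star_comm; apply: (stdomP _ _ (cdom Su)).
move=> u w E; rewrite /mtv; case: ifP => Su.
  by rewrite (negPf (Sadj Su E)); apply: H.
by case: ifP => Sw; [apply/commute_sym/H; rewrite 1?adj_sym | apply: gn_comm].
Qed.

Lemma mtv_inv s : inv_pair (mtv s) (mtv (~~ s)).
Proof.
split; try exact: hom_mtv.
  move=> u; rewrite {2}/mtv; case: ifP => Su; last by rewrite ev_gn ?/mtv ?Su //; apply: hom_mtv.
  rewrite evM ?ev_gn ?ev_lt; try exact: hom_mtv.
  rewrite /mtv Su /evl /= (negPf (Sc Su)) -!mulgA -[RHS]mulg1; congr (_ * _).
  rewrite -[lt (_, ~~ s)]/(lt (linv (c u, s))) lt_inv.
  case: s => /=; last by rewrite mulVg.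
  by rewrite -[lt (_, true)]/(lt (linv (c u, false))) lt_inv invgK mulgV.
move=> u; rewrite {2}/mtv; case: ifP => Su; last by rewrite ev_gn ?/mtv ?Su //; apply: hom_mtv.
rewrite evM ?ev_gn ?ev_lt; try exact: hom_mtv.
rewrite /mtv Su /evl /= (negPf (Sc Su)) -!mulgA -[RHS]mulg1; congr (_ * _).
case: s => /=; last by rewrite mulgV.
by rewrite -[lt (_, true)]/(lt (linv (c u, false))) lt_inv mulVg.
Qed.

Lemma chi_mtv s b u :
  chi b (mtv s u) = ((b == u)%:R + (S u && (b == c u))%:R * (-1) ^+ s)%R.
Proof.
rewrite /mtv; case: ifP => _; last by rewrite chi_gn mul0r addr0.
rewrite chiM chi_gn chi_lt /sg /= (eq_sym (c u)); congr (_ + _)%R.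
by case: (b == c u); rewrite ?mul1r ?mul0r.
Qed.

End MultiTransvection.

Section PartialConjugation.
Variables (v : G) (C : pred G).
Hypotheses (Cv : forall x, C x -> ~~ star v x)
  (Cadj : forall x y, C x -> ~~ star v y -> adj x y -> C y).

Definition pcj (s : bool) u : raag G :=
  if C u then lt (v, s) * gn u * (lt (v, s))^-1 else gn u.

Lemma hom_pcj s : hom (pcj s).
Proof.
have H x y : C x -> ~~ C y -> adj x y ->
    commute (lt (v, s) * gn x * (lt (v, s))^-1) (gn y).
  move=> Cx nCy E; have /orP[/eqP e|Evy] : star v y.
      by apply: contraNT nCy => ny; apply: Cadj E.
    by move: (Cv Cx); rewrite /star adj_sym -e E orbT.
  have c : commute (gn y) (lt (v, s)) by apply/commute_gnlt/gn_comm; rewrite adj_sym.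
  apply/commute_sym/commuteM; last exact: commuteV.
  by apply: commuteM => //; apply: gn_comm; rewrite adj_sym.
move=> x y E; rewrite /pcj; case: ifPn => Cx; case: ifPn => Cy.
- by apply: commute_conj; rewrite -!mulgA mulVg mulg1 mulKg; apply: gn_comm.
- exact: H.
- by apply/commute_sym/H; rewrite // adj_sym.
- exact: gn_comm.
Qed.

Lemma pcj_inv s : inv_pair (pcj s) (pcj (~~ s)).
Proof.
have nCv : C v = false by apply/negP => /Cv; rewrite /star eqxx.
split; try exact: hom_pcj.
  move=> x; rewrite {2}/pcj; case: ifP => Cx; last by rewrite ev_gn ?/pcj ?Cx //; apply: hom_pcj.
  rewrite !evM ?evV ?ev_gn ?ev_lt; try exact: hom_pcj.
  rewrite /pcj Cx /evl /= nCv -[lt (v, ~~ s)]/(lt (linv (v, s))) lt_inv invgK.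
  have -> : (if s then (gn v)^-1 else gn v) = lt (v, s).
    by case: (s); rewrite // -[lt (v, true)]/(lt (linv (v, false))) lt_inv.
  by rewrite -!mulgA mulgV mulg1 mulVKg.
move=> x; rewrite {2}/pcj; case: ifP => Cx; last by rewrite ev_gn ?/pcj ?Cx //; apply: hom_pcj.
rewrite !evM ?evV ?ev_gn ?ev_lt; try exact: hom_pcj.
rewrite /pcj Cx /evl /= nCv.
have -> : (if ~~ s then (gn v)^-1 else gn v) = (lt (v, s))^-1.
  by rewrite -lt_inv /linv /=; case: (s); rewrite // -[lt (v, true)]/(lt (linv (v, false))) lt_inv.
by rewrite invgK -!mulgA mulVg mulg1 mulKg.
Qed.

Lemma chi_pcj s b u : chi b (pcj s u) = (b == u)%:R%R.
Proof.
rewrite /pcj; case: ifP => _; last exact: chi_gn.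
by rewrite !chiM chiV chi_gn addrAC addrN add0r.
Qed.

End PartialConjugation.
End Elementary.

(** * Regular coverings *)

Record covering (L G : graph) := Covering {
  cmap :> L -> G;
  cov_surj : forall v, exists u, cmap u = v;
  cov_adj : forall u w, adj u w -> adj (cmap u) (cmap w);
  cov_inj : forall u u1 u2, adj u u1 -> adj u u2 -> cmap u1 = cmap u2 -> u1 = u2;
  cov_lift : forall u v, adj (cmap u) v -> exists2 w, adj u w & cmap w = v;
  cov_deck : forall u w, cmap u = cmap w -> exists mu : L -> L,
    [/\ forall a b, adj (mu a) (mu b) = adj a b,
        injective mu, forall a, cmap (mu a) = cmap a & mu u = w];
  cov_noiso : forall v : G, exists w, adj v w }.

Section Covering.
Context {L G : graph} (phi : covering L G).
Implicit Types (u w x y z i j : L) (a b v : G).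

Definition push (g : raag L) : raag G := ev (fun u => gn (phi u)) g.

Lemma hom_phi : hom (fun u => gn (phi u)).
Proof. by move=> u w /(cov_adj phi)/gn_comm. Qed.

Lemma pushM g h : push (g * h) = push g * push h. Proof. exact/evM/hom_phi. Qed.
Lemma pushV g : push g^-1 = (push g)^-1. Proof. exact/evV/hom_phi. Qed.
Lemma push1 : push 1 = 1. Proof. exact/ev1/hom_phi. Qed.
Lemma push_gn u : push (gn u) = gn (phi u). Proof. exact/ev_gn/hom_phi. Qed.

Lemma push_lt u s : push (lt (u, s)) = lt (phi u, s).
Proof.
rewrite /push ev_lt; last exact: hom_phi.
by rewrite /evl /=; case: s; rewrite // -[lt _]/(lt (linv (phi u, false))) lt_inv.
Qed.

Lemma push_inp (P : pred L) (Q : pred G) g :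
  (forall u, P u -> Q (phi u)) -> inp P g -> inp Q (push g).
Proof.
by move=> PQ; apply: ev_inp => [|u /PQ q]; [apply: hom_phi|apply/inp_lt].
Qed.

Lemma cov_noisoL u : exists w, adj u w.
Proof.
by have [v /cov_lift[w E _]] := cov_noiso phi (phi u); exists w.
Qed.

Lemma fiber_nadj u w : phi u = phi w -> ~~ adj u w.
Proof. by move=> e; apply/negP => /(cov_adj phi); rewrite e adj_irr. Qed.

(** Points of one fibre are not adjacent, and distinct ones share no neighbour because a covering is
    injective on links. *)
Lemma fiber_star u w z : phi u = phi w -> star u z -> star w z -> u = w.
Proof.
move=> e /orP[/eqP->|Euz] /orP[/eqP//|Ewz].
- by move: (fiber_nadj e); rewrite adj_sym Ewz.
- by move=> zw; move: (fiber_nadj e); rewrite -zw Euz.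
- by apply: (cov_inj (u := z)) e; rewrite adj_sym.
Qed.

Lemma stdom_uniq u w w' : stdom u w -> stdom u w' -> phi w = phi w' -> w = w'.
Proof.
have [z E] := cov_noisoL u.
by move=> /stdomP/(_ z E) h /stdomP/(_ z E) h' e; apply: fiber_star h h'.
Qed.

Lemma star_phi u w : star u w -> star (phi u) (phi w).
Proof. by case/orP => [/eqP->|/(cov_adj phi) E]; rewrite /star ?eqxx // E orbT. Qed.

Lemma deg_phi u : deg (phi u) = deg u.
Proof.
rewrite /deg -(card_in_imset (f := phi) (D := [set c | adj u c])); last first.
  by move=> w z; rewrite !inE; apply: cov_inj.
apply: eq_card => a; rewrite !inE; apply/idP/imsetP.
  by case/cov_lift => w E <-; exists w; rewrite ?inE.
by case=> w; rewrite inE => /(cov_adj phi) + ->.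
Qed.

(** Domination seen in [L], in general stricter than [stdom] on [G]. Regularity makes it hold at
    every point over [v], see [pdom_lift]; this is what lets a transvection lift. *)
Definition pdom v b := [exists u, exists w, [&& phi u == v, phi w == b & stdom u w]].

Lemma pdomI u w : stdom u w -> pdom (phi u) (phi w).
Proof. by move=> h; apply/existsP; exists u; apply/existsP; exists w; rewrite !eqxx. Qed.

Lemma pdom_lift u b : pdom (phi u) b -> exists2 w, stdom u w & phi w = b.
Proof.
case/existsP=> u' /existsP[w' /and3P[/eqP eu /eqP <- d]].
have [mu [muadj muinj muphi <-]] := cov_deck eu.
exists (mu w') => //; apply/stdomP => z; rewrite adj_sym => E.
have [z' ez] : exists z', mu z' = z.
  by have [nu _ nu'] := injF_bij muinj; exists (nu z).
rewrite -ez muadj adj_sym in E; have := stdomP _ _ d _ E.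
by rewrite -ez /star muadj (inj_eq muinj).
Qed.

Lemma pdom_trans b v a : pdom v b -> pdom b a -> pdom v a.
Proof.
have [u <-] := cov_surj phi v => /pdom_lift[w d1 <-] /pdom_lift[z d2 <-].
exact/pdomI/(stdom_trans d1).
Qed.

Lemma pdom_stdom v b : pdom v b -> stdom v b.
Proof.
have [u <-] := cov_surj phi v => /pdom_lift[w d <-]; apply/stdomP => _ /cov_lift[z E <-].
exact/star_phi/(stdomP _ _ d).
Qed.

Lemma stdom_adj_phi u w : stdom u w -> adj (phi u) (phi w) = adj u w.
Proof.
move=> d; apply/idP/idP => [E|]; last exact: cov_adj.
apply: contraT => nE; have /lkdomP h := stdom_lkdom nE d.
have [z Ez ez] := cov_lift E; have := cov_adj phi (h z Ez).
by rewrite ez adj_irr.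
Qed.

Lemma pdom_deg_sym v b : pdom v b -> deg b <= deg v -> pdom b v.
Proof.
have [u <-] := cov_surj phi v => /pdom_lift[w d <-]; rewrite !deg_phi => h.
exact/pdomI/stdom_deg_sym.
Qed.

Lemma chi_push a g : chi a (push g) = (\sum_(u | phi u == a) chi u g)%R.
Proof.
rewrite /push chi_ev; last exact: hom_phi.
rewrite [RHS]big_mkcond; apply: eq_bigr => u _.
by rewrite chi_gn eq_sym; case: ifP => _; rewrite ?mulr1 ?mulr0.
Qed.

Definition lifts (f : G -> raag G) (F : L -> raag L) :=
  forall u, push (F u) = f (phi u).

Lemma lifts_comp f F h H : hom f -> hom F -> hom h -> lifts f F -> lifts h H ->
  lifts (fun v => ev f (h v)) (fun u => ev F (H u)).
Proof.
move=> hf hF hh l1 l2 u; rewrite -l2 /push.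
rewrite [LHS]ev_comp //; last exact: hom_phi.
rewrite [RHS]ev_comp //; last exact: hom_phi.
by apply: eq_ev => w; rewrite ev_gn.
Qed.

Section ChiLift.
Variables (f : G -> raag G) (F : L -> raag L).
Hypothesis lf : lifts f F.

(** By [stdom_uniq] at most one point of a fibre dominates [u], so the fibre sum of [chi_push] has a
    single nonzero term at most. *)
Lemma chi_lift u w : (forall b : L, chi b (F u) != 0%R -> stdom u b) -> stdom u w ->
  chi (phi w) (f (phi u)) = chi w (F u).
Proof.
move=> Fd d; rewrite -lf chi_push (bigD1 w) //= big1 ?addr0 // => w' /andP[/eqP e nw].
by apply: contraNeq nw => /Fd d'; rewrite (stdom_uniq d' d e).
Qed.

Lemma chi_lift_ex u a : (forall b : L, chi b (F u) != 0%R -> stdom u b) ->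
  chi a (f (phi u)) != 0%R -> exists w, [/\ phi w = a, stdom u w & chi w (F u) != 0%R].
Proof.
move=> Fd nz; have [w /andP[/eqP e nw]|no] := pickP (fun w => (phi w == a) && (chi w (F u) != 0%R)).
  by exists w; split=> //; apply: Fd.
case/eqP: nz; rewrite -lf chi_push big1 // => w e.
by apply/eqP; have := no w; rewrite e /= => /negbFE.
Qed.

End ChiLift.

Section TransvectionLift.
Variables (v b : G).
Hypotheses (vb : v != b) (dvb : pdom v b).

(** The default is never reached over [v], the only place where [tvL] consults [tvc]. *)
Definition tvc u := odflt u [pick w | (phi w == b) && stdom u w].

Lemma tvcP u : phi u = v -> phi (tvc u) = b /\ stdom u (tvc u).
Proof.
move=> e; rewrite /tvc; case: pickP => [w /andP[/eqP-> ->]//|no].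
by move: dvb; rewrite -e => /pdom_lift[w d ew]; have := no w; rewrite ew eqxx d.
Qed.

Definition tv s : G -> raag G := mtv (pred1 v) (fun=> b) s.
Definition tvL s : L -> raag L := mtv (fun u => phi u == v) tvc s.

Lemma tv_inv s : inv_pair (tv s) (tv (~~ s)).
Proof.
apply: mtv_inv => [u w /eqP-> E|u _|u /eqP->] /=.
- by rewrite eq_sym adj_neq.
- by rewrite eq_sym.
- exact: pdom_stdom.
Qed.

Lemma tvL_inv s : inv_pair (tvL s) (tvL (~~ s)).
Proof.
apply: mtv_inv => [u w /eqP e E|u /eqP e|u /eqP e].
- by rewrite -e eq_sym; apply: adj_neq; apply: cov_adj.
- by have [-> _] := tvcP e; rewrite eq_sym.
- by have [] := tvcP e.
Qed.

Lemma tv_lifts s : lifts (tv s) (tvL s).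
Proof.
move=> u; rewrite /tv /tvL /mtv /=; case: eqP => [e|_]; last exact: push_gn.
by rewrite pushM push_gn push_lt; have [-> _] := tvcP e.
Qed.

Lemma tvL_stdom s u w : chi w (tvL s u) != 0%R -> stdom u w.
Proof.
rewrite chi_mtv; have [-> _|_] := eqVneq w u; first exact: stdom_refl.
have [e|_] /= := eqVneq (phi u) v; last by rewrite mul0r addr0 eqxx.
have [-> _|_] := eqVneq w (tvc u); first by have [] := tvcP e.
by rewrite mul0r addr0 eqxx.
Qed.

End TransvectionLift.

(* Conjugation on a set of components of [L \ st i], for various [i] over [v]:
   a piece is a sign, the vertex [i] and the set. *)
Section ConjugationLift.
Variable v : G.

Definition piece : Type := bool * L * {set L}.
Definition piece_ok (e : piece) :=
  [/\ phi e.1.2 = v, forall x, x \in e.2 -> ~~ star e.1.2 x &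
      forall x y, x \in e.2 -> ~~ star e.1.2 y -> adj x y -> y \in e.2].

Definition piece_val (e : piece) u : int := ((u \in e.2)%:R * (-1) ^+ e.1.1)%R.
Definition pieces_val (l : seq piece) u : int := (\sum_(e <- l) piece_val e u)%R.
Definition pieces_aut (l : seq piece) : L -> raag L :=
  foldr (fun (e : piece) (F : L -> raag L) u =>
    ev F (pcj e.1.2 (mem e.2) e.1.1 u)) (@gn L) l.

(** All conjugators seen in [A_G] are powers of the single vertex [v]; they commute, so the
    exponents of the pieces containing [u] add up to [pieces_val]. *)
Lemma pieces_autP (l : seq piece) : (forall e, e \in l -> piece_ok e) ->
  [/\ exists F', inv_pair (pieces_aut l) F',
      forall u (b : L), chi b (pieces_aut l u) = (b == u)%:R%R &
      forall u, exists k, [/\ inp (pred1 v) k, chi v k = pieces_val l u &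
        push (pieces_aut l u) = k * gn (phi u) * k^-1]].
Proof.
elim: l => [|e l IH] ok.
  split=> [|u b|u]; last first.
  - exists 1; rewrite chi1 /pieces_val big_nil mul1g invg1 mulg1 push_gn.
    by split=> //; apply: inp1.
  - exact: chi_gn.
  - by exists (@gn L); split=> *; rewrite ?ev_gn_id //; apply: hom_gn.
have [|[F' pF] cF kF] := IH; first by move=> e' le'; apply: ok; rewrite inE le' orbT.
have [ei e1 e2] : piece_ok e by apply: ok; rewrite mem_head.
have [hF _ _ _] := pF; have pP := pcj_inv e1 e2.
split=> [|u b|u] /=.
- by exists (fun w => ev (pcj e.1.2 (mem e.2) (~~ e.1.1)) (F' w)); apply: inv_pair_comp.
- rewrite chi_ev //; under eq_bigr do rewrite cF chi_pcj -natrM.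
  rewrite (bigD1 u) //= eqxx big1 ?addr0 => [|c /negPf nc]; first by rewrite mul1n.
  by rewrite nc.
have [k [ik ck ek]] := kF u; have [m [im cm em]] := kF e.1.2.
rewrite /pieces_val big_cons /piece_val -/(pieces_val l u).
have comm (p q : raag G) : inp (pred1 v) p -> inp (pred1 v) q -> commute p q.
  move=> ip iq; apply: commute_gen ip => x /eqP ex; apply/commute_sym.
  apply: commute_gen iq => y /eqP ey; case: (x) (y) ex ey => [a s] [b t] /= -> ->.
  case: t; rewrite -?[lt (v, true)]/(lt (linv (v, false))) ?lt_inv; last first.
    exact/commute_gnlt/commute_refl.
  exact/commute_sym/commuteV/commute_sym/commute_gnlt/commute_refl.
have iv s : inp (pred1 v) (lt (v, s)) by apply/inp_lt => /=.
rewrite /pcj inE; case: ifP => ue; last first.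
  by exists k; rewrite mul0r add0r ev_gn.
exists (lt (v, e.1.1) * k); split.
- exact: inpM.
- by rewrite chiM chi_lt /sg eqxx mul1r ck.
have ee : push (ev (pieces_aut l) (lt (e.1.2, e.1.1))) = lt (v, e.1.1).
  have gv : push (pieces_aut l e.1.2) = gn v.
    by rewrite em ei (comm _ _ im (iv false)) mulgK.
  rewrite ev_lt // /evl /=; case: (e.1.1); rewrite ?pushV gv //.
  by rewrite -[lt (v, true)]/(lt (linv (v, false))) lt_inv.
rewrite !evM ?evV // !pushM pushV ee ev_gn // ek.
by rewrite invgM !mulgA.
Qed.

(** Values over the star of [v] are ignored, since conjugation by a power of [v] is trivial
    there. *)
Definition spanned (c : L -> int) := exists l : seq piece,
  (forall e, e \in l -> piece_ok e) /\
  forall u, ~~ star v (phi u) -> c u = pieces_val l u.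

Lemma spannedD c d : spanned c -> spanned d -> spanned (fun u => (c u + d u)%R).
Proof.
move=> [l [ok1 e1]] [m [ok2 e2]]; exists (l ++ m); split=> [e|u nu].
  by rewrite mem_cat => /orP[/ok1|/ok2].
by rewrite e1 // e2 // /pieces_val big_cat.
Qed.

Lemma spannedN c : spanned c -> spanned (fun u => (- c u)%R).
Proof.
move=> [l [ok e]]; exists [seq (~~ p.1.1, p.1.2, p.2) | p <- l]; split=> [_ /mapP[p /ok h ->] //|u nu].
rewrite e // /pieces_val big_map -sumrN; apply: eq_bigr => p _.
by rewrite /piece_val /=; case: p.1.1 => /=; rewrite ?expr0 ?expr1; ring.
Qed.

Lemma spanned_eq c d : (forall u, ~~ star v (phi u) -> c u = d u) -> spanned c -> spanned d.
Proof. by move=> h [l [ok e]]; exists l; split=> // u nu; rewrite -h ?e. Qed.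

Lemma spanned_piece i (M : {set L}) : piece_ok (false, i, M) ->
  spanned (fun u => (u \in M)%:R%R).
Proof.
move=> ok; exists [:: (false, i, M)]; split=> [e|u _]; first by rewrite inE => /eqP->.
by rewrite /pieces_val big_seq1 /piece_val /= expr0 mulr1.
Qed.

Definition off i : rel L := fun x y => [&& adj x y, ~~ star i x & ~~ star i y].
Definition conn i := connect (off i).

Lemma conn_sym i x y : conn i x y = conn i y x.
Proof.
apply: sym_connect_sym => {}x {}y; rewrite /off adj_sym.
by case: (adj y x) => //=; rewrite andbC.
Qed.

Lemma conn_star i x y : conn i x y -> ~~ star i x -> ~~ star i y.
Proof.
case/connectP=> p; elim: p x => [|z p IH] x /=; first by move=> _ ->.
by case/andP=> /and3P[_ _ nz] pp e _; apply: IH pp e nz.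
Qed.

Lemma conn_adj i x y : adj x y -> ~~ star i x -> ~~ star i y -> conn i x y.
Proof. by move=> E nx ny; apply: connect1; rewrite /off E nx. Qed.

Lemma conn_avoid i j x y : conn j x y -> (forall z, conn j x z -> ~~ star i z) ->
  conn i x y.
Proof.
case/connectP=> p; elim: p x => [|z p IH] x /=; first by move=> _ ->; rewrite /conn connect0.
case/andP=> e pp ey h; have jz : conn j x z by apply: connect1.
apply: (connect_trans (y := z)).
  by have /and3P[E _ _] := e; apply: conn_adj => //; apply: h; rewrite // /conn connect0.
by apply: IH => // t ht; apply: h; apply: connect_trans ht.
Qed.

Definition together (l : seq L) x y := all (fun i => conn i x y) l.

Lemma together_sym l x y : together l x y = together l y x.
Proof. by apply: eq_all => i; apply: conn_sym. Qed.

Lemma together_trans l y x z : together l x y -> together l y z -> together l x z.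
Proof.
move=> /allP h1 /allP h2; apply/allP => i il.
exact: connect_trans (h1 i il) (h2 i il).
Qed.

(* Adding a point [i] to [l] only cuts the class of [i]: another class is
   separated from [i] by some [j] in [l], hence misses the star of [i] and
   stays connected outside it. *)
Lemma spanned_closed (l : seq L) (S : {set L}) :
  uniq l -> (forall i, i \in l -> phi i = v) ->
  (forall x y, x \in S -> together l x y -> y \in S) -> (l = [::] -> S = set0) ->
  spanned (fun u => (u \in S)%:R%R).
Proof.
elim: l S => [|i l IH] S /=.
  move=> _ _ _ /(_ erefl)->; exists [::]; split=> // u _.
  by rewrite inE /pieces_val big_nil.
case/andP=> il ul fib clS _.
have fi : phi i = v by apply: fib; rewrite mem_head.
have fl j : j \in l -> phi j = v by move=> jl; apply: fib; rewrite inE jl orbT.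
pose Q := [set y | together l i y].
have starQ z : star i z -> z \in Q.
  move=> iz; rewrite inE; apply/allP => j jl.
  have nij : i != j by apply: contraNneq il => ->.
  have fij : phi i = phi j by rewrite fi fl.
  case/orP: (iz) => [/eqP->|E]; first exact: connect0.
  apply: conn_adj => //.
    by apply: contra nij => ji; apply/eqP/(fiber_star (z := i)); rewrite ?/star ?eqxx.
  by apply: contra nij => jz; apply/eqP/(fiber_star (z := z)).
have split_ x y : x \notin Q -> together l x y -> conn i x y.
  rewrite inE => /allPn[j jl nj] /allP/(_ j jl) jxy; apply: conn_avoid jxy _ => z jxz.
  apply: contra nj => /starQ; rewrite inE => /allP/(_ j jl) jiz.
  by apply: connect_trans jiz _; rewrite -[connect _ _ _]/(conn j z x) conn_sym.
have Qcl x y : x \notin Q -> together l x y -> y \notin Q.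
  rewrite !inE => nx xy; apply: contra nx => iy; apply: together_trans iy _.
  by rewrite together_sym.
have Q0 : l = [::] -> forall x, x \in Q by move=> l0 x; rewrite inE l0.
pose M := [set y | [exists x, [&& x \in S, x \in Q, ~~ star i x & conn i x y]]].
have MP y : reflect (exists x, [/\ x \in S, x \in Q, ~~ star i x & conn i x y]) (y \in M).
  rewrite inE; apply: (iffP existsP) => -[x]; first by move=> /and4P[? ? ? ?]; exists x.
  by move=> [? ? ? ?]; exists x; apply/and4P.
have okM : piece_ok (false, i, M).
  split=> //= [y /MP[x [_ _ nx c]]|y z /MP[x [xS xQ nx c]] nz E]; first exact: conn_star c nx.
  apply/MP; exists x; split=> //; apply: (connect_trans c).
  by apply: conn_adj => //; apply: conn_star c nx.
have s1 : spanned (fun u => (u \in S :\: Q)%:R%R).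
  apply: IH => // [x y|/Q0 h].
    rewrite !inE => /andP[nx xS] xy; have nx' : x \notin Q by rewrite inE.
    have := Qcl x y nx' xy; rewrite inE => ->.
    by apply: clS xS _; rewrite xy (split_ x y).
  by apply/setP => x; rewrite in_setD h !inE.
have s2 : spanned (fun u => (u \in M :\: Q)%:R%R).
  apply: IH => // [y z|/Q0 h].
    rewrite !(in_setD, andbT) => /andP[ny /MP[x [xS xQ nx c]]] yz.
    rewrite (Qcl y z ny yz); apply/MP; exists x; split=> //.
    exact: connect_trans c (split_ y z ny yz).
  by apply/setP => x; rewrite in_setD h !inE.
(* Inclusion and exclusion: outside [Q] the two terms in [M] cancel and leave [S]; inside [Q], off
   the star of [i], [M] agrees with [S]. *)
apply: spanned_eq (spannedD (spannedD s1 (spanned_piece okM)) (spannedN s2)) => u nu.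
have niu : ~~ star i u by apply: contra nu => /star_phi; rewrite fi.
rewrite !in_setD; have [uQ|nQ] /= := boolP (u \in Q); last by ring.
suff -> : (u \in M) = (u \in S) by ring.
apply/MP/idP => [[x [xS xQ nx c]]|uS]; last by exists u; split=> //; apply: connect0.
apply: clS xS _; rewrite /= c; apply: (together_trans (y := i)).
  by rewrite together_sym; rewrite inE in xQ.
by rewrite inE in uQ.
Qed.

(** The third condition makes the preimage of [C] closed under [together] for the whole fibre of
    [v], so [spanned_closed] supplies the pieces of a lift. *)
Lemma pcj_lift (C : pred G) s : (forall a, C a -> ~~ star v a) ->
  (forall a b, C a -> ~~ star v b -> adj a b -> C b) ->
  (forall x y, C (phi x) -> (forall i, phi i = v -> conn i x y) -> C (phi y)) ->
  exists F F', [/\ inv_pair F F', lifts (pcj v C s) F &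
                   forall u (b : L), chi b (F u) = (b == u)%:R%R].
Proof.
move=> C1 C2 C3; pose S := [set x | C (phi x)]; pose l := enum [pred i | phi i == v].
have [i ei] := cov_surj phi v.
have sp : spanned (fun u => (u \in S)%:R%R).
  apply: (@spanned_closed l) => [|j|x y|]; first exact: enum_uniq.
  - by rewrite mem_enum => /eqP.
  - rewrite !inE => Cx /allP h; apply: C3 Cx _ => j ej.
    by apply: h; rewrite mem_enum inE ej.
  - by move=> l0; have il : i \in l; [rewrite mem_enum inE ei|rewrite l0 in il].
have {}sp : spanned (fun u => ((u \in S)%:R * (-1) ^+ s)%R).
  case: s; last by apply: spanned_eq sp => u _; rewrite expr0 mulr1.
  by apply: spanned_eq (spannedN sp) => u _; rewrite expr1 mulrN1.
have [p [okp ep]] := sp; have [[F' pF] cF kF] := pieces_autP okp.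
exists (pieces_aut p), F'; split=> // u; have [k [ik ck ->]] := kF u.
have [su|nu] := boolP (star v (phi u)).
  have -> : pcj v C s (phi u) = gn (phi u).
    by rewrite /pcj; case: ifP => // /C1; rewrite su.
  have c : commute k (gn (phi u)).
    apply: commute_gen ik => x /eqP ex; apply/commute_sym.
    rewrite [x]surjective_pairing ex; apply/commute_gnlt/star_comm.
    by rewrite star_sym.
  by rewrite c mulgK.
rewrite -ep // inE in ck; pose k0 : raag G := if C (phi u) then lt (v, s) else 1.
have ik0 : inp (pred1 v) k0 by rewrite /k0; case: ifP => _; [apply/inp_lt => /=|apply: inp1].
(* Both are powers of [v], and such a power is determined by its exponent sum. *)
have -> : k = k0.
  have : k * k0^-1 = 1.
    have i1 : inp (pred1 v) (k * k0^-1) by apply: inpM => //; apply: inpV.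
    apply: cnt_eq0 => a; have [->|na] := eqVneq a v.
      rewrite -chi_pred1 // chiM chiV ck /k0; case: ifP => _.
        by rewrite chi_lt /sg eqxx mul1r addrN.
      by rewrite chi1 mul0r addrN.
    by apply/eqP; rewrite -leqn0 leqNgt; apply: contra na => /i1.
  by move/(congr1 (fun g => g * k0)); rewrite mulgVK mul1g.
by rewrite /k0 /pcj; case: ifP => _ //; rewrite mul1g invg1 mulg1.
Qed.

End ConjugationLift.
End Covering.

(** * Lexicographic descent *)

Section Lex.
Variable T : finType.
Implicit Types (o : seq T) (r : T -> nat) (d : T -> int) (a b : T).

(** Allowing an inequality before [a] does not enlarge the lexicographic order, as an earlier drop
    would itself be decisive. *)
Definition lexlt o r' r := exists a, [/\ a \in o, r' a < r a &
  forall b, index b o < index a o -> r' b <= r b].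

Lemma lexlt_wf o : well_founded (lexlt o).
Proof.
elim: o => [|x o IH]; first by move=> r; apply: Acc_intro => r' [a []]; rewrite in_nil.
(* Nested induction: on a bound for the entry at [x], then on accessibility along the rest of the
   list. *)
suff S n r : r x <= n -> Acc (lexlt (x :: o)) r by move=> r; apply: (S (r x)).
elim: n r => [|n IHn] r; elim: {r}(IH r) => r _ IHr rn; apply: Acc_intro => r' [a [ao ra rb]].
  have nax : a != x by apply: contraTneq ra => ->; lia.
  have r'x : r' x <= r x by apply: rb; rewrite /= eqxx eq_sym (negPf nax).
  apply: IHr; last exact: leq_trans rn.
  exists a; split=> // [|b]; first by move: ao; rewrite inE (negPf nax).
  move=> ib; have [->//|nbx] := eqVneq b x.
  by apply: rb; rewrite /= eq_sym (negPf nbx) eq_sym (negPf nax) ltnS.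
have [ax|nax] := eqVneq a x; first by apply: IHn; rewrite -ax in rn *; lia.
have r'x : r' x <= r x by apply: rb; rewrite /= eqxx eq_sym (negPf nax).
apply: IHr; last exact: leq_trans rn.
exists a; split=> // [|b]; first by move: ao; rewrite inE (negPf nax).
move=> ib; have [->//|nbx] := eqVneq b x.
by apply: rb; rewrite /= eq_sym (negPf nbx) eq_sym (negPf nax) ltnS.
Qed.

Definition lexpos o d := exists2 a, (0 < d a)%R & forall b, index b o < index a o -> d b = 0%R.

Lemma eq_lexpos o d d' : d =1 d' -> lexpos o d -> lexpos o d'.
Proof. by move=> e [a h1 h2]; exists a => [|b /h2]; rewrite -e. Qed.

Lemma lexpos_ge0 o d d' : lexpos o d -> (forall a, (0 <= d' a)%R) ->
  lexpos o (fun a => (d a + d' a)%R).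
Proof.
move=> [a h1 h2] h.
have h3 : (0 < d a + d' a)%R by apply: ltr_wpDr.
pose P b := (0 < d b + d' b)%R; have [b Pb bmin] := @arg_minnP _ a P (index^~ o) h3.
exists b => // c cb; have := bmin c; rewrite /P h2; last exact: leq_trans cb (bmin a h3).
rewrite !add0r => hb; have := h c; rewrite le_eqVlt => /orP[/eqP<- //|/hb].
by rewrite leqNgt cb.
Qed.

Lemma lexpos_total o d : (exists a, d a != 0%R) -> (forall a, a \in o) ->
  lexpos o d \/ lexpos o (fun a => (- d a)%R).
Proof.
move=> [a nz] _; have [b nb bmin] := @arg_minnP _ a (fun c => d c != 0%R) (index^~ o) nz.
have z c : index c o < index b o -> d c = 0%R.
  by move=> cb; apply/eqP; apply: contraLR cb => nc; rewrite -leqNgt bmin.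
have [lt0|gt0|e] := ltrgt0P (d b); last by rewrite e eqxx in nb.
  by left; exists b.
right; exists b; first by rewrite oppr_gt0.
by move=> c /z->; rewrite oppr0.
Qed.

Lemma lexpos_lexlt o r' r : (forall a, a \in o) ->
  lexpos o (fun a => ((r a)%:Z - (r' a)%:Z)%R) -> lexlt o r' r.
Proof. by move=> ao [a h1 h2]; exists a; split=> // [|b /h2]; lia. Qed.

End Lex.

Section DegreeOrder.
Context {G : graph}.

Definition degs : seq G := sort (fun a b => deg a <= deg b) (enum G).

Lemma mem_degs a : a \in degs. Proof. by rewrite mem_sort mem_enum. Qed.

Lemma degs_mono (a b : G) : index a degs <= index b degs -> deg a <= deg b.
Proof.
move=> h; have so : sorted (fun a b : G => deg a <= deg b) degs.
  by apply: sort_sorted => c d; apply: leq_total.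
have tr : transitive (fun a b : G => deg a <= deg b) by move=> c d e; apply: leq_trans.
have := sorted_leq_nth tr (fun c => leqnn (deg c)) a so.
move=> /(_ (index a degs) (index b degs)); rewrite !inE !index_mem !mem_degs.
by rewrite !nth_index ?mem_degs //; apply.
Qed.

End DegreeOrder.

(** * Conjugators that carry images into dominating subgroups *)

Section System.
Context {G : graph}.
Implicit Types (u v w a b c e : G) (g h k x y m : raag G) (s t : G * bool).

Lemma inp_conj (P Q : pred G) h k : (forall a b, P a -> Q b -> adj a b) ->
  inp (predU P Q) h -> inp P k -> inp P (h^-1 * k * h).
Proof.
move=> PQ ih; elim/(@inp_ind G): h / ih k => [|t h pt _ _ IH] k.
  by rewrite invg1 mul1g mulg1.
move=> ik; have -> : (lt t * h)^-1 * k * (lt t * h) = h^-1 * ((lt t)^-1 * k * lt t) * h.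
  by rewrite invgM !mulgA.
apply: IH; case/orP: pt => [pt|qt]; first last.
  suff c : commute (lt t) k by rewrite -mulgA -c mulKg.
  by apply: adj_comm; apply: inp_sub ik => a pa; rewrite adj_sym; apply: PQ.
have it : inp P (lt t) by apply/inp_lt.
by apply: inpM => //; apply: inpM => //; apply: inpV.
Qed.

Variables (dom : rel G) (f : G -> raag G).
Hypothesis dom_lk : forall v b, dom v b -> lkdom v b.
Hypothesis dom_sym : forall v b, dom v b -> deg b <= deg v -> dom b v.
Hypothesis fS : forall v, exists x,
  (forall w, adj v w -> inp (adj v) (x^-1 * f w * x)) /\ inp (dom v) (x^-1 * f v * x).
Hypothesis fE : forall v, exists e, [/\ dom v e, dom e v & odd (cnt e (f v))].

(** The section serves twice, for [f] on [G] with [pldom] and for [F] on [L] with [lkdom]. The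
    elements based at [v] form a single coset of the group of [region v], by [based_mulr] and
    [based_uniq]. *)
Definition based v g := inp (dom v) (g^-1 * f v * g).
Definition region v : pred G := predU (dom v) (adj v).

Lemma dom_adjF v a b : dom v a -> adj v b -> adj a b.
Proof. by move/dom_lk/lkdomP; apply. Qed.

Lemma dom_eq_adj v e : dom v e -> dom e v -> adj e =1 adj v.
Proof.
move=> /dom_lk h1 /dom_lk h2 c; apply/idP/idP; [exact: (lkdomP _ _ h2)|exact: (lkdomP _ _ h1)].
Qed.

Lemma based_ex v : exists2 g, based v g & rmin (region v) g.
Proof.
have [x [_ hx]] := fS v; have [g [h [e ih mg]]] := rmin_dec (region v) x.
exists g => //; rewrite /based.
have -> : g^-1 * f v * g = h^-1^-1 * (x^-1 * f v * x) * h^-1.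
  by rewrite e invgM invgK !mulgA mulgV mul1g -!mulgA mulgV mulg1.
apply: (@inp_conj _ (adj v)) => //; last exact: inpV.
exact: dom_adjF.
Qed.

Lemma based_mulr v g h : based v g -> inp (region v) h -> based v (g * h).
Proof.
move=> bg ih; have := @inp_conj _ (adj v) h _ (@dom_adjF v) ih bg.
by rewrite /based invgM !mulgA.
Qed.

Lemma chi_odd_supp v e g : odd (cnt e (f v)) -> 0 < cnt e (g^-1 * f v * g).
Proof.
move=> o; apply: chi_cnt_neq0; rewrite chi_conj; move: o; rewrite -chi_odd.
by case: chi => [[]|].
Qed.

Lemma region_adj1 v (P : pred G) d : inp (adj v) d -> (forall a, adj v a -> P a) ->
  lmin P d -> d = 1.
Proof.
move=> id sub ld; case: (raag_case d) => // -[t ht].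
by have := ld t (sub _ (id _ (hd_cnt ht))); rewrite ht.
Qed.

(** The minimal part [d] of [g^-1 * g'] intertwines two conjugates of [f v], so it commutes with
    their letters, among them an equivalent of [v]. Hence [d] lies in the group of the link of [v],
    where minimality makes it trivial. *)
Lemma based_uniq v g g' : based v g -> based v g' -> inp (region v) (g^-1 * g').
Proof.
move=> bg bg'; set m := _ * _.
have [a [d [b [e ia ib ld rmd]]]] := double_coset_dec (region v) (region v) m.
have [c [d1 d2 oc]] := fE v.
have sub k : inp (dom v) k -> inp (region v) k by apply: inp_sub => p; rewrite /region /= => ->.
have E : a^-1 * (g^-1 * f v * g) * a * d = d * (b * (g'^-1 * f v * g') * b^-1).
  apply: (@mulgI _ a); apply: (@mulIg _ b).
  have : g^-1 * f v * g * m = m * (g'^-1 * f v * g').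
    by rewrite /m -!mulgA !mulVKg.
  by rewrite e -!mulgA mulVKg !mulgA => ->; rewrite mulgVK.
have [||_ H] := double_coset_comm ld rmd _ _ E.
- by apply: inpM => //; apply: inpM; [apply: inpV|apply: sub].
- by apply: inpM; [apply: inpM => //; apply: sub|apply: inpV].
have id : inp (adj v) d.
  apply: (@inp_sub _ (adj c)) => [p|]; first by rewrite (dom_eq_adj d1 d2).
  have eH : a^-1 * (g^-1 * f v * g) * a = (g * a)^-1 * f v * (g * a).
    by rewrite invgM !mulgA.
  by apply: H; rewrite eH; apply: chi_odd_supp.
rewrite e (region_adj1 id _ ld) ?mulg1; first exact: inpM.
by move=> p vp; rewrite /region /= vp orbT.
Qed.

Lemma based_lk v g w : based v g -> adj v w -> inp (adj v) (g^-1 * f w * g).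
Proof.
move=> bg E; have [x [hx bx]] := fS v; have im := based_uniq bx bg.
have -> : g^-1 * f w * g = (x^-1 * g)^-1 * (x^-1 * f w * x) * (x^-1 * g).
  by rewrite invgM invgK -!mulgA !mulVKg.
apply: (@inp_conj _ (dom v)) (hx _ E) => [a b va vb|].
  by rewrite adj_sym; apply: dom_adjF vb va.
by apply: inp_sub im => c; rewrite /region /= orbC.
Qed.

Lemma based_adj v w : adj v w -> exists2 g, based v g & based w g.
Proof.
move=> E; have [g bg _] := based_ex v; have [g' bg' _] := based_ex w.
have [a [d [b [e ia ib ld rmd]]]] := double_coset_dec (region v) (region w) (g^-1 * g').
have b1 := based_mulr bg ia; have b2 := based_mulr bg' (inpV ib).
have ed : g * a * d = g' * b^-1.
  by rewrite -[g'](mulVKg g) e !mulgA mulgK.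
have [c [d1 d2 oc]] := fE v.
have E2 : (g * a)^-1 * f v * (g * a) * d = d * ((g' * b^-1)^-1 * f v * (g' * b^-1)).
  by rewrite -ed; move: (g * a) => p; rewrite invgM !mulgA mulgV mul1g.
have [||_ /(_ c) H] := double_coset_comm ld rmd _ _ E2.
- by apply: inp_sub b1 => p; rewrite /region /= => ->.
- have Ewv : adj w v by rewrite adj_sym.
  by apply: inp_sub (based_lk b2 Ewv) => p; rewrite /region /= orbC => ->.
have id : inp (adj v) d.
  apply: (@inp_sub _ (adj c)) => [p|]; first by rewrite (dom_eq_adj d1 d2).
  exact/H/chi_odd_supp.
have d0 : d = 1.
  by apply: (region_adj1 id _ ld) => p vp; rewrite /region /= vp orbT.
by exists (g * a) => //; rewrite -[g * a]mulg1 -d0 ed.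
Qed.

Lemma based_rd v g (k := g^-1 * f v * g) : based v g -> rmin (region v) g ->
  rd k g^-1 /\ rd g (k * g^-1).
Proof.
move=> bg mg; have r1 : rd k g^-1.
  by apply: lmin_rd mg _; apply: inp_sub bg => p; rewrite /region /= => ->.
split=> //; case: (rd_dec g (k * g^-1)) => // /rdN[t h1 h2].
have : ~~ region v t.1 by apply/negP => /mg; rewrite h1.
rewrite /region /= negb_or => /andP[nd na].
have [c [d1 d2 oc]] := fE v.
case: (hdM r1 h2) => [/hd_cnt/bg|[ik _]]; first by rewrite (negPf nd).
have /ik : 0 < cnt c k by apply: chi_odd_supp.
by rewrite adj_sym (dom_eq_adj d1 d2) (negPf na).
Qed.

Lemma based_cnt v g a : based v g -> rmin (region v) g ->
  cnt a (f v) = (cnt a g + cnt a (g^-1 * f v * g) + cnt a g)%N.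
Proof.
move=> bg mg; have [r1 r2] := based_rd bg mg.
have {1}-> : f v = g * (g^-1 * f v * g * g^-1) by rewrite -!mulgA mulgV mulg1 mulVKg.
by rewrite r2 r1 cntV; lia.
Qed.

(* The hyperplane in the middle of [1] and [f v] for the lexicographic count of
   crossings, vertices of small degree first.  The class of [v] comes first in
   the region of [v] and occurs an odd number of times, so that there are no
   ties and the middle hyperplane is labelled by an equivalent of [v]. *)
Lemma middle v : exists x s y,
  [/\ f v = x * lt s * y^-1 /\ (forall a, cnt a (f v) = (cnt a x + (a == s.1) + cnt a y)%N),
      gated x s /\ gated y (linv s),
      lexpos degs (fun a => (cnt a x)%:Z + (a == s.1)%:Z - (cnt a y)%:Z)%R /\
      lexpos degs (fun a => (cnt a y)%:Z + (a == s.1)%:Z - (cnt a x)%:Z)%R,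
      dom v s.1 /\ dom s.1 v & based v x /\ based v y].
Proof.
have [g bg mg] := based_ex v; set k := g^-1 * f v * g.
have [r1 r2] := based_rd bg mg; have [e [d1 d2 oe]] := fE v.
have oek : odd (cnt e k).
  by have := oe; rewrite (based_cnt _ bg mg) -/k !oddD; case: (odd (cnt e g)); case: (odd _).
pose R p q := [exists a : G, (0 < (cnt a q)%:Z - (cnt a p)%:Z :> int)%R &&
  [forall b, (index b degs < index a degs) ==> ((cnt b q)%:Z - (cnt b p)%:Z == 0 :> int)%R]].
have RP p q : reflect (lexpos degs (fun a => (cnt a q)%:Z - (cnt a p)%:Z)%R) (R p q).
  apply: (iffP existsP) => [[a /andP[h1 /forallP h2]]|[a h1 h2]].
    by exists a => // b ib; apply/eqP; apply: (implyP (h2 b)).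
  by exists a; rewrite h1; apply/forallP => b; apply/implyP => /h2->.
have [||u [s [z [ek ru rz h1 h2]]]] := @cut_red G R k.
- apply/RP; have nz : exists a, ((cnt a k)%:Z - (cnt a 1)%:Z != 0)%R.
    by exists e; rewrite cnt1; case: (cnt e k) oek.
  case: (lexpos_total nz mem_degs) => // -[a]; rewrite cnt1; lia.
- by apply/RP => -[a]; rewrite cnt1; lia.
have [rus _] := rd_assocr rz ru.
have cu a : cnt a k = (cnt a u + (a == s.1) + cnt a z)%N.
  by rewrite ek ru rz cnt_lt addnA.
have [iu isz] : inp (dom v) u /\ inp (dom v) (lt s * z).
  by apply: inpM_rd ru _; rewrite -ek.
have [/(inp_lt (dom v)) ds iz] := inpM_rd rz isz.
have l1 : lexpos degs (fun a => (cnt a z)%:Z + (a == s.1)%:Z - (cnt a u)%:Z)%R.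
  by move/RP: h1; apply: eq_lexpos => a; rewrite rz cnt_lt; lia.
(* The order cannot flip at a letter of larger degree: the odd count of [e] produces a difference no
   later than [e], before any entry that [s] changes. *)
have sdeg : deg s.1 <= deg v.
  rewrite leqNgt; apply/negP => sv.
  have es : e != s.1 by apply: contraTneq sv => <-; rewrite -leqNgt; apply/lkdom_deg/dom_lk.
  have de : ((cnt e z)%:Z - (cnt e u)%:Z != 0)%R.
    by have := oek; rewrite cu (negPf es); lia.
  have ev : deg e <= deg v by apply/lkdom_deg/dom_lk.
  have small c : index c degs <= index e degs -> c == s.1 = false.
    move/degs_mono => ce; apply/eqP => cs; move: sv; rewrite -cs; lia.
  have [a a1 a2] := l1.
  have ae : index a degs <= index e degs.
    by rewrite leqNgt; apply/negP => /a2; rewrite (negPf es); lia.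
  case/RP: h2; exists a.
    by move: a1; rewrite rus cnt_lt small //; lia.
  move=> b ba; have := a2 b ba; rewrite rus cnt_lt small; first lia.
  exact: leq_trans (ltnW ba) ae.
have sv : dom s.1 v by apply: dom_sym.
have es := dom_eq_adj ds sv.
have l2 : lexpos degs (fun a => (cnt a u)%:Z + (a == s.1)%:Z - (cnt a z)%:Z)%R.
  have nz : exists a, ((cnt a u)%:Z + (a == s.1)%:Z - (cnt a z)%:Z != 0)%R.
    exists e; have := oek; rewrite cu; lia.
  case: (lexpos_total nz mem_degs) => // n; case/RP: h2.
  by apply: eq_lexpos n => a; rewrite rus cnt_lt; lia.
have subr p : inp (dom v) p -> inp (region v) p by apply: inp_sub => c; rewrite /region /= => ->.
have G0 p q : inp (dom v) p -> rd p^-1 g^-1 -> ~~ hd q p^-1 -> q.1 = s.1 -> gated (g * p) q.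
  move=> ip rp nq eq t; rewrite invgM => ht; rewrite eq adj_sym es.
  case: (hdM rp ht) => [h|[_ h]].
    have := ip t.1; rewrite -cntV => /(_ (hd_cnt h)) dt; split.
      by apply/negP => vt; have := dom_adjF dt vt; rewrite adj_irr.
    by apply: contraNneq nq => <-.
  have : ~~ region v t.1 by apply/negP => /mg; rewrite h.
  rewrite /region /= negb_or => /andP[nd na]; split=> //.
  by apply: contraNneq nd => ->; rewrite eq.
have rpg p : inp (dom v) p -> rd p^-1 g^-1.
  by move=> ip; apply: lmin_rd mg _; apply/inpV/subr.
have iz' : inp (dom v) z^-1 by apply: inpV.
exists (g * u), s, (g * z^-1).
have cgx p a : inp (dom v) p -> cnt a (g * p) = (cnt a g + cnt a p)%N.
  by move=> ip; apply: rmin_rd mg (subr _ ip) a.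
split.
- split=> [|a]; last by rewrite (based_cnt _ bg mg) -/k cu !cgx // cntV; lia.
  rewrite invgM invgK -[f v]mul1g -(mulgV g) -!mulgA; congr (g * _).
  by rewrite [lt s * _]mulgA [u * _]mulgA -ek /k -!mulgA mulgV mulg1.
- split; apply: G0 => //; try exact: rpg.
    by have := rdV rus; rewrite -lt_inv => /rd_lt; rewrite linvK.
  by rewrite invgK; apply/rd_lt.
- by split; [apply: eq_lexpos l2|apply: eq_lexpos l1] => a; rewrite !cgx // cntV; lia.
- by [].
- by split; apply: based_mulr => //; apply: subr.
Qed.

End System.

Definition invs (H : graph) (s : H -> bool) (a : H) : raag H := lt (a, s a).

Lemma hom_invs (H : graph) (s : H -> bool) : hom (invs s).
Proof. by move=> a b E; apply: lt_comm. Qed.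

Lemma invs_inv (H : graph) (s : H -> bool) : inv_pair (invs s) (invs s).
Proof.
have h := hom_invs s; split=> // a; rewrite ev_lt // /evl /invs /=;
  by case: (s a) => //=; rewrite -lt_inv.
Qed.

(** * Elementary moves with their lifts *)

Section Moves.
Context {L G : graph} (phi : covering L G).
Implicit Types (u w x y z i j : L) (a b c e v : G).

(** The counterpart on [G] of [lkdom] on [L]: for a pair with [stdom] in [L], adjacency is the same
    in [L] and in [G] ([stdom_adj_phi]). *)
Definition pldom : rel G := fun v b => pdom phi v b && ~~ adj v b.

Lemma lkdom_nadj (H : graph) (a b : H) : lkdom a b -> ~~ adj a b.
Proof. by move=> /lkdomP h; apply/negP => /h; rewrite adj_irr. Qed.

Lemma lkdom_refl (H : graph) : reflexive (@lkdom H).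
Proof. by move=> a; apply/lkdomP. Qed.

Lemma lkdom_trans (H : graph) : transitive (@lkdom H).
Proof. by move=> b a c /lkdomP h1 /lkdomP h2; apply/lkdomP => w /h1/h2. Qed.

Lemma pldomI u w : lkdom u w -> pldom (phi u) (phi w).
Proof.
move=> h; have d := lkdom_stdom h.
by rewrite /pldom pdomI //= (stdom_adj_phi phi d) lkdom_nadj.
Qed.

Lemma pldom_lift u b : pldom (phi u) b -> exists2 w, lkdom u w & phi w = b.
Proof.
case/andP=> /pdom_lift[w d <-]; rewrite (stdom_adj_phi phi d) => nE.
by exists w => //; apply: stdom_lkdom.
Qed.

Lemma pldom_trans : transitive pldom.
Proof.
move=> b v a; have [u <-] := cov_surj phi v.
move=> /pldom_lift[w d1 <-] /pldom_lift[z d2 <-].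
exact/pldomI/(lkdom_trans d1).
Qed.

Lemma pldom_lkdom v b : pldom v b -> lkdom v b.
Proof. by case/andP=> /pdom_stdom h nE; apply: stdom_lkdom. Qed.

Lemma pldom_sym_deg v b : pldom v b -> deg b <= deg v -> pldom b v.
Proof. by case/andP=> h nE d; rewrite /pldom adj_sym nE andbT; apply: pdom_deg_sym. Qed.

Inductive Lgen : (G -> raag G) -> Prop :=
| Lgen_tv v b s : v != b -> pdom phi v b -> Lgen (tv v b s)
| Lgen_inv s : Lgen (invs s)
| Lgen_pcj v (C : pred G) s : (forall a, C a -> ~~ star v a) ->
    (forall a b, C a -> ~~ star v b -> adj a b -> C b) ->
    (forall x y, C (phi x) -> (forall i, phi i = v -> conn i x y) -> C (phi y)) ->
    Lgen (pcj v C s)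
| Lgen_sym (sigma : G -> G) (tau : L -> L) : bijective sigma -> bijective tau ->
    (forall a b, adj (sigma a) (sigma b) = adj a b) ->
    (forall x y, adj (tau x) (tau y) = adj x y) ->
    (forall x, phi (tau x) = sigma (phi x)) -> Lgen (fun v => gn (sigma v))
| Lgen_comp f g : Lgen f -> Lgen g -> Lgen (fun v => ev f (g v))
| Lgen_eq f g : f =1 g -> Lgen f -> Lgen g.

Definition LgenK T := exists T', [/\ inv_pair T T', Lgen T & Lgen T'].

(** [R] restricts the exponent sums of the lift and not its letters: for transitive [R] this
    survives composition, and it is what [dominated_structure] takes as input. *)
Definition glift (R : rel L) (f : G -> raag G) := exists f' F F',
  [/\ inv_pair f f', inv_pair F F', lifts phi f F &
      forall u w, chi w (F u) != 0%R -> R u w].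

Lemma glift_comp (R : rel L) f g : transitive R -> glift R f -> glift R g ->
  glift R (fun v => ev f (g v)).
Proof.
move=> tr [f' [F [F' [pf pF lf Ff]]]] [g' [H [H' [pg pH lg Hg]]]].
exists (fun v => ev g' (f' v)), (fun u => ev F (H u)), (fun u => ev H' (F' u)).
split; try exact: inv_pair_comp.
  by apply: lifts_comp => //; [case: pf|case: pF|case: pg].
move=> u w; rewrite chi_ev; last by case: pF.
move=> nz; apply: NNPP => nR; case/eqP: nz; apply: big1 => c _.
apply/eqP; rewrite mulf_eq0; apply: contra_notT nR; rewrite negb_or => /andP[h1 h2].
by apply: tr (Hg _ _ h1) (Ff _ _ h2).
Qed.

Lemma glift_eq R f g : f =1 g -> glift R f -> glift R g.
Proof.
move=> e [f' [F [F' [[h1 h2 h3 h4] pF lf Ff]]]]; exists f', F, F'; split=> //; last first.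
  by move=> u; rewrite -e.
split=> // [u v E|v|v]; first by rewrite -!e; apply: h1.
- by rewrite -e.
- by rewrite -(eq_ev _ e).
Qed.

Lemma glift_inv (R : rel L) s : reflexive R -> glift R (invs s).
Proof.
move=> rf; exists (invs s), (invs (fun u => s (phi u))), (invs (fun u => s (phi u))).
split; try exact: invs_inv.
  by move=> u; rewrite push_lt.
move=> u w; rewrite chi_lt /sg /=; have [<-|] := eqVneq u w; first by rewrite rf.
by rewrite eqxx.
Qed.

Lemma glift_tv v b s : v != b -> pdom phi v b -> glift stdom (tv v b s).
Proof.
move=> vb d; exists (tv v b (~~ s)), (tvL phi v b s), (tvL phi v b (~~ s)).
by split; [apply: (tv_inv vb d)|apply: tvL_inv|apply: tv_lifts|apply: tvL_stdom].
Qed.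

Lemma glift_tv_lk v b s : v != b -> pldom v b -> glift lkdom (tv v b s).
Proof.
move=> vb /andP[d nE]; exists (tv v b (~~ s)), (tvL phi v b s), (tvL phi v b (~~ s)).
split; [exact: (tv_inv vb d)|exact: tvL_inv|exact: tv_lifts|].
move=> u w nz; have st : stdom u w by apply: tvL_stdom nz.
apply: stdom_lkdom st; move: nz; rewrite chi_mtv.
have [->|_] := eqVneq w u; first by rewrite adj_irr.
have [e|_] /= := eqVneq (phi u) v; last by rewrite mul0r addr0 eqxx.
have [-> _|_] := eqVneq w (tvc phi b u); last by rewrite mul0r addr0 eqxx.
by have [e1 e2] := tvcP d e; rewrite -(stdom_adj_phi phi e2) e1 e.
Qed.

Lemma glift_pcj (R : rel L) v (C : pred G) s : reflexive R -> (forall a, C a -> ~~ star v a) ->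
  (forall a b, C a -> ~~ star v b -> adj a b -> C b) ->
  (forall x y, C (phi x) -> (forall i, phi i = v -> conn i x y) -> C (phi y)) ->
  glift R (pcj v C s).
Proof.
move=> rf c1 c2 c3; have [F [F' [pF lF cF]]] := pcj_lift s c1 c2 c3.
exists (pcj v C (~~ s)), F, F'; split=> //; first exact: pcj_inv.
by move=> u w; rewrite cF; have [->|] := eqVneq w u; rewrite ?rf // eqxx.
Qed.

(** Multiplication on the left is a right transvection conjugated by the inversion of [v], so it
    adds no generator. *)
Definition tvl v b (s : bool) a : raag G := if a == v then lt (b, s) * gn v else gn a.

Lemma inv_pair_eq (H : graph) (f f' h h' : H -> raag H) : f =1 h -> f' =1 h' ->
  inv_pair f f' -> inv_pair h h'.
Proof.
move=> e e' [h1 h2 h3 h4]; split.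
- by move=> a b /h1; rewrite !e.
- by move=> a b /h2; rewrite !e'.
- by move=> a; rewrite -e -(eq_ev _ e').
- by move=> a; rewrite -e' -(eq_ev _ e).
Qed.

Section LeftTransvection.
Variables (v b : G).
Hypotheses (vb : v != b) (dvb : pdom phi v b).

Lemma tvlE s :
  (fun a => ev (invs (pred1 v)) (ev (tv v b (~~ s)) (invs (pred1 v) a))) =1 tvl v b s.
Proof.
move=> a; have hi := hom_invs (pred1 v).
have ht : hom (tv v b (~~ s)) by case: (tv_inv vb dvb (~~ s)).
rewrite /invs /tvl /=; have [->|na] := eqVneq a v; last first.
  by rewrite -[lt (a, _)]/(gn a) ev_gn // /tv /mtv /= (negPf na) ev_gn //= (negPf na).
rewrite ev_lt // /evl /= /tv /mtv /= eqxx evV // evM // ev_gn // ev_lt // /evl /=.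
rewrite eqxx eq_sym (negPf vb) invgM -lt_inv; congr (_ * _);
  last by rewrite -lt_inv.
by case: (s) => //=; rewrite -lt_inv.
Qed.

Lemma Lgen_tvl s : Lgen (tvl v b s).
Proof.
apply: Lgen_eq (tvlE s) _; apply: Lgen_comp; first exact: Lgen_inv.
by apply: Lgen_comp; [apply: Lgen_tv|apply: Lgen_inv].
Qed.

Lemma tvl_inv s : inv_pair (tvl v b s) (tvl v b (~~ s)).
Proof.
have p1 := invs_inv (pred1 v); have p2 := tv_inv vb dvb (~~ s).
apply: inv_pair_eq (inv_pair_comp p1 (inv_pair_comp p2 p1)); first exact: tvlE.
by move=> a; rewrite -tvlE [RHS]ev_comp //; [case: p2|case: p1].
Qed.

Lemma glift_tvl s : pldom v b -> glift lkdom (tvl v b s).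
Proof.
move=> d; apply: glift_eq (tvlE s) _; have tr := @lkdom_trans L.
have rf := @lkdom_refl L.
apply: glift_comp => //; first exact: glift_inv.
by apply: glift_comp => //; [apply: glift_tv_lk|apply: glift_inv].
Qed.

End LeftTransvection.
End Moves.

(** * The descent step *)

Section Step.
Context {L G : graph} (phi : covering L G).
Implicit Types (u w x y z i j : L) (a b c e v : G) (g h k p q : raag G) (s t : G * bool).
Variables (f f' : G -> raag G) (F F' : L -> raag L).
Hypotheses (pf : inv_pair f f') (pF : inv_pair F F') (lf : lifts phi f F).
Hypothesis Flk : forall u w, chi w (F u) != 0%R -> lkdom u w.
Let dom := pldom phi.

Let hf : hom f. Proof. by case: pf. Qed.

Let sigma_ex : exists2 sigma : L -> L, bijective sigma /\ (forall u, odd `|chi (sigma u) (F u)|%N) &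
  forall u, adj (sigma u) =1 adj u.
Proof.
have MN u w : (\sum_c chi u (F c) * chi c (F' w) = (u == w)%:R)%R by apply: chi_inv_pair.
have [sigma bs os] := @odd_permutation L (fun u w => chi u (F w)) (fun u w => chi u (F' w)) MN.
exists sigma => // u w.
have lk x : lkdom x (sigma x) by apply: Flk; have := os x; case: chi => [[]|].
rewrite (lkdom_deg_eq (lk u)) // (bij_leq_eq bs (d := deg)) // => x.
exact/lkdom_deg/lk.
Qed.

Let FS u : exists X : raag L, (forall w, adj u w -> inp (adj u) (X^-1 * F w * X)) /\
  inp (lkdom u) (X^-1 * F u * X).
Proof.
have [sigma [bs os] as_] := sigma_ex.
apply: (dominated_structure pF Flk bs as_) => w.
by rewrite -chi_odd.
Qed.

Let FE u : exists w, [/\ lkdom u w, lkdom w u & odd (cnt w (F u))].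
Proof.
have [sigma [bs os] as_] := sigma_ex.
exists (sigma u); rewrite -chi_odd os; split=> //; apply/lkdomP => z; by rewrite as_.
Qed.

Let Fst u w : chi w (F u) != 0%R -> stdom u w.
Proof. by move/Flk/lkdom_stdom. Qed.

Let fS v : exists X : raag G, (forall b, adj v b -> inp (adj v) (X^-1 * f b * X)) /\
  inp (dom v) (X^-1 * f v * X).
Proof.
have [u <-] := cov_surj phi v; have [X [h1 h2]] := FS u.
have E w : (push phi X)^-1 * f (phi w) * push phi X = push phi (X^-1 * F w * X).
  by rewrite !pushM pushV lf.
exists (push phi X); split=> [_ /cov_lift[w Ew <-]|]; rewrite E.
  by apply: push_inp (h1 w Ew) => z /(cov_adj phi).
by apply: push_inp h2 => z; apply: pldomI.
Qed.

Let fE v : exists e, [/\ dom v e, dom e v & odd (cnt e (f v))].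
Proof.
have [u <-] := cov_surj phi v; have [w [d1 d2 o]] := FE u.
exists (phi w); split; try exact: pldomI.
by rewrite -chi_odd (chi_lift lf (@Fst u) (lkdom_stdom d1)) chi_odd.
Qed.

Let domT := @pldom_trans _ _ phi.
Let domL v b : dom v b -> lkdom v b. Proof. exact: pldom_lkdom. Qed.
Let domS v b : dom v b -> deg b <= deg v -> dom b v. Proof. exact: pldom_sym_deg. Qed.

Let data : exists gx : G -> raag G, exists X : G * bool -> raag G,
    exists Lb : G * bool -> G * bool,
  [/\ forall v, based dom f v (gx v) /\ rmin (region dom v) (gx v),
      forall t, [/\ evl f t = X t * lt (Lb t) * (X (linv t))^-1,
                    Lb (linv t) = linv (Lb t), gated (X t) (Lb t),
                    based dom f t.1 (X t) & dom t.1 (Lb t).1 /\ dom (Lb t).1 t.1],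
      forall t a, cnt a (f t.1) = (cnt a (X t) + (a == (Lb t).1) + cnt a (X (linv t)))%N &
      forall t, lexpos degs (fun a => (cnt a (X t))%:Z + (a == (Lb t).1)%:Z
                                     - (cnt a (X (linv t)))%:Z)%R].
Proof.
have [gx Hg] : exists gx : G -> raag G, forall v,
    based dom f v (gx v) /\ rmin (region dom v) (gx v).
  apply: (@fin_all_exists _ _ (fun v g => based dom f v g /\ rmin (region dom v) g)) => v.
  by have [g ? ?] := based_ex domL fS v; exists g.
pose P v (m : raag G * (G * bool) * raag G) :=
  let x := m.1.1 in let s := m.1.2 in let y := m.2 in
    [/\ f v = x * lt s * y^-1 /\ (forall a, cnt a (f v) = (cnt a x + (a == s.1) + cnt a y)%N),
      gated x s /\ gated y (linv s),
      lexpos degs (fun a => (cnt a x)%:Z + (a == s.1)%:Z - (cnt a y)%:Z)%R /\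
      lexpos degs (fun a => (cnt a y)%:Z + (a == s.1)%:Z - (cnt a x)%:Z)%R,
      dom v s.1 /\ dom s.1 v & based dom f v x /\ based dom f v y].
have [xsy H] : exists xsy : G -> raag G * (G * bool) * raag G, forall v, P v (xsy v).
  apply: (@fin_all_exists _ _ P) => v; have [x [s [y H]]] := middle domL domS fS fE v.
  by exists (x, s, y).
exists gx, (fun t => if t.2 then (xsy t.1).2 else (xsy t.1).1.1),
  (fun t => if t.2 then linv (xsy t.1).1.2 else (xsy t.1).1.2).
split=> // [[v []]|[v []] a|[v []]] /=;
  have := H v; case: (xsy v) => [[x s] y] /= [[e c] [g1 g2] [l1 l2] [d1 d2] [b1 b2]] //.
- split=> //; last by rewrite linvK.
  by rewrite /evl /= e !invgM invgK lt_inv mulgA.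
- by rewrite c addnC (addnC (cnt a x)) addnA.
Qed.

Definition total (k : G -> raag G) a : nat := (\sum_v cnt a (k v))%N.

Lemma descent_step :
  (exists (la : G -> G) (b : G -> bool), forall v,
     [/\ f v = lt (la v, b v), dom v (la v) & dom (la v) v]) \/
  exists T, [/\ LgenK phi T, glift phi lkdom T &
    lexlt degs (total (fun v => ev f (T v))) (total f)].
Proof.
have [gx [X [Lb [Hg H cH lH]]]] := data.
(* [K t] is the far side of the middle letter in the image of the letter [t]. The ping-pong rules
   are [Kz], by which that image maps the complement of [K (linv t)] onto [K t], and [Kadj], by
   which images of letters adjacent to [s] preserve [K s]. *)
pose K t g := half (X t) (Lb t) g.
have Ladj t : adj (Lb t).1 =1 adj t.1.
  by have [_ _ _ _ [d1 d2]] := H t; apply: (dom_eq_adj domL).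
have K1 t : ~~ K t 1 by have [_ _ gt _ _] := H t; apply: gated_half1.
have Kz t g : K t (evl f t * g) = ~~ K (linv t) g.
  have [e el _ _ _] := H t; rewrite /K /half e -!mulgA mulKg hd_linv.
  by rewrite el.
have Kadj s t g : adj s.1 t.1 -> K s (evl f t * g) = K s g.
  move=> E; have [_ _ _ bs _] := H s; have h := based_lk domL fS fE bs E.
  rewrite /K /half -[X s in RHS]mulg1 -{1}(mulgV (X s)).
  have -> : (X s)^-1 * (evl f t * g) = ((X s)^-1 * evl f t * X s) * ((X s)^-1 * g).
    by rewrite -!mulgA mulVKg.
  rewrite mulgV mulg1 hd_inp_adj //; apply: (@inp_sub _ (adj s.1)) => [a|].
    by rewrite Ladj.
  rewrite /evl; case: t.2 => //; have := inpV h.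
  by rewrite !invgM invgK mulgA.
(* That is, [K t] is contained in [K s]; up to exchanging [s] and [t], [half_nest] leaves this as
   the only alternative to disjointness. *)
pose bad s t := [/\ s != t, ~~ adj s.1 t.1 &
  (X t = X s /\ Lb t = Lb s) \/ pre (X s * lt (Lb s)) (X t)].
have [[s [t bst]]|good_] := classic (exists s t, bad s t); last first.
  left; have disj s t g : s != t -> ~~ adj s.1 t.1 -> K s g -> K t g -> False.
    move=> nst nE ks kt; have [_ _ gs _ _] := H s; have [_ _ gt _ _] := H t.
    have nE' : ~~ adj (Lb s).1 (Lb t).1.
      by rewrite Ladj adj_sym Ladj adj_sym.
    case: good_; case: (half_nest gs gt nE' ks kt) => [[e1 e2]|p|p].
    - by exists s, t; split=> //; left.
    - by exists s, t; split=> //; right.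
    - by exists t, s; split=> //; [rewrite eq_sym|rewrite adj_sym|right].
  (* When the letter [t] after [s] is adjacent to [s], [Kadj] removes it, and the induction
     hypothesis applies to [lt s * h'], which is as long as [h]. *)
  have pp n g s : len g <= n -> hd s g -> K s (ev f g).
    elim: n g s => [|n IH] g s.
      by rewrite leqn0 /len sum_nat_eq0 => /forallP/(_ s.1)/= + /hd_cnt; case: (cnt _ _).
    move=> + hs; have [h -> nh] := hdE hs => lg.
    have lh : len h <= n.
      have hs1 : hd s (lt s * h) by rewrite hd_linv.
      by have := len_hd hs1; rewrite ltVK => lh; rewrite -ltnS; apply: leq_trans lh lg.
    rewrite evM // ev_lt // Kz; apply/negP => k.
    case: (raag_case h) => [h1|[t ht]]; first by rewrite h1 ev1 // (negPf (K1 _)) in k.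
    have [E|nE] := boolP (adj s.1 t.1); last first.
      apply: (@disj (linv s) t _ _ _ k) => //; last exact: IH lh ht.
      by apply: contraNneq nh => ->.
    have [h' eh nh'] := hdE ht.
    rewrite eh evM // ev_lt // Kadj // in k.
    have hs' : hd s (lt s * h').
      by rewrite hd_linv; apply: contra nh; rewrite eh hd_adj //= adj_sym.
    have ls' : len (lt s * h') <= n.
      apply: leq_trans lh; rewrite eh; apply: eq_leq; rewrite /len.
      have c1 a : cnt a (lt s * h') = ((a == s.1) + cnt a h')%N by rewrite cnt_ltM // -hd_linv.
      have c2 a : cnt a (lt t * h') = ((a == t.1) + cnt a h')%N by rewrite cnt_ltM.
      under eq_bigr do rewrite c1; under [RHS]eq_bigr do rewrite c2.
      have one c : (\sum_(a : G) (a == c) = 1)%N.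
        by rewrite (bigD1 c) //= eqxx big1 // => a /negPf->.
      by rewrite !big_split /= !one.
    by have := IH _ _ ls' hs'; rewrite evM // ev_lt // Kz k.
  (* [lt r] is the image of some [g], so it lies in the halfspace of a first letter of [g]; the gate
     of that halfspace is a prefix of one letter. Finiteness then makes every [X s] trivial. *)
  have surj (r : G * bool) : exists s, X s = 1 /\ Lb s = r.
    have eg : ev f (ev f' (lt r)) = lt r := inv_pairK _ (inv_pair_sym pf).
    case: (raag_case (ev f' (lt r))) => [g1|[s hs]].
      have : hd r (lt r) by rewrite hd_lt.
      by rewrite -eg g1 ev1 // hd1.
    have ks := pp _ _ _ (leqnn _) hs; rewrite eg in ks.
    have [_ _ gs _ _] := H s; have p := half_pre gs ks.
    have cX c : cnt c (X s) + (c == (Lb s).1) <= (c == r.1).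
      by have := pre_cnt c p; rewrite (gated_rd gs) !cnt_lt.
    have e1 : (Lb s).1 = r.1.
      by have := cX (Lb s).1; rewrite eqxx; case: eqP => //; lia.
    have x1 : X s = 1.
      by apply: cnt_eq0 => c; have := cX c; rewrite e1; lia.
    by exists s; split=> //; move: ks; rewrite /K /half x1 invg1 mul1g hd_lt => /eqP.
  have [si hsi] : exists si : G * bool -> G * bool, forall r, X (si r) = 1 /\ Lb (si r) = r.
    exact: (@fin_all_exists _ _ (fun r s => X s = 1 /\ Lb s = r)).
  have isi : injective si by apply: (can_inj (g := Lb)) => r; have [] := hsi r.
  have X1 s : X s = 1.
    by have [ri _ r2] := injF_bij isi; rewrite -(r2 s); have [] := hsi (ri s).
  exists (fun v => (Lb (v, false)).1), (fun v => (Lb (v, false)).2) => v.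
  have [e _ _ _ [d1 d2]] := H (v, false); split=> //.
  by move: e; rewrite !X1 invg1 mulg1 mul1g -surjective_pairing.
right; case: bst => nst nE alt; set v := s.1 in nE; set w := t.1 in nE.
have [es eLs gs bs [ds1 ds2]] := H s; have [et eLt gt bt [dt1 dt2]] := H t.
have esV : evl f (linv s) = X (linv s) * (lt (Lb s))^-1 * (X s)^-1.
  by have [-> _ _ _ _] := H (linv s); rewrite eLs linvK lt_inv.
have vw : v != w.
  apply/eqP => e; have ts : t = linv s.
    rewrite (surjective_pairing t) /linv -/v e; congr pair; apply/eqP.
    apply: contraNT nst => h; apply/eqP; rewrite (surjective_pairing s) (surjective_pairing t).
    by rewrite -/v -/w e; congr pair; case: (s.2) (t.2) h => [] [].
  case: alt => [[_]|p]; first by rewrite ts eLs => /(congr1 snd)/=; case: (Lb s).2.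
  have [a a1 _] := lH s; have := pre_cnt a p; rewrite (gated_rd gs) cnt_lt ts; lia.
(* In the product the part of the image of [t] up to the gate of [K s] is replaced by [X (linv s)];
   [lH] makes the saving lexicographically positive. *)
have newW a : cnt a (evl f (linv s) * evl f t) + (cnt a (X s) + (a == (Lb s).1)) <=
    cnt a (f w) + cnt a (X (linv s)).
  have := cH t a; rewrite -/w => cw; rewrite esV et.
  case: alt => [[eX eL]|/preE[z ez rz]].
    rewrite cw eX eL -!mulgA mulKg mulKg.
    apply: leq_trans (leq_add (cntM_le _ _ _) (leqnn _)) _; rewrite cntV; clear; lia.
  have cz : cnt a (X t) = (cnt a (X s) + (a == (Lb s).1) + cnt a z)%N.
    by rewrite ez rz (gated_rd gs) cnt_lt.
  have -> : X (linv s) * (lt (Lb s))^-1 * (X s)^-1 * (X t * lt (Lb t) * (X (linv t))^-1) =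
      X (linv s) * (z * (lt (Lb t) * (X (linv t))^-1)).
    by rewrite ez -!mulgA mulKg mulKg.
  have := cntM_le a (X (linv s)) (z * (lt (Lb t) * (X (linv t))^-1)).
  have := cntM_le a z (lt (Lb t) * (X (linv t))^-1).
  have := cntM_le a (lt (Lb t)) (X (linv t))^-1.
  by rewrite cntV cnt_lt cw cz; clear; lia.
have [D|nD] := boolP (dom w v).
  have Dp : pdom phi w v by case/andP: D.
  have wv : w != v by rewrite eq_sym.
  (* [T] multiplies the letter [t] on the left by [linv s]; for an inverse letter this is a right
     transvection of [w]. *)
  pose T := if t.2 then tv w v s.2 else tvl w v (~~ s.2).
  have eT (u : G) : u != w -> T u = gn u.
    by move=> /negPf nu; rewrite /T; case: t.2; rewrite /tv /mtv /tvl /= nu.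
  have cT a : cnt a (ev f (T w)) = cnt a (evl f (linv s) * evl f t).
    rewrite /T {2}/evl -/w; case: t.2.
      rewrite /tv /mtv /= eqxx evM // ev_gn // ev_lt // -[RHS]cntV invgM invgK evl_linv invgK.
      by rewrite /v -surjective_pairing.
    by rewrite /tvl eqxx evM // ev_gn // ev_lt.
  exists T; split.
  - exists (if t.2 then tv w v (~~ s.2) else tvl w v (~~ ~~ s.2)); rewrite /T; case: t.2.
      by split; [apply: (tv_inv wv Dp)|apply: Lgen_tv|apply: Lgen_tv].
    by split; [apply: (tvl_inv wv Dp)|apply: Lgen_tvl|apply: Lgen_tvl].
  - by rewrite /T; case: t.2; [apply: glift_tv_lk|apply: glift_tvl].
  - apply: (lexpos_lexlt (@mem_degs G)).
    pose d' a := ((cnt a (f w))%:Z - (cnt a (ev f (T w)))%:Z - ((cnt a (X s))%:Z +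
                 (a == (Lb s).1)%:Z - (cnt a (X (linv s)))%:Z))%R.
    apply: eq_lexpos (lexpos_ge0 (lH s) (d' := d') _) => a.
      have tE (q : G -> raag G) : total q a = (cnt a (q w) + \sum_(i | i != w) cnt a (q i))%N.
        by rewrite /total (bigD1 w).
      rewrite /d' !tE /=.
      have -> : (\sum_(i | i != w) cnt a (ev f (T i)) = \sum_(i | i != w) cnt a (f i))%N.
        by apply: eq_bigr => u nu; rewrite eT // ev_gn.
      by clear; lia.
    by rewrite /d' cT; have := newW a; clear; lia.
have bw : based dom f w (X t) by [].
have nwv : ~~ star v w by rewrite /star negb_or eq_sym vw.
(* [C] collects the vertices whose based coset lies in [K s]. By [Kreg] the element of the coset is
   immaterial, because the region of such a [u] avoids the label of [K s]. *)
pose C : pred G := fun u : G => [&& ~~ star v u, ~~ dom u v & K s (gx u)].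
have Kreg (u : G) g g' : ~~ star v u -> ~~ dom u v -> based dom f u g -> based dom f u g' ->
    K s g = K s g'.
  move=> nu nd bg bg'; have im := based_uniq domL fE bg bg'.
  rewrite /K /half -[g'](mulVKg g) mulgA hdMr //; apply: inp_sub im => c.
  case/orP=> [dc|ac] /=; apply/eqP => ec.
    by rewrite ec in dc; case/negP: nd; apply: domT dc ds2.
  by rewrite ec in ac; move: nu; rewrite /star -Ladj adj_sym ac orbT.
have Cw : C w.
  apply/and3P; split=> //; have [bgw _] := Hg w.
  case: alt => [[_ eL]|p]; first by case/negP: nD; apply: domT ds2; rewrite -eL.
  by rewrite (Kreg w (gx w) (X t)) //; apply: pre_half.
have C1 (u : G) : C u -> ~~ star v u by case/and3P.
have C2 a b : C a -> ~~ star v b -> adj a b -> C b.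
  case/and3P=> na nda ka nb E; have ndb : ~~ dom b v.
    apply/negP => /domL/lkdomP/(_ a); rewrite adj_sym => /(_ E) E'.
    by rewrite /star E' orbT in na.
  apply/and3P; split=> //; have [r ra rb] := based_adj domL fS fE E.
  rewrite (Kreg b _ r) //; last by have [] := Hg b.
  by rewrite -(Kreg a (gx a)) //; have [] := Hg a.
(* A vertex [e] over the label of [K s] has the link of some [i] over [v]. Along a path outside the
   star of [i], based elements for [F] differ by elements without the letter [e], so their images
   stay on one side of the hyperplane. *)
have C3 x y : C (phi x) -> (forall i, phi i = v -> conn i x y) -> C (phi y).
  move=> Cx cxy; have [->//|nxy] := eqVneq y x; have := Cx => /and3P[nx ndx kx].
  have nxi i : phi i = v -> ~~ star i x.
    by move=> ei; apply: contra nx => /(star_phi phi); rewrite ei.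
  have ny : ~~ star v (phi y).
    apply/negP => sy; have [i ei iy] : exists2 i, phi i = v & star i y.
      case/orP: sy => [/eqP e|]; first by exists y; rewrite // /star eqxx.
      by rewrite adj_sym => /cov_lift[i E e]; exists i => //; rewrite /star adj_sym E orbT.
    by have := conn_star (cxy i ei) (nxi i ei); rewrite iy.
  (* A vertex dominated by [i] has all its neighbours in the star of [i], so outside that star it is
     connected only to itself. *)
  have ndy : ~~ dom (phi y) v.
    apply/negP => /pldom_lift[i /lkdomP h ei].
    have : conn i y x by rewrite conn_sym; apply: cxy.
    case/connectP=> [[|z p]] /=; first by move=> _ e; rewrite e eqxx in nxy.
    by case/andP=> /and3P[/h E _ + _ _]; rewrite /star E orbT.
    have idl (x1 y1 : L) : lkdom x1 y1 -> lkdom x1 y1 by [].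
  have exg (z : L) : exists r : raag L, based (@lkdom L) F z r.
    by have [r br _] := based_ex idl FS z; exists r.
  have [gL HgL] := fin_all_exists exg.
  have pb z : based dom f (phi z) (push phi (gL z)).
    have := push_inp (Q := dom (phi z)) (@pldomI _ _ phi z) (HgL z).
    by rewrite !pushM pushV lf.
  apply/and3P; split=> //.
  rewrite (Kreg (phi y) _ (push phi (gL y))) //; last by have [] := Hg (phi y).
  rewrite (Kreg (phi x) _ (push phi (gL x))) // in kx; last by have [] := Hg (phi x).
  suff im : inp (fun z => phi z != (Lb s).1) ((gL x)^-1 * gL y).
    rewrite -[gL y](mulVKg (gL x)) pushM /K /half mulgA hdMr //.
    exact: push_inp im.
  move=> e; apply: contraTneq => ee.
  have [i ii ei] : exists2 i, lkdom e i & phi i = v by apply: pldom_lift; rewrite ee.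
  have ie : adj i =1 adj e.
    by apply: lkdom_deg_eq ii _; rewrite -!(deg_phi phi) ei ee; apply/lkdom_deg/domL.
  suff : inp (predC1 e) ((gL x)^-1 * gL y).
    by move=> h; apply/negP => /h; rewrite /= eqxx.
  case/connectP: (cxy i ei) => p; elim: p x {Cx cxy nxy nx ndx kx nxi} => [|z p IH] x /=.
    by move=> _ ->; rewrite mulVg; apply: inp1.
  case/andP=> /and3P[E nix niz] pp ey.
  have [r r1 r2] := based_adj idl FS FE E.
  have reg z1 z2 : ~~ star i z1 -> ~~ star i z2 -> adj z1 z2 -> ~~ region lkdom z1 e.
    rewrite /star !negb_or => /andP[_ n1] /andP[_ n2] E12.
    apply/andP; split; last by rewrite adj_sym -ie.
    by apply/negP => /lkdomP/(_ z2 E12); rewrite -ie (negPf n2).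
  have step z1 z2 (r1' r2' : raag L) : ~~ star i z1 -> ~~ star i z2 -> adj z1 z2 ->
      based lkdom F z1 r1' -> based lkdom F z1 r2' -> inp (predC1 e) (r1'^-1 * r2').
    move=> n1 n2 E12 b1 b2; apply: inp_sub (based_uniq idl FE b1 b2) => c.
    by apply: contraTneq => ->; apply: reg E12.
  have -> : (gL x)^-1 * gL y = (gL x)^-1 * r * (r^-1 * gL z) * ((gL z)^-1 * gL y).
    by rewrite -!mulgA !mulVKg.
  apply: inpM; last exact: IH.
  apply: inpM; first exact: step nix niz E (HgL x) r1.
  by apply: step niz nix _ r2 (HgL z); rewrite adj_sym.
exists (pcj v C (~~ s.2)); split.
- by exists (pcj v C (~~ ~~ s.2)); split; [apply: pcj_inv|apply: Lgen_pcj|apply: Lgen_pcj].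
- by apply: glift_pcj => //; apply: lkdom_refl.
apply: (lexpos_lexlt (@mem_degs G)).
pose D a := ((cnt a (X s))%:Z + (a == (Lb s).1)%:Z - (cnt a (X (linv s)))%:Z)%R.
(* The initial part of [gx c] up to the gate of [K s] occurs at both ends of [f c], whence twice the
   saving [D]. *)
have TC c : C c -> forall a, ((cnt a (ev f (pcj v C (~~ s.2) c)))%:Z + D a *+ 2 <= (cnt a (f c))%:Z)%R.
  move=> Cc a; have [bc mc] := Hg c; have := Cc => /and3P[_ _ kc].
  rewrite /pcj Cc !evM // evV // ev_gn // ev_lt //.
  have -> : evl f (v, ~~ s.2) = evl f (linv s) by [].
  have := based_cnt domL fE a bc mc; set k := (gx c)^-1 * f c * gx c => cf.
  have /preE[z ez rz] := half_pre gs kc.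
  have ce : cnt a (gx c) = (cnt a (X s) + (a == (Lb s).1) + cnt a z)%N.
    by rewrite ez rz (gated_rd gs) cnt_lt.
  have -> : evl f (linv s) * f c * (evl f (linv s))^-1 =
      (X (linv s) * z) * k * (X (linv s) * z)^-1.
    have -> : X (linv s) * z = evl f (linv s) * gx c.
      by rewrite esV ez -!mulgA mulKg mulKg.
    by rewrite /k invgM -!mulgA !mulVKg.
  have := cntM_le a (X (linv s) * z * k) (X (linv s) * z)^-1.
  have := cntM_le a (X (linv s) * z) k; have := cntM_le a (X (linv s)) z.
  by rewrite cntV cf ce /D; clear; lia.
have [n nC] : exists n, #|C| = n.+1.
  have cC : 0 < #|C| by apply/card_gt0P; exists w.
  by exists #|C|.-1; rewrite prednK.
pose S a := (\sum_(c | C c) ((cnt a (f c))%:Z - (cnt a (ev f (pcj v C (~~ s.2) c)))%:Z))%R.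
have S1 a : (D a *+ (2 * n.+1) <= S a)%R.
  rewrite mulrnA -nC -sumr_const; apply: ler_sum => c Cc.
  by have := TC c Cc a; clear; lia.
have posD : lexpos degs (fun a => D a *+ (2 * n.+1))%R.
  have [a a1 a2] := lH s; exists a => [|b /a2]; first by rewrite pmulrn_lgt0.
  by rewrite -/(D b) => ->; rewrite mul0rn.
apply: eq_lexpos (lexpos_ge0 posD (d' := fun a => (S a - D a *+ (2 * n.+1))%R) _) => a; last first.
  by have := S1 a; clear; lia.
have sp (q : G -> nat) : (\sum_b q b = \sum_(b | C b) q b + \sum_(b | ~~ C b) q b)%N by rewrite (bigID C).
rewrite addrC subrK /S /total !sp.
have -> : (\sum_(c | ~~ C c) cnt a (ev f (pcj v C (~~ s.2) c)) = \sum_(c | ~~ C c) cnt a (f c))%N.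
  by apply: eq_bigr => c /negPf nc; rewrite /pcj nc ev_gn.
by rewrite sumrB -!(big_morph Posz PoszD (erefl _)) !PoszD; clear; lia.
Qed.

End Step.

(** * Reduction of liftable automorphisms *)

Lemma sym_inv (H : graph) (s s' : H -> H) : cancel s s' -> cancel s' s ->
  (forall a b, adj (s a) (s b) = adj a b) -> inv_pair (fun a => gn (s a)) (fun a => gn (s' a)).
Proof.
move=> e e' h.
have h1 : hom (fun a => gn (s a)) by move=> a b E; apply: lt_comm; rewrite /= h.
have h2 : hom (fun a => gn (s' a)) by move=> a b E; apply: lt_comm; rewrite /= -h !e'.
by split=> // a; rewrite ev_gn ?e ?e'.
Qed.

Section Reduction.
Context {L G : graph} (phi : covering L G).
Implicit Types (u w x y z i j : L) (a b c v : G).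

Lemma LgenK_cancel f T : LgenK phi T -> hom f -> Lgen phi (fun v => ev f (T v)) -> Lgen phi f.
Proof.
move=> [T' [pT LT LT']] hf Lf; have [hT _ _ e] := pT.
apply: Lgen_eq (Lgen_comp Lf LT') => v.
by rewrite -ev_comp // e ev_gn.
Qed.

Definition rows (k : G -> raag G) a : nat := (\sum_(v | star a v) `|chi a (k v)|)%N.

Section Split.
Variables (f f' : G -> raag G) (F F' : L -> raag L).
Hypotheses (pf : inv_pair f f') (pF : inv_pair F F') (lf : lifts phi f F).

Definition split (sigma sigma' : G -> G) (tau tau' : L -> L) :=
  [/\ [/\ cancel sigma sigma', cancel sigma' sigma, cancel tau tau' & cancel tau' tau],
      forall a b, adj (sigma a) (sigma b) = adj a b,
      forall x y, adj (tau x) (tau y) = adj x y,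
      forall x, phi (tau x) = sigma (phi x) &
      (forall v, chi (sigma v) (f v) != 0%R) /\
      forall u w, chi w (F u) != 0%R -> stdom (tau u) w].

(** The odd permutations [sg] of [G] and [s] of [L] are chosen independently, so [s] need not cover
    [sg]. As the entry of [f] at [sg (phi u)] is a fibre sum, some [tau u] over that vertex has a
    nonzero entry in [F u]. Equal degrees make it equivalent to [s u], and [tau] is then a
    symmetry. *)
Lemma split_ex : exists sigma sigma' tau tau', split sigma sigma' tau tau'.
Proof.
have odd_nz (m : int) : odd `|m|%N -> m != 0%R by apply: contraTneq => ->.
have [sg bsg osg] := @odd_permutation G (fun a b => chi a (f b)) (fun a b => chi a (f' b))
  (fun a b => chi_inv_pair a b pf).
have [s bs os] := @odd_permutation L (fun u w => chi u (F w)) (fun u w => chi u (F' w))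
  (fun x y => chi_inv_pair x y pF).
have sg0 v : chi (sg v) (f v) != 0%R by apply/odd_nz/osg.
have s0 u : chi (s u) (F u) != 0%R by apply/odd_nz/os.
have sgadj := sigma_adj pf bsg sg0; have sadj := sigma_adj pF bs s0.
have std := sigma_stdom pF bs s0.
have degE (H : graph) (r : H -> H) : bijective r -> (forall a1 b1 : H, adj (r a1) (r b1) = adj a1 b1) ->
    forall a1 : H, deg (r a1) = deg a1.
  move=> br ra a1; rewrite /deg -[RHS](card_imset (f := r) _ (bij_inj br)); apply: eq_card => z1.
  have [r' e e'] := br; apply/idP/imsetP => [|[c1 + ->]]; rewrite !inE ?ra //.
  by move=> E; exists (r' z1); rewrite ?inE ?e' // -ra e'.
have [tau Ht] : exists tau : L -> L, forall u, phi (tau u) = sg (phi u) /\ chi (tau u) (F u) != 0%R.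
  suff h (u : L) : exists w : L, phi w = sg (phi u) /\ chi w (F u) != 0%R.
    exact: (fin_all_exists h).
  have := sg0 (phi u); rewrite -lf chi_push => nz.
  apply: NNPP => no; case/eqP: nz; apply: big1 => w /eqP e.
  by apply/eqP; apply: contra_notT no => nw; exists w.
have t1 u : stdom (s u) (tau u) by apply: std; have [] := Ht u.
have t2 u : stdom (tau u) (s u).
  apply: stdom_deg_sym (t1 u) _; rewrite -!(deg_phi phi); have [-> _] := Ht u.
  by rewrite (degE _ _ bsg sgadj) !deg_phi (degE _ _ bs sadj).
have tinj : injective tau.
  move=> u w e; have e1 : phi u = phi w.
    by apply: (bij_inj bsg); have [<- _] := Ht u; rewrite e; have [-> _] := Ht w.
  apply: (@stdom_uniq _ _ phi u) e1; first exact: stdom_refl.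
  have [s' es es'] := bs; apply/stdomP => z E.
  have := stdom_trans (t1 u) (eq_ind_r (fun z => stdom z (s w)) (t2 w) e).
  move/stdomP/(_ (s z)); rewrite sadj => /(_ E).
  by rewrite /star (can_eq es) sadj.
have tadj u w : adj u w -> adj (tau u) (tau w).
  move=> E; have EG : adj (phi (tau u)) (phi (tau w)).
    by have [-> _] := Ht u; have [-> _] := Ht w; rewrite sgadj; apply: cov_adj.
  have st z : star (tau w) z -> z = tau u -> adj (tau u) (tau w).
    move=> + ez; rewrite ez => /orP[/eqP e|]; last by rewrite adj_sym.
    by move: EG; rewrite e adj_irr.
  have : star (tau u) (s w) by apply: (stdomP _ _ (t1 u)); rewrite sadj.
  case/orP=> [/eqP e|E2].
    have d : stdom (tau u) (tau w) by rewrite -e; apply: t1.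
    by rewrite -(stdom_adj_phi phi d).
  by apply: (st (tau u)) => //; apply: (stdomP _ _ (t1 w)); rewrite adj_sym.
have [sg' e1 e2] := bsg; have [tau' e3 e4] := injF_bij tinj.
exists sg, sg', tau, tau'; split=> //; first exact: adj_inj_eq.
- by move=> x; have [] := Ht x.
- by split=> // u w /std; apply: stdom_trans (t2 u).
Qed.

Lemma split_glift (R : rel L) sigma sigma' tau tau' : split sigma sigma' tau tau' ->
  (forall u w, chi w (F u) != 0%R -> R (tau u) w) ->
  LgenK phi (fun v => gn (sigma' v)) /\ glift phi R (fun v => ev f (gn (sigma' v))).
Proof.
move=> [[e1 e2 e3 e4] sa ta pt [s0 t0]] FR.
have sa' a b : adj (sigma' a) (sigma' b) = adj a b by rewrite -sa !e2.
have ta' x y : adj (tau' x) (tau' y) = adj x y by rewrite -ta !e4.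
have pt' x : phi (tau' x) = sigma' (phi x) by apply: (can_inj e1); rewrite e2 -pt e4.
have pS := sym_inv e2 e1 sa'; have pT := sym_inv e4 e3 ta'.
split.
  exists (fun v => gn (sigma v)); split=> //.
    by apply: (@Lgen_sym _ _ _ _ tau') => //; [exists sigma|exists tau].
  by apply: (@Lgen_sym _ _ _ _ tau) => //; [exists sigma'|exists tau'].
have [hf _ _ _] := pf; have [hF _ _ _] := pF; have [hS _ _ _] := pS.
exists (fun v => ev (fun a => gn (sigma a)) (f' v)),
  (fun u => ev F (gn (tau' u))), (fun u => ev (fun x => gn (tau x)) (F' u)); split.
- exact: inv_pair_comp.
- exact: inv_pair_comp.
- by apply: lifts_comp => // u; rewrite push_gn pt'.
- by move=> u w; rewrite ev_gn // => /FR; rewrite e4.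
Qed.

Lemma lifts_inv : lifts phi f' F'.
Proof.
have [hf hf' e1 e2] := pf; have [hF hF' e3 e4] := pF; have hp := hom_phi phi.
have com g : ev f (push phi g) = push phi (ev F g).
  rewrite /push !ev_comp //; apply: eq_ev => u; rewrite ev_gn //; exact/esym/lf.
move=> u; rewrite -[LHS](inv_pairK _ pf) com e4 push_gn.
by rewrite ev_gn.
Qed.

(** * The Euclidean algorithm on rows of clique classes *)

Section Rows.
Local Open Scope ring_scope.
Hypothesis Fst : forall u w, chi w (F u) != 0 -> stdom u w.
Let M a v : int := chi a (f v).
Let N a v : int := chi a (f' v).

Let F'st u w : chi w (F' u) != 0 -> stdom u w.
Proof.
have [s bs os] := @odd_permutation L (fun u w => chi u (F w)) (fun u w => chi u (F' w))
  (fun x y => chi_inv_pair x y pF).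
have s0 x : chi (s x) (F x) != 0 by have := os x; case: eqP => [->|].
by apply: (inv_stdom pF bs s0) => x; apply/Fst/s0.
Qed.

Let chi_pdom (k : G -> raag G) K : lifts phi k K -> (forall u w, chi w (K u) != 0 -> stdom u w) ->
  forall a v, chi a (k v) != 0 -> pdom phi v a.
Proof.
move=> lk Kst a v; have [u <-] := cov_surj phi v => nz.
by have [w [<- d _]] := chi_lift_ex lk (@Kst u) nz; apply: pdomI.
Qed.

Let Mdom a v : M a v != 0 -> pdom phi v a. Proof. exact: chi_pdom lf Fst _ _. Qed.
Let Ndom a v : N a v != 0 -> pdom phi v a. Proof. exact: chi_pdom lifts_inv F'st _ _. Qed.

Definition clique a := [forall b, pdom phi a b && pdom phi b a ==> star a b].
(** The obstruction to link domination: a dominating pair of adjacent vertices with nonzero entry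
    creates a crowded row, see [uncrowded_lkdom]. *)
Definition crowded a := clique a && [exists b, exists c,
  [&& b != c, star a b, star a c, chi a (f b) != 0 & chi a (f c) != 0]].

Let cliqueP a b : clique a -> pdom phi a b -> pdom phi b a -> star a b.
Proof. by move=> /forallP/(_ b)/implyP h d1 d2; apply: h; rewrite d1. Qed.

Let star_class a b c : clique a -> pdom phi a b -> pdom phi b a -> star a c = star b c.
Proof.
move=> ca d1 d2; have := cliqueP ca d1 d2; rewrite /(star a b) => /orP[/eqP->//|E].
apply/idP/idP; apply: stdom_star => //; try exact: pdom_stdom d1; try exact: pdom_stdom d2.
by rewrite adj_sym.
Qed.

Let clique_class a b : clique a -> pdom phi a b -> pdom phi b a -> clique b.
Proof.
move=> ca d1 d2; apply/forallP => v; apply/implyP => /andP[d3 d4].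
rewrite -(star_class v ca d1 d2); apply: cliqueP => //.
  exact: pdom_trans d3.
exact: pdom_trans d2.
Qed.

Let MN a b : \sum_c M a c * N c b = (a == b)%:R.
Proof. exact: chi_inv_pair. Qed.

(* Euclidean algorithm on row [s] with pivot [b] such that [N b s != 0]: as
   [M N = 1], an uncrowded row of the class of [s] vanishes at [b], so that the
   reduction leaves the earlier rows unchanged. *)
Lemma crowded_step : (exists a, crowded a) -> exists T,
  [/\ LgenK phi T, glift phi stdom T & lexlt degs (rows (fun v => ev f (T v))) (rows f)].
Proof.
case=> a0 cr0; have [s crs smin] := @arg_minnP _ a0 crowded (index^~ degs) cr0.
have /andP[cs /existsP[b1 /existsP[b2 /and5P[b12 sb1 sb2 Mb1 Mb2]]]] := crs.
pose B b := [&& pdom phi s b, pdom phi b s, M s b != 0 & N b s != 0].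
have Bex : exists b, B b.
  apply: NNPP => nB; have := MN s s; rewrite eqxx big1 // => c _.
  apply/eqP; apply: contra_notT nB; rewrite mulf_eq0 negb_or => /andP[h1 h2].
  by exists c; apply/and4P; split=> //; [apply: Ndom|apply: Mdom].
have [b0 Bb0] := Bex.
have [b /and4P[d1 d2 Mb Nb] bmin] := @arg_minnP _ b0 B (fun c => `|M s c|%N) Bb0.
(* Otherwise the other nonzero entries in the star are smaller than the pivot, so by its minimality
   they contribute nothing to the diagonal entry of [M N]. The pivot is then a unit and the others
   vanish, against crowding. *)
have [v [sv nvb Mv Mvb]] : exists v, [/\ star s v, v != b, M s v != 0 & (`|M s b| <= `|M s v|)%N].
  apply: NNPP => no.
  have small v : star s v -> v != b -> M s v != 0 -> (`|M s v| < `|M s b|)%N.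
    by move=> h1 h2 h3; rewrite ltnNge; apply: contra_notN no => h4; exists v.
  have e1 : M s b * N b s = 1.
    have := MN s s; rewrite eqxx (bigD1 b) //= big1 ?addr0 // => c ncb.
    apply/eqP; apply: contraT; rewrite mulf_eq0 negb_or => /andP[h1 h2].
    have e3 := Mdom h1; have e4 := Ndom h2.
    have := bmin c; rewrite /B h1 h2 e3 e4 => /(_ isT).
    by rewrite leqNgt small //; apply: cliqueP.
  have e2 : (`|M s b| <= 1)%N.
    by move/(congr1 absz): e1; rewrite abszM => /eqP; rewrite muln_eq1 => /andP[/eqP-> _].
  have [e|n1] := eqVneq b1 b.
    have n2 : b2 != b by rewrite -e eq_sym.
    by have := small _ sb2 n2 Mb2; have : (0 < `|M s b2|)%N; [rewrite absz_gt0|lia].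
  by have := small _ sb1 n1 Mb1; have : (0 < `|M s b1|)%N; [rewrite absz_gt0|lia].
have vb := pdom_trans (Mdom Mv) d1.
(* Equal signs require [b^-1], so that column [b] is subtracted from column [v]. *)
pose e := (0 < M s v) == (0 < M s b).
exists (tv v b e); split.
- by exists (tv v b (~~ e)); split; [apply: (tv_inv nvb vb)|apply: Lgen_tv|apply: Lgen_tv].
- exact: glift_tv.
have [hf _ _ _] := pf.
have T1 c : c != v -> ev f (tv v b e c) = f c.
  by move=> /negPf nc; rewrite /tv /mtv /= nc ev_gn.
have T2 a : chi a (ev f (tv v b e v)) = M a v + (-1) ^+ e * M a b.
  rewrite /tv /mtv /= eqxx evM // ev_gn // chiM ev_lt // /evl /=; congr (_ + _).
  by case: (e); rewrite ?chiV /= ?expr1 ?expr0 ?mulN1r ?mul1r.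
exists s; split; first exact: mem_degs.
  rewrite /rows (bigD1 v) //= [X in (_ < X)%N](bigD1 v) //= T2.
  rewrite [X in (_ + X < _)%N](eq_bigr (fun c => `|chi s (f c)|%N)); last first.
    by move=> c /andP[_ nc]; rewrite T1.
  rewrite ltn_add2r -/(M s v) /e; move: (M s v) (M s b) Mv Mb Mvb; clear => m n.
  by case: (ltrP 0 m) (ltrP 0 n) => [m0|m0] [n0|n0] /=; rewrite ?expr1 ?expr0 ?mulN1r ?mul1r; lia.
move=> a ai; apply: eq_leq; apply: eq_bigr => c sc.
have [ec|nc] := eqVneq c v; last by rewrite T1.
rewrite ec T2; have [->|Mab] := eqVneq (M a b) 0; first by rewrite mulr0 addr0.
have sa := pdom_trans d1 (Mdom Mab).
have as_ := pdom_deg_sym sa (degs_mono (ltnW ai)).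
have ca := clique_class cs sa as_.
have ncr : ~~ crowded a by apply: contraL ai => /smin; rewrite -leqNgt.
have starE c1 : star s c1 = star a c1 by apply: star_class.
have := MN a s; rewrite (bigD1 b) //= big1 ?addr0.
  have -> : (a == s) = false by apply: contraTF ai => /eqP->; rewrite ltnn.
  by move/eqP; rewrite mulf_eq0 (negPf Mab) (negPf Nb).
move=> c1 nc1; apply/eqP; apply: contraT; rewrite mulf_eq0 negb_or => /andP[h1 h2].
case/negP: ncr; rewrite /crowded ca; apply/existsP; exists c1; apply/existsP; exists b.
rewrite nc1 h1 Mab -!starE !cliqueP //; first exact: Ndom.
exact: pdom_trans (Mdom h1) as_.
Qed.

(** If [w] were adjacent to [tau u], the class of [phi w] would be a clique, and its row would have
    two nonzero entries in its star: at [phi u], and at the preimage of [phi w] under [sigma]. *)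
Lemma uncrowded_lkdom sigma sigma' tau tau' : (forall a, ~~ crowded a) ->
  split sigma sigma' tau tau' -> forall u w, chi w (F u) != 0 -> lkdom (tau u) w.
Proof.
move=> nc [[e1 e2 e3 e4] sa ta pt [s0 t0]] u w nz.
have d := t0 u w nz; apply: stdom_lkdom (d); apply/negP => E.
set x := phi (tau u); set s := phi w.
have Exs : adj x s by apply: cov_adj.
have xs : pdom phi x s by apply: pdomI.
have degE v : deg (sigma v) = deg v.
  rewrite /deg -[RHS](card_imset (f := sigma) _ (can_inj e1)); apply: eq_card => c.
  apply/idP/imsetP => [|[b + ->]]; rewrite !inE ?sa //.
  by move=> E'; exists (sigma' c); rewrite ?inE ?e2 // -sa e2.
have vs a v : M a v != 0 -> deg a = deg v -> pdom phi v a /\ pdom phi a v.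
  by move=> h ed; split; [apply: Mdom|apply: pdom_deg_sym (Mdom h) _; rewrite ed].
have [vx xv] := vs _ _ (s0 (phi u)) (degE _); rewrite -pt -/x in vx xv.
have [vs' sv'] := vs _ _ (s0 (sigma' s)) (degE _); rewrite e2 in vs' sv'.
have cs : clique s.
  apply/forallP => b; apply/implyP => /andP[sb bs].
  have h : star b x by apply: (stdomP _ _ (pdom_stdom sb)); rewrite adj_sym.
  by apply: (stdom_star Exs (pdom_stdom xs)); rewrite star_sym.
case/negP: (nc s); rewrite /crowded cs; apply/existsP; exists (phi u); apply/existsP.
exists (sigma' s); apply/and5P; split.
- apply: contraTneq Exs => e; rewrite /x pt e e2; exact/negbT/adj_irr.
- by rewrite star_sym; apply: (stdomP _ _ (pdom_stdom xv)).
- exact: cliqueP.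
- by rewrite (chi_lift lf (@Fst u)) //; apply: Fst.
- by have := s0 (sigma' s); rewrite e2.
Qed.

End Rows.
End Split.


Lemma lkdom_Lgen f : glift phi lkdom f -> Lgen phi f.
Proof.
move: (lexlt_wf degs (total f)); move e: (total f) => r wf.
elim: wf f e => {}r _ IH f er gf.
have [f' [F [F' [pf pF lf FR]]]] := gf; have [hf _ _ _] := pf.
have [[la [b Hf]]|[T [KT gT lT]]] := descent_step pf pF lf FR; last first.
  apply: LgenK_cancel KT (hf) _; apply: IH (erefl _) _; first by rewrite -er.
  by apply: glift_comp => //; apply: lkdom_trans.
(* Every image is now a single letter, so the nonzero entry at [sm v] identifies [la] with the
   symmetry [sm]; dividing by it leaves an inversion. *)
have [sm [sm' [tau [tau' spl]]]] := split_ex pf pF lf.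
have [[_ e2 _ _] _ _ _ [s0 t0]] := spl.
have [KT _] := split_glift pf pF lf spl (R := fun _ _ => true) (fun _ _ _ => isT).
apply: LgenK_cancel KT (hf) _.
apply: (@Lgen_eq _ _ _ (invs (fun v => b (sm' v)))); last exact: Lgen_inv.
move=> v; rewrite ev_gn // /invs; have [e _ _] := Hf (sm' v).
rewrite e; have := s0 (sm' v); rewrite e e2 chi_lt /sg /=.
by have [->|] := eqVneq (la (sm' v)) v; rewrite ?eqxx.
Qed.

Lemma stdom_Lgen f : glift phi stdom f -> Lgen phi f.
Proof.
move: (lexlt_wf degs (rows f)); move e: (rows f) => r wf.
elim: wf f e => {}r _ IH f er gf.
have [f' [F [F' [pf pF lf FR]]]] := gf; have [hf _ _ _] := pf.
have [ex|nex] := classic (exists a, crowded f a).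
  have [T [KT gT lT]] := crowded_step pf pF lf FR ex.
  apply: LgenK_cancel KT (hf) _; apply: IH (erefl _) _; first by rewrite -er.
  by apply: glift_comp => //; apply: stdom_trans.
have [sm [sm' [tau [tau' spl]]]] := split_ex pf pF lf.
have nc a : ~~ crowded f a by apply/negP => ca; apply: nex; exists a.
have [KT gT] := split_glift pf pF lf spl (uncrowded_lkdom lf FR nc spl).
exact: LgenK_cancel KT (hf) (lkdom_Lgen gT).
Qed.

Lemma lifts_Lgen f f' F F' : inv_pair f f' -> inv_pair F F' -> lifts phi f F -> Lgen phi f.
Proof.
move=> pf pF lf; have [sm [sm' [tau [tau' spl]]]] := split_ex pf pF lf.
have [hf _ _ _] := pf; have [|KT gT] := split_glift pf pF lf spl (R := stdom).
  by case: spl => _ _ _ _ [].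
exact: LgenK_cancel KT (hf) (stdom_Lgen gT).
Qed.

End Reduction.

(** * Translation to words *)

Section Words.
Context {G : graph}.
Implicit Types (f g : G -> word G).

Definition hm f (v : G) : raag G := wd (f v).

Lemma wd_subst f w : wd (subst f w) = evw (hm f) w.
Proof.
elim: w => [|x w IH] //; rewrite /= wd_cat -IH; congr (_ * _).
by rewrite /evl; case: x.2; rewrite ?wd_inv.
Qed.

Lemma hm_comp f g : hom (hm f) -> hm (comp_end f g) =1 (fun v => ev (hm f) (hm g v)).
Proof. by move=> hf v; rewrite /hm /comp_end wd_subst -ev_wd. Qed.

Lemma is_homP f : is_hom adj adj f <-> hom (hm f).
Proof.
split=> h u v E; first by have /wdP := h u v E; rewrite !wd_cat.
by apply/wdP; rewrite !wd_cat; apply: h.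
Qed.

Lemma end_eqP f g : end_eq adj f g <-> hm f =1 hm g.
Proof. by split=> h v; [apply/wdP/h|apply/wdP/(h v)]. Qed.

Lemma hm_rword (T : G -> raag G) : hm (fun v => rword (T v)) =1 T.
Proof. by move=> v; apply: rwordK. Qed.

Lemma is_autP f : is_aut adj f <-> exists k, inv_pair (hm f) k.
Proof.
split=> [[/is_homP hf [g [/is_homP hg [e1 e2]]]]|[k [hf hk e1 e2]]].
  by exists (hm g); split=> // v; rewrite -hm_comp //; apply/wdP; [apply: e1|apply: e2].
have h' : hom (hm (fun v => rword (k v))) by move=> u v E; rewrite !hm_rword; apply: hk.
split; first exact/is_homP.
exists (fun v => rword (k v)); split; first exact/is_homP.
split; apply/(end_eqP (comp_end _ _) (@gen_word G)) => v; rewrite hm_comp //.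
  by rewrite (eq_ev _ (hm_rword k)) e1.
by rewrite hm_rword e2.
Qed.

End Words.

Section Generation.
Context {L G : graph} (phi : covering L G).
Implicit Types (f g : G -> word G) (T : G -> raag G).

Lemma wd_map_word (w : word L) : wd (map_word phi w) = push phi (wd w).
Proof.
elim: w => [|x w IH]; first by rewrite /= !wd0 push1.
by rewrite /= !wd_cons IH pushM; case: x => u s; rewrite push_lt.
Qed.

Definition alift T := glift phi (fun _ _ => true) T.

Lemma liftableP f : liftable adj adj phi f <-> alift (hm f).
Proof.
split=> [[/is_autP[f' pf] [F [/is_autP[F' pF] lf]]]|[f' [F [F' [pf pF lf _]]]]].
  exists f', (hm F), F'; split=> // u.
  by rewrite /hm -wd_map_word; apply/esym/wdP.
split; first by apply/is_autP; exists f'.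
exists (fun u => rword (F u)); split.
  by apply/is_autP; exists F'; apply: inv_pair_eq pF => // u; rewrite hm_rword.
by move=> u; apply/wdP; rewrite wd_map_word rwordK lf.
Qed.

Lemma glift_alift (R : rel L) T : glift phi R T -> alift T.
Proof. by move=> [f' [F [F' [pf pF lf _]]]]; exists f', F, F'. Qed.

Lemma alift_comp T1 T2 : alift T1 -> alift T2 -> alift (fun v => ev T1 (T2 v)).
Proof. exact: glift_comp. Qed.

Lemma Lgen_alift T : Lgen phi T -> alift T.
Proof.
elim=> {T} [v b s vb d|s|v C s c1 c2 c3|sm tau bs bt sa ta pt|T1 T2 _ h1 _ h2|T1 T2 e _ h].
- exact/glift_alift/glift_tv.
- exact: glift_inv.
- exact: glift_pcj.
- have [sm' e1 e2] := bs; have [tau' e3 e4] := bt.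
  exists (fun a => gn (sm' a)), (fun u => gn (tau u)), (fun u => gn (tau' u)).
  by split=> //; [apply: sym_inv|apply: sym_inv|move=> u; rewrite push_gn pt].
- exact: alift_comp.
- exact: glift_eq e h.
Qed.

Let gens := gen_aut adj (LAut_gens adj adj phi).

Let gens_eq f T : hm f =1 T -> gens f -> gens (fun v => rword (T v)).
Proof.
move=> e gf; apply: gen_eq gf _; apply/end_eqP => v.
by rewrite e hm_rword.
Qed.

Let gens_inv T T' : inv_pair T T' -> gens (fun v => rword (T v)) -> gens (fun v => rword (T' v)).
Proof.
move=> [h h' e e'] gT.
have r1 : hom (hm (fun v => rword (T v))) by move=> u v E; rewrite !hm_rword; apply: h.
have r2 : hom (hm (fun v => rword (T' v))) by move=> u v E; rewrite !hm_rword; apply: h'.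
apply: gen_inv gT _ _ _; first exact/is_homP.
  by apply/end_eqP => v; rewrite hm_comp // (eq_ev _ (hm_rword T')) hm_rword e.
by apply/end_eqP => v; rewrite hm_comp // (eq_ev _ (hm_rword T)) hm_rword e'.
Qed.

(** The listed transvections and partial conjugations have the positive sign; those of the other
    sign enter as their inverses. *)
Lemma Lgen_gens T : Lgen phi T -> gens (fun v => rword (T v)).
Proof.
elim=> {T} [v b s vb d|s|v C s c1 c2 c3|sm tau bs bt sa ta pt|T1 T2 L1 h1 L2 h2|T1 T2 e _ h].
- suff h : gens (fun a => rword (tv v b false a)).
    by case: s => //; apply: gens_inv h; apply: (tv_inv vb d false).
  pose f0 a : word G := if a == v then [:: (v, false); (b, false)] else gen_word a.
  have e : hm f0 =1 tv v b false.
    move=> a; rewrite /hm /f0 /tv /mtv /=; case: eqP => [->|//].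
    by rewrite -wd_cat.
  apply: (gens_eq e); apply: gen_base; right; right; left; split.
    exists b, v; split; first by rewrite eq_sym.
    split=> // w E; have /stdomP/(_ w E) := pdom_stdom d.
    by case/orP=> [/eqP|]; [left|right].
  by apply/liftableP/(glift_eq (fsym e)); apply: glift_alift (glift_tv false vb d).
- pose f0 a : word G := [:: (a, s a)].
  apply: (@gens_eq f0) => //; apply: gen_base; right; left.
  by exists s.
- suff h : gens (fun a => rword (pcj v C false a)).
    by case: s => //; apply: gens_inv h; apply: (pcj_inv c1 c2 false).
  pose f0 a : word G := if a \in [set x | C x] then [:: (v, false); (a, false); (v, true)]
    else gen_word a.
  have e : hm f0 =1 pcj v C false.
    move=> a; rewrite /hm /f0 /pcj inE; case: ifP => // _.
    by rewrite !wd_cons wd0 mulg1 -mulgA -lt_inv.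
  apply: (gens_eq e); apply: gen_base; right; right; right; split.
    exists v, [set x | C x]; split=> [x|]; first by rewrite inE => /c1; rewrite /star negb_or => /andP.
    split=> // x y; rewrite !inE => Cx nv nE; apply: c2 => //.
    by rewrite /star negb_or nv.
  by apply/liftableP/(glift_eq (fsym e)); apply: glift_pcj.
- apply: (@gens_eq (fun a => gen_word (sm a))) => //; apply: gen_base; left; split.
    by exists sm.
  by apply/liftableP/Lgen_alift/(Lgen_sym bs bt sa ta pt).
- apply: gen_eq (gen_mul h2 h1) _; apply/end_eqP => v.
  rewrite hm_rword hm_comp ?hm_rword; first by apply: eq_ev; apply: hm_rword.
  have [T1' [F [F' [[hT _ _ _] _ _ _]]]] := Lgen_alift L1.
  by move=> x y E; rewrite !hm_rword; apply: hT.
- by apply: gens_eq h => v; rewrite hm_rword e.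
Qed.

Lemma liftable_gens f : liftable adj adj phi f <-> gens f.
Proof.
split=> [/liftableP[f' [F [F' [pf pF lf _]]]]|].
  by apply: gen_eq (Lgen_gens (lifts_Lgen pf pF lf)) _; apply/end_eqP/hm_rword.
elim=> {f} [f|| f g _ /liftableP hf _ /liftableP hg|f g _ /liftableP hf /is_homP hg /end_eqP e1 /end_eqP e2|
            f g _ /liftableP hf /end_eqP e].
- case=> [[]|[|[[]|[]]]] //; case=> b e; apply/liftableP.
  apply: (@glift_eq _ _ _ _ (invs b)); last exact: glift_inv.
  by move=> v; rewrite /hm e.
- by apply/liftableP; apply: (@glift_eq _ _ _ _ (invs xpred0)); last exact: glift_inv.
- have hgh : hom (hm g) by case: hg => g' [F [F' [[]]]].
  by apply/liftableP; apply: glift_eq (fsym (hm_comp _ hgh)) _; apply: alift_comp.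
- have [f' [F [F' [pf pF lf _]]]] := hf; have [hf1 _ _ _] := pf.
  have pfg : inv_pair (hm f) (hm g).
    by split=> // v; rewrite -hm_comp // ?e1 ?e2.
  apply/liftableP; exists (hm f), F', F; split=> //; try exact: inv_pair_sym.
  exact: lifts_inv pfg pF lf.
- by apply/liftableP; apply: glift_eq e hf.
Qed.

End Generation.

Theorem theorem6p2 (W V : finType) (EL : rel W) (EG : rel V) (phi : W -> V) :
  simple_graph EL -> simple_graph EG ->
  regular_covering EL EG phi ->
  no_isolated EG ->
  forall f : V -> word V,
    liftable EL EG phi f <-> gen_aut EG (LAut_gens EL EG phi) f.
Proof.
move=> [symL irrL] [symG irrG] [[surj [cadj loc]] deck] noiso.
pose LL := Graph symL irrL; pose GG := Graph symG irrG.
have c_inj (u u1 u2 : LL) : adj u u1 -> adj u u2 -> phi u1 = phi u2 -> u1 = u2.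
  by have [h _] := loc u; apply: h.
have c_lift (u : LL) (v : GG) : adj (phi u : GG) v -> exists2 w : LL, adj u w & phi w = v.
  by have [_ h] := loc u; move=> /h[w [E e]]; exists w.
have c_deck (u w : LL) : phi u = phi w -> exists mu : LL -> LL,
    [/\ forall a b, adj (mu a) (mu b) = adj a b, injective mu,
        forall a, phi (mu a) = phi a & mu u = w].
  by move=> /deck[mu [[[bmu amu] pmu] e]]; exists mu; split=> //; apply: bij_inj.
exact: (liftable_gens (@Covering LL GG phi surj cadj c_inj c_lift c_deck noiso)).
Qed.
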